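(* Let $D\subset\mathbb{RP}^2$ be a connected, non-local diagram of an oriented nullhomologous link in $\mathbb{RP}^3$. Then there is a differential $\partial=\partial_+\oplus\partial_-$ on the space $\mathcal{C}(D)=\mathcal{C}_+(D)\oplus\mathcal{C}_-(D)$ generated by spanning trees of the two Tait graphs of $D$, with $\partial_+:\mathcal{C}_+\to\mathcal{C}_+$ of $(u,v)$-bidegree $(-1,-1)$ and $\partial_-:\mathcal{C}_-\to\mathcal{C}_-$ of $(u,v)$-bidegree $(1,1)$, such that the resulting spanning tree complex $\{\mathcal{C}_+(D)\oplus\mathcal{C}_-(D),\partial_+\oplus\partial_-\}$ is a deformation retract of the reduced Khovanov complex $\widetilde{C}(D)$ over $\mathbb{F}=\mathbb{Z}/2\mathbb{Z}$.
   Context: Diagrams and Tait graphs. Links in $\mathbb{RP}^3$ are represented by diagrams $D\subset\mathbb{RP}^2$, drawn in a disk with antipodal boundary points identified, over/under information as seen in the disk. $D$ is local if it is contained in a disk in $\mathbb{RP}^2$. Nullhomologous links ($[L]=0\in H_1(\mathbb{RP}^3;\mathbb{F})$) have checkerboard colorable diagrams; for each of the two colorings the Tait graph, embedded in $\mathbb{RP}^2$, has one vertex per black region and one edge per crossing, with sign $+$ if rotating the over-strand counterclockwise sweeps out the black regions and $-$ otherwise. Let $e_\pm(\cdot)$ be the number of $\pm$ edges. $G_+$ denotes the Tait graph with $e_+(G)\ge e_-(G)$ and $G_-$ the other one (for which $e_-\ge e_+$); if $e_+=e_-$ the names are assigned arbitrarily. Activities. Order the crossings (hence the edges). For a spanning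 tree $T$ and edge $e\in T$, $\mathsf{Cut}(T,e)$ is the set of edges of $G$ joining the two components of $T-e$; for $e\notin T$, $\mathsf{Cyc}(T,e)$ is the unique cycle of $T\cup e$. An edge $e\in T$ is internally active if it is the smallest edge of $\mathsf{Cut}(T,e)$; $e\notin T$ is externally active if it is smallest in $\mathsf{Cyc}(T,e)$, and then locally externally active if $[\mathsf{Cyc}(T,e)]=0\in H_1(\mathbb{RP}^2)$. Let $\#L,\#\bar L$ be the numbers of internally active $+$, respectively $-$, edges and $\#\ell_{\mathrm{loc}},\#\bar\ell_{\mathrm{loc}}$ the numbers of locally externally active $+$, respectively $-$, edges. Spanning tree space. For a spanning tree $T\subset G_\pm$ put $u(T)=\pm(\#L-\#\ell_{\mathrm{loc}}-\#\bar L+\#\bar\ell_{\mathrm{loc}})$ and $v(T)=e_\pm(T)$ (the number of edges of $T$ of sign $\pm$). $\mathcal{C}_\pm^{u,v}(D)$ is the $\mathbb{F}$-vector space with basis the spanning trees $T\subset G_\pm$ with $u(T)=u$, $v(T)=v$; $\mathcal{C}_\pm(D)=\bigoplus_{u,v}\mathcal{C}_\pm^{u,v}(D)$. The cohomological degree of $T\subset G_\pm$ is $i(T)=\pm(u-2v)+\frac{w(D)\pm k_\pm}{2}$, where $w(D)$ is the writhe and $k_\pm=\pm(e_+(G_\pm)-e_-(G_\pm))+2(v(G_\pm)-1)$, $v(G_\pm)$ being the number of vertices. Reduced Khovanov complex. For $\mathbf v\in\{A,B\}^n$ ($n$ the number of crossings; the $A$-smoothing joins the two regions swept by rotating the over-strand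 counterclockwise) all circles of the resolution $D_{\mathbf v}$ are null-homotopic; $\widehat C(D)=\bigoplus_{\mathbf v}V^{\otimes\#\text{circles}(D_{\mathbf v})}$, $V=\mathbb{F}\langle1,X\rangle$. The differential sums over changes of one $A$- to a $B$-smoothing the maps: merge ($1\otimes1\mapsto1$; $1\otimes X,X\otimes1\mapsto X$; $X\otimes X\mapsto0$), split ($1\mapsto1\otimes X+X\otimes1$; $X\mapsto X\otimes X$), and $0$ when the number of circles does not change. The cohomological degree is $i=\#(B\text{-smoothings})-n_-$, $n_-$ the number of negative crossings. Fixing a basepoint on $D$ away from crossings, $\widetilde{C}(D)$ is the subcomplex spanned by generators in which the circle containing the basepoint is labeled $X$. A complex $\mathcal{C}$ is a deformation retract of $\widetilde{C}$ if there are chain maps $r:\widetilde C\to\mathcal C$, $f:\mathcal C\to\widetilde C$ with $rf=\mathrm{id}$ and $fr$ chain homotopic to the identity. *)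

(* Defs.v *)
From HB Require Import structures.
From mathcomp Require Import all_boot all_order all_algebra.

Set Implicit Arguments.
Unset Strict Implicit.
Unset Printing Implicit Defensive.

Import Order.TTheory GRing.Theory Num.Theory.
Local Open Scope ring_scope.

(* A diagram in RP^2, drawn in a disk with antipodal boundary points          *)
(* identified, is encoded by the 4-valent graph it forms, i.e. as a signed    *)
(* rotation system.  Crossing c has four ends (c, 0), ..., (c, 3), listed     *)
(* counterclockwise as seen in the disk and numbered so that the over-strand  *)
(* runs between the ends 0 and 2.  [arc] sends an end to the other end of its *)
(* arc, and [wraps d] says whether the arc through d passes through the       *)
(* boundary of the disk an odd number of times; each such passage reverses    *)
(* the orientation of the plane of the picture.                               *)
(* The crossings are ordered by their index in 'I_n; this order is arbitrary, *)
(* as nothing in a diagram constrains the numbering of its crossings.         *)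

Record rotation_system := RotationSystem {
  ncross : nat;
  arc : 'I_ncross * 'I_4 -> 'I_ncross * 'I_4;
  wraps : 'I_ncross * 'I_4 -> bool;
  arcK : involutive arc;
  arc_neq : forall d, arc d != d;
  wraps_arc : forall d, wraps (arc d) = wraps d }.

Definition crossing (D : rotation_system) : finType := 'I_(ncross D).
Definition dart (D : rotation_system) : finType := (crossing D * 'I_4)%type.

Section Regions.
Variable D : rotation_system.
Implicit Types (d x y : dart D) (c : crossing D).

Definition turn d (k : 'I_4) : dart D := (d.1, d.2 + k).

(* The element (c, i) of [dart D] also names the corner of c lying between    *)
(* the ends i and i + 1.  [corner d true] and [corner d false] are the two    *)
(* corners flanking the end d: on its left and on its right, when looking     *)
(* from the crossing along d.                                                 *)
Definition corner d (left : bool) : dart D :=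
  if left then d else turn d (-1).

(* From corner x to corner y along one side of an arc that crosses the        *)
(* boundary of the disk t (mod 2) times.  The left side at one end of an arc  *)
(* is the right side as seen from the other end, unless the arc wraps.        *)
Definition region_step (t : bool) : rel (dart D) := fun x y =>
  [exists d : dart D, exists left : bool,
    [&& wraps d == t, x == corner d left
      & y == corner (arc d) (left (+) ~~ t)]].

Definition region_adj : rel (dart D) :=
  fun x y => [exists t, region_step t x y].

(* A region of the complement of D, as the set of its corners.                *)
Definition region x : {set dart D} := [set y | connect region_adj x y].
Definition regions : {set {set dart D}} := [set region x | x : dart D].

Definition crossing_adj : rel (crossing D) :=
  fun c c' => [exists i : 'I_4, (arc (c, i)).1 == c'].

Definition component c : {set crossing D} :=
  [set c' | connect crossing_adj c c'].
Definition components : {set {set crossing D}} :=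
  [set component c | c : crossing D].

(* Capping off a thickening of D with disks yields a closed surface with      *)
(* ncross - 2 ncross + #|regions| as Euler characteristic; it has Euler genus *)
(* at most 1 (i.e., D embeds in RP^2) iff this number is at least             *)
(* 2 #|components| - 1.                                                       *)
Definition in_RP2 : Prop :=
  (ncross D + 2 * #|components| <= #|regions| + 1)%N.

Definition connected_diagram : Prop :=
  forall c c' : crossing D, connect crossing_adj c c'.

(* Contained in a disk of RP^2: after moving the crossings c with [push c]    *)
(* through the boundary of the drawing disk, no arc has to pass through it.   *)
Definition local_diagram : Prop :=
  exists push : crossing D -> bool,
    forall d, wraps d = push d.1 (+) push (arc d).1.

End Regions.

(* Diagrams without crossing-free components.  A connected diagram with no    *)
(* crossing is a circle, either local or not nullhomologous.                  *)
Record diagram := Diagram {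
  diagram_map :> rotation_system;
  diagram_in_RP2 : in_RP2 diagram_map }.

(* [outgoing d] : the orientation of the link leaves the crossing at the end  *)
(* d.                                                                         *)
Record orientation (D : rotation_system) := Orientation {
  outgoing : dart D -> bool;
  outgoing_arc : forall d : dart D, outgoing (arc d) = ~~ outgoing d;
  outgoing_through : forall d : dart D, outgoing (turn d 2) = ~~ outgoing d }.

Section Oriented.
Variables (D : rotation_system) (o : orientation D).

(* The class of the link in H_1(RP^3; Z/2) = Z/2 is its number of             *)
(* intersections with the projective plane at infinity.  Every arc leaves     *)
(* exactly one crossing end.                                                  *)
Definition nullhomologous : Prop :=
  ~~ odd #|[set d : dart D | outgoing o d && wraps d]|.

(* Positive: the over-strand direction followed by the under-strand direction *)
(* is a counterclockwise frame.                                               *)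
Definition positive_crossing (c : crossing D) : bool :=
  outgoing o (c, 0) == outgoing o (c, 1).

Definition n_minus : nat := #|[set c | ~~ positive_crossing c]|.
Definition writhe : int :=
  #|[set c | positive_crossing c]|%:Z - n_minus%:Z.

End Oriented.

Record multigraph (V E : finType) := Multigraph {
  vertices : {set V};
  ends : E -> V * V }.

Section Graphs.
Variables (V E : finType) (G : multigraph V E).
Implicit Types (H T : {set E}) (e f : E).

Definition edge_adj H : rel V := fun u v =>
  [exists e in H, (ends G e == (u, v)) || (ends G e == (v, u))].

Definition joined H e : bool :=
  connect (edge_adj H) (ends G e).1 (ends G e).2.

(* e lies on a cycle of H: that cycle is e followed by a path of H - e        *)
(* between the ends of e.                                                     *)
Definition on_cycle H e : bool := (e \in H) && joined (H :\ e) e.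

Definition spanning_tree T : bool :=
  [forall u in vertices G, forall v in vertices G,
     connect (edge_adj T) u v] && [forall e, ~~ on_cycle T e].

Definition tree : finType := {T : {set E} | spanning_tree T}.

Definition Cut T e : {set E} := [set f | ~~ joined (T :\ e) f].
Definition Cyc T e : {set E} := [set f | on_cycle (e |: T) f].

End Graphs.

Section Tait.
Variable D : rotation_system.

(* A coloring is given by the set of its black corners. *)
Definition checkerboard (black : {set dart D}) : Prop :=
  (forall x y, region_adj x y -> (x \in black) = (y \in black)) /\
  (forall d : dart D,
     (corner d true \in black) = (corner d false \notin black)).

Variable black : {set dart D}.
Implicit Types (c e : crossing D) (T C : {set crossing D}).

(* Rotating the over-strand of c counterclockwise sweeps out the corners      *)
(* (c, 0) and (c, 2); true stands for the sign +.                             *)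
Definition edge_sign c : bool := (c, 0) \in black.

Definition black_corner c : dart D := (c, if edge_sign c then 0 else 1).

Definition tait : multigraph {set dart D} (crossing D) :=
  Multigraph [set region x | x in black]
    (fun c => (region (black_corner c), region (turn (black_corner c) 2))).

Definition num_edges (s : bool) : nat := #|[set c | edge_sign c == s]|.

(* Curves running through black regions, and from one black region to the     *)
(* opposite one at the crossings (Tait graph edges) in C; t counts the        *)
(* passages through the boundary of the disk mod 2.                           *)
Definition curve_step C (t : bool) : rel (dart D) := fun x y =>
  region_step t x y || [&& ~~ t, x.1 \in C & y == turn x 2].

Definition lifted_step C : rel (dart D * bool) :=
  fun x y => curve_step C (x.2 (+) y.2) x.1 y.1.

(* H_1(C) maps to 0 in H_1(RP^2) = Z/2, the class of a closed curve being its *)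
(* number of passages through the boundary of the disk; for a cycle C this    *)
(* says [C] = 0.                                                              *)
Definition homology_trivial C : bool :=
  [forall x in black,
     ~~ connect (lifted_step C) (x, false) (x, true)].

Definition smallest e (A : {set crossing D}) : bool :=
  (e \in A) && [forall f in A, (e <= f)%N].

Definition int_active T e : bool :=
  (e \in T) && smallest e (Cut tait T e).
Definition ext_active T e : bool :=
  (e \notin T) && smallest e (Cyc tait T e).
Definition loc_ext_active T e : bool :=
  ext_active T e && homology_trivial (Cyc tait T e).

Definition num_int (s : bool) T : nat :=
  #|[set e | int_active T e && (edge_sign e == s)]|.
Definition num_loc (s : bool) T : nat :=
  #|[set e | loc_ext_active T e && (edge_sign e == s)]|.

(* In the sequel pm = true (resp. false) stands for the index + (resp. -),    *)
(* [black] being the coloring with Tait graph G_pm.                           *)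
Definition pm_sign (pm : bool) : int := if pm then 1 else -1.

Definition u_deg (pm : bool) T : int :=
  pm_sign pm * ((num_int true T)%:Z - (num_loc true T)%:Z
                - (num_int false T)%:Z + (num_loc false T)%:Z).

Definition v_deg (pm : bool) T : int :=
  #|[set e in T | edge_sign e == pm]|%:Z.

Definition k_const (pm : bool) : int :=
  pm_sign pm * ((num_edges true)%:Z - (num_edges false)%:Z)
  + 2 * (#|vertices tait|%:Z - 1).

Definition bidegree (pm : bool) (T : tree tait) : int * int :=
  (u_deg pm (val T), v_deg pm (val T)).

Definition tree_degree (o : orientation D) (pm : bool) (T : tree tait) : rat :=
  (pm_sign pm * (u_deg pm (val T) - 2 * v_deg pm (val T)))%:~R
  + (writhe o + pm_sign pm * k_const pm)%:~R / 2.

End Tait.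

(* [black] is a coloring whose Tait graph may be named G_+; G_- is then the   *)
(* Tait graph of the opposite coloring ~: black.                              *)
Definition plus_coloring (D : rotation_system) (black : {set dart D}) : Prop :=
  checkerboard black /\ (num_edges black false <= num_edges black true)%N.

Notation F2 := ('F_2).
Definition fspace (I : finType) : vectType F2 := {ffun I -> F2^o}.
Definition basis_vec (I : finType) (i : I) : fspace I :=
  [ffun j => (j == i)%:R].

(* The linear map sending the basis vector i to the sum of the m i j * j. *)
Definition extend_fun (I J : finType) (m : I -> J -> F2) (x : fspace I) :
    fspace J :=
  [ffun j => \sum_(i : I) x i * m i j].

Definition extend (I J : finType) (m : I -> J -> F2) :
    'Hom(fspace I, fspace J) :=
  linfun (extend_fun m).

Lemma extend_fun_linear (I J : finType) (m : I -> J -> F2) :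
  linear (extend_fun m).
Proof.
move=> a x y; apply/ffunP=> k; rewrite !ffunE.
rewrite scaler_sumr -big_split; apply: eq_bigr => l _ /=.
by rewrite !ffunE mulrDl -scalerAl.
Qed.

HB.instance Definition _ (I J : finType) (m : I -> J -> F2) :=
  GRing.isLinear.Build F2 (fspace I) (fspace J) _ (extend_fun m)
    (extend_fun_linear m).

Lemma extend_basis (I J : finType) (m : I -> J -> F2) i j :
  extend m (basis_vec i) j = m i j.
Proof.
rewrite /extend lfunE /= ffunE (bigD1 i) //= big1 => [|l li].
  by rewrite ffunE eqxx mul1r addr0.
by rewrite ffunE (negPf li) mul0r.
Qed.

(* With basis elements graded by degI and degJ, f is homogeneous of degree k. *)
Definition homogeneous (A : zmodType) (I J : finType) (degI : I -> A)
    (degJ : J -> A) (k : A) (f : 'Hom(fspace I, fspace J)) : Prop :=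
  forall i j, f (basis_vec i) j != 0 -> degJ j = degI i + k.

Definition direct_sum (I J : finType)
    (f : 'End(fspace I)) (g : 'End(fspace J)) : 'End(fspace (I + J)%type) :=
  extend (fun a b => match a, b with
    | inl i, inl i' => f (basis_vec i) i'
    | inr j, inr j' => g (basis_vec j) j'
    | _, _ => 0
    end).

Definition sum_degree (A : Type) (I J : finType) (degI : I -> A)
    (degJ : J -> A) (a : I + J) : A :=
  match a with inl i => degI i | inr j => degJ j end.

(* {fspace I, dI} is a deformation retract of {fspace J, dJ}, as cochain      *)
(* complexes graded by degI and degJ.                                         *)
Definition deformation_retract (I J : finType)
    (degI : I -> rat) (dI : 'End(fspace I))
    (degJ : J -> rat) (dJ : 'End(fspace J)) : Prop :=
  exists (r : 'Hom(fspace J, fspace I)) (f : 'Hom(fspace I, fspace J))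
         (h : 'End(fspace J)),
    [/\ homogeneous degJ degI 0 r /\ (r \o dJ = dI \o r)%VF,
        homogeneous degI degJ 0 f /\ (f \o dI = dJ \o f)%VF,
        (r \o f = \1)%VF
      & homogeneous degJ degJ (-1) h /\
        (f \o r)%VF - \1%VF = (dJ \o h)%VF + (h \o dJ)%VF].

Section Khovanov.
Variable D : rotation_system.

(* A vertex of the cube is given by the set v of its B-smoothed crossings.    *)
(* The A-smoothing merges the corners (c, 0), (c, 2), so that it connects the *)
(* ends 1, 2 and the ends 3, 0; the B-smoothing connects 0, 1 and 2, 3.       *)
Definition smoothing (v : {set crossing D}) (d : dart D) : dart D :=
  (d.1, (if d.1 \in v then 1 else -1) - d.2).

Definition circle_adj (v : {set crossing D}) : rel (dart D) :=
  fun d d' => (d' == arc d) || (d' == smoothing v d).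

Definition circle (v : {set crossing D}) (d : dart D) : {set dart D} :=
  [set d' | connect (circle_adj v) d d'].
Definition circles (v : {set crossing D}) : {set {set dart D}} :=
  [set circle v d | d : dart D].

(* Basis of the unreduced complex: (v, x) is the labelling of the circles of  *)
(* v by X on the circles in x and by 1 on the other ones.                     *)
Definition state : finType :=
  {s : {set crossing D} * {set {set dart D}} | s.2 \subset circles s.1}.

(* Multiplication: 1(x)1 -> 1, 1(x)X -> X, X(x)1 -> X, X(x)X -> 0, in terms   *)
(* of the numbers of labels X before and after.                               *)
Definition merge_rule (k l : nat) : bool :=
  ((k, l) == (0, 0)%N) || ((k, l) == (1, 1)%N).
(* Comultiplication: 1 -> 1(x)X + X(x)1, X -> X(x)X. *)
Definition split_rule (k l : nat) : bool :=
  ((k, l) == (0, 1)%N) || ((k, l) == (1, 2)%N).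

(* The coefficient of t in the differential of s.  When the number of circles *)
(* does not change, [old] and [new] are empty and the coefficient is 0.       *)
Definition incidence (s t : state) : bool :=
  let: (v, x) := val s in
  let: (w, y) := val t in
  let old := circles v :\: circles w in
  let new := circles w :\: circles v in
  [&& [exists c, (c \notin v) && (w == c |: v)],
      x :\: old == y :\: new
    & [&& #|old| == 2, #|new| == 1 & merge_rule #|x :&: old| #|y :&: new|]
      || [&& #|old| == 1, #|new| == 2
           & split_rule #|x :&: old| #|y :&: new|] ]%N.

(* The basepoint is placed on the arc through p. *)
Definition reduced_state (p : dart D) : finType :=
  {s : state | circle (val s).1 p \in (val s).2}.

Definition reduced_differential (p : dart D) : 'End(fspace (reduced_state p)) :=
  extend (fun s t : reduced_state p => (incidence (val s) (val t))%:R).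

Definition state_degree (o : orientation D) (p : dart D)
    (s : reduced_state p) : rat :=
  (#|(val (val s)).1|%:Z - (n_minus o)%:Z)%:~R.

End Khovanov.

(* Main.v *)
From HB Require Import structures.
From mathcomp Require Import all_boot all_order all_algebra zify ring.
Require Import Defs.

(** A vertex v of the cube of smoothings determines the set of edges of the
    black Tait graph at which v joins the two black corners; the complementary
    edges of the white Tait graph are those at which v joins the white corners.
    By duality of the two graphs in RP^2, exactly one of these two sets carries
    no essential cycle.  Kruskal's algorithm, run on that set with respect to
    the order of the crossings, attaches to v a spanning tree T of one of the
    two graphs.  The vertices attached to T form the subcube spanned by the
    active crossings of T at a vertex with a single circle, and toggling an
    active crossing always merges or splits circles in this subcube, which
    therefore retracts to one generator.

    A toggle that changes the color of the attached tree preserves the parity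
    of the number of circles, so it neither merges nor splits circles and
    contributes 0 to the differential.  The edge maps between different
    subcubes of the same color increase the binary number of the one-circle
    vertex of the tree, so that the homological perturbation lemma applies.
    The edge maps are homogeneous for the grading by the number of
    B-smoothings and by the number of circles minus twice the number of labels
    X; translated to trees, this gives the bidegrees. *)

Set Implicit Arguments.
Unset Strict Implicit.
Unset Printing Implicit Defensive.

Import Order.TTheory GRing.Theory Num.Theory.
Local Open Scope ring_scope.

(** * Homological perturbation in characteristic 2 *)

(** Cancelling the active crossings of a subcube one after the other would alter the remaining edge
    maps. Instead each active crossing c gets its own homotopy, made of the edge map at c and a
    derivation of the labels along the circles that c cuts off from the basepoint. Active crossings
    do not interlace on the circle of the one-circle vertex, so these homotopies commute and the
    subcube behaves like a tensor product of two-term complexes, whose retractions multiply.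
    Nonlocality says that the class of [wraps] is not a coboundary; with the bound of [in_RP2] on
    the Euler characteristic, this class spans the first cohomology of the plane modulo 2, and its
    pairing with itself through the two colors is 1. This is the source of the alternative between
    the two Tait graphs. Recording the color of the tree as a further grading of the cube makes the
    transferred differential a direct sum. *)

Section Perturbation.
Variable R : pzRingType.
Hypothesis char2 : forall x : R, x + x = 0.

(* With e = f r, this describes a deformation retraction r with section f     *)
(* and homotopy h onto a complex with zero differential.                      *)
Definition sdr (d h e : R) : Prop :=
  [/\ d * d = 0, h * h = 0, e = 1 + d * h + h * d, d * e = 0 & h * e = 0].

Lemma addKK (x y : R) : x + (x + y) = y.
Proof. by rewrite addrA char2 add0r. Qed.

Lemma eq_char2 (x y : R) : x + y = 0 -> x = y.
Proof. by move=> xy; rewrite -[y](addKK x) addrCA xy addr0. Qed.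

(** Identities in a noncommutative ring of characteristic 2: [expand] moves all monomials to one
    side, where equal ones cancel in pairs. *)
Ltac cancel_pairs :=
  match goal with
  | |- 0 = 0 => reflexivity
  | |- ?x + ?x = 0 => exact: char2
  | |- ?x + (?x + ?z) = 0 => rewrite addKK; cancel_pairs
  | |- ?x + ?s = 0 =>
      match s with
      | context C [x + ?z] =>
          let s' := context C [z] in
          rewrite (_ : s = x + s');
          [| by repeat (rewrite [RHS]addrCA; congr (_ + _))];
          rewrite addKK; cancel_pairs
      | context C [?y + x] =>
          let s' := context C [y] in
          rewrite (_ : s = x + s');
          [| by do ?[by rewrite addrC | rewrite [RHS]addrCA; congr (_ + _)]];
          rewrite addKK; cancel_pairs
      end
  end.
Ltac expand :=
  apply: eq_char2;
  rewrite ?(mulrDl, mulrDr, mulr1, mul1r, mulr0, mul0r, addr0, add0r) ?mulrA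
    -?addrA.

Lemma sdr_mul_d d h e : sdr d h e -> e * d = 0.
Proof.
move=> [dd hh -> de he]; rewrite -de; expand.
by rewrite -!mulrA !dd ?mulrA dd !(mul0r, mulr0) ?addr0 ?add0r; cancel_pairs.
Qed.

Lemma sdr_mul_h d h e : sdr d h e -> e * h = 0.
Proof.
move=> [dd hh -> de he]; rewrite -he; expand.
by rewrite -!mulrA !hh ?mulrA hh !(mul0r, mulr0) ?addr0 ?add0r; cancel_pairs.
Qed.

Lemma sdr_idem d h e : sdr d h e -> e * e = e.
Proof.
move=> S; case: (S) => dd hh eE de he; rewrite {1}eE !mulrDl mul1r -!mulrA.
by rewrite de he !mulr0 !addr0.
Qed.

Lemma sdr_comm d h e x : sdr d h e -> GRing.comm d x -> GRing.comm h x ->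
  GRing.comm e x.
Proof.
case=> _ _ -> _ _ dx hx; apply: commr_sym; apply: commrD; first apply: commrD.
- exact: commr1.
- by apply: commrM; apply: commr_sym.
- by apply: commrM; apply: commr_sym.
Qed.

(** The retraction of a tensor product: contract by the first datum, then by the second one on the
    image of [e1]. In characteristic 2 plain commutation stands in for the Koszul signs. *)
Lemma sdr_cat d1 h1 e1 d2 h2 e2 : sdr d1 h1 e1 -> sdr d2 h2 e2 ->
  GRing.comm d1 d2 -> GRing.comm d1 h2 -> GRing.comm h1 d2 ->
  GRing.comm h1 h2 ->
  sdr (d1 + d2) (h1 + e1 * h2) (e1 * e2).
Proof.
move=> S1 S2 dd dh hd hh.
have ed := sdr_mul_d S1; have eh := sdr_mul_h S1; have ee := sdr_idem S1.
have ed2 := sdr_comm S1 dd hd; have eh2 := sdr_comm S1 dh hh.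
case: (S1) => dd1 hh1 e1E de1 he1; case: (S2) => dd2 hh2 e2E de2 he2.
split.
- by rewrite mulrDl !mulrDr dd1 dd2 add0r addr0 dd char2.
- rewrite mulrDl !mulrDr hh1 add0r mulrA he1 mul0r add0r.
  rewrite -mulrA -hh mulrA eh mul0r add0r.
  by rewrite -mulrA [h2 * _]mulrA -eh2 -[e1 * h2 * _]mulrA hh2 !mulr0.
- have a0 : d1 * e1 * h2 = 0 by rewrite de1 mul0r.
  have a1 : e1 * h2 * d1 = 0 by rewrite -mulrA -dh mulrA ed mul0r.
  have a2 : d2 * e1 * h2 = e1 * d2 * h2 by rewrite -ed2.
  have a3 : h1 * d2 = d2 * h1 by [].
  rewrite [in LHS]e2E; expand.
  rewrite a0 a1 a2 a3 e1E -?addrA ?add0r; cancel_pairs.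
- by rewrite mulrDl mulrA de1 mul0r add0r mulrA -ed2 -mulrA de2 mulr0.
- rewrite mulrDl mulrA he1 mul0r add0r.
  by rewrite -mulrA [h2 * _]mulrA -eh2 -[e1 * h2 * _]mulrA he2 !mulr0.
Qed.

(** Under these identities [d * h] and [h * d] are orthogonal idempotents, and the projection is the
    complementary idempotent. *)
Lemma sdr_intro (d h : R) : d * d = 0 -> h * h = 0 -> d * h * d = d ->
  h * d * h = h -> sdr d h (1 + d * h + h * d).
Proof.
move=> dd hh dhd hdh; split=> //; rewrite !mulrDr mulr1 !mulrA.
  by rewrite dd mul0r addr0 dhd char2.
by rewrite hh mul0r hdh addr0 char2.
Qed.

Lemma sdr0 : sdr 0 0 1.
Proof. by split; rewrite ?(mul0r, mulr0, addr0). Qed.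

Section Family.
Variables (I : eqType) (d h : I -> R).
Hypothesis sdr1 : forall i, sdr (d i) (h i) (1 + d i * h i + h i * d i).
Hypothesis dd : forall i j, i != j -> GRing.comm (d i) (d j).
Hypothesis dh : forall i j, i != j -> GRing.comm (d i) (h j).
Hypothesis hh : forall i j, i != j -> GRing.comm (h i) (h j).

Definition proj1 i := 1 + d i * h i + h i * d i.

Fixpoint homotopy (s : seq I) : R :=
  if s is i :: s' then h i + proj1 i * homotopy s' else 0.

Lemma proj1_comm i x : GRing.comm (d i) x -> GRing.comm (h i) x ->
  GRing.comm (proj1 i) x.
Proof. exact: sdr_comm (sdr1 i). Qed.

Lemma homotopy_comm x s :
  {in s, forall i, GRing.comm (d i) x /\ GRing.comm (h i) x} ->
  GRing.comm (homotopy s) x.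
Proof.
elim: s => [|i s IH] cx /=; first exact/commr_sym/commr0.
have [di hi] : GRing.comm (d i) x /\ GRing.comm (h i) x.
  by apply: cx; rewrite mem_head.
apply: commr_sym; apply: commrD; first exact: commr_sym.
apply: commrM; apply: commr_sym; first exact: proj1_comm.
by apply: IH => j js; apply: cx; rewrite in_cons js orbT.
Qed.

Lemma sdr_family s : uniq s ->
  sdr (\sum_(i <- s) d i) (homotopy s) (\prod_(i <- s) proj1 i).
Proof.
elim: s => [|i s IH] /=; first by move=> _; rewrite !big_nil; exact: sdr0.
case/andP=> iis us; rewrite !big_cons.
have ne j : j \in s -> i != j by apply: contraTneq => <-.
apply: sdr_cat (IH us) _ _ _ _; first exact: sdr1.
- rewrite big_seq; apply: commr_sum => j js; exact/dd/ne.
- apply/commr_sym/homotopy_comm => j js; split.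
    by apply: dd; rewrite eq_sym ne.
  exact/commr_sym/dh/ne.
- rewrite big_seq; apply: commr_sum => j js; apply/commr_sym/dh.
  by rewrite eq_sym ne.
- apply/commr_sym/homotopy_comm => j js; split.
    by apply: dh; rewrite eq_sym ne.
  by apply: hh; rewrite eq_sym ne.
Qed.

Lemma proj1_proj s i : i \in s -> uniq s ->
  proj1 i * (\prod_(j <- s) proj1 j) = \prod_(j <- s) proj1 j.
Proof.
elim: s => // k s IH; rewrite in_cons big_cons /=.
case/predU1P=> [-> _|iis /andP[ks us]].
  by rewrite mulrA (sdr_idem (sdr1 k)).
have ik : i != k by apply: contraTneq iis => ->.
have -> : proj1 i * (proj1 k * \prod_(j <- s) proj1 j) =
          proj1 k * (proj1 i * \prod_(j <- s) proj1 j).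
  rewrite !mulrA; congr (_ * _); apply: proj1_comm; apply: commr_sym.
    apply: proj1_comm; [by apply: dd; rewrite eq_sym|exact/commr_sym/dh].
  by apply: proj1_comm; [apply: dh; rewrite eq_sym|apply: hh; rewrite eq_sym].
by rewrite IH.
Qed.

Lemma proj_proj1 s i : i \in s -> uniq s ->
  (\prod_(j <- s) proj1 j) * proj1 i = \prod_(j <- s) proj1 j.
Proof.
move=> iis us; rewrite -[RHS](proj1_proj iis us).
have cc j : j != i -> GRing.comm (proj1 i) (proj1 j).
  move=> ji; have ij : i != j by rewrite eq_sym.
  apply: proj1_comm; apply: commr_sym; apply: proj1_comm.
  - exact: dd.
  - exact/commr_sym/dh.
  - exact: dh.
  - exact: hh.
apply/commr_sym; rewrite /GRing.comm.
elim: s us {iis} => [|k s IH] /=; first by rewrite big_nil mulr1 mul1r.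
case/andP=> ks us; rewrite big_cons.
apply: commrM (IH us); have [->|ki] := eqVneq k i; last exact: cc.
by [].
Qed.

End Family.

(** * The basic perturbation lemma *)

Section Perturb.
Variables d0 h e del b : R.
Hypothesis S0 : sdr d0 h e.
Hypothesis d_sq : (d0 + del) * (d0 + del) = 0.
Hypothesis bl : b * (1 + del * h) = 1.
Hypothesis br : (1 + del * h) * b = 1.

(* The inverse of 1 + h * del. *)
Definition pert' := 1 + h * b * del.

Lemma pert'E : h * b = pert' * h.
Proof.
have -> : pert' * h = h * (1 + b * del * h) by rewrite /pert'; expand; cancel_pairs.
congr (_ * _); apply: eq_char2; rewrite addrA -[X in _ + X]mulrA -bl.
by rewrite mulrDr mulr1; rewrite -!addrA; cancel_pairs.
Qed.

Lemma pert'_l : pert' * (1 + h * del) = 1.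
Proof.
rewrite mulrDr mulr1 mulrA -pert'E /pert' -addrA.
by rewrite char2 addr0.
Qed.

Lemma del_b : del * pert' = b * del.
Proof.
have E : (1 + del * h) * (del * pert') = (1 + del * h) * (b * del).
  rewrite [RHS]mulrA br mul1r -[RHS]mulr1.
  rewrite mulrA mulrDl mul1r -mulrA -{1}[del]mulr1 -mulrDr -mulrA.
  congr (_ * _).
  rewrite /pert' mulrDl mul1r mulrDr mulr1 !mulrA.
  have -> : h * del * h * b = h * (del * h * b) by rewrite !mulrA.
  have -> : del * h * b = b + 1.
    by apply: eq_char2; rewrite -br mulrDl mul1r addrA addrC; expand; cancel_pairs.
  expand; cancel_pairs.
have := congr1 (fun x => b * x) E.
by rewrite !mulrA bl !mul1r.
Qed.

Lemma pert'_r : (1 + h * del) * pert' = 1.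
Proof. by rewrite mulrDl mul1r -mulrA del_b mulrA /pert'; expand; cancel_pairs. Qed.

Lemma e_b : e * b * e = e.
Proof.
have eh := sdr_mul_h S0; case: S0 => _ _ _ _ he.
have -> : b = 1 + b * del * h.
  by apply: eq_char2; rewrite -bl; expand; cancel_pairs.
by rewrite mulrDr mulr1 mulrDl (sdr_idem S0) -!mulrA he !mulr0 addr0.
Qed.

Lemma bE : b = 1 + del * h * b.
Proof. by apply: eq_char2; rewrite -br; expand; cancel_pairs. Qed.

(** The perturbed data are the projection [e * b], the section [pert' * e], the homotopy [h * b] and
    the transferred differential [e * b * del * e]. *)
Lemma pert_ebbe : e * b * pert' * e = e.
Proof.
have [_ hh _ _ _] := S0.
have bh : b * h = h.
  have -> : b = 1 + b * del * h.
    by apply: eq_char2; rewrite -bl; expand; cancel_pairs.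
  by rewrite mulrDl mul1r -[_ * h * h]mulrA hh mulr0 addr0.
have -> : e * b * pert' = e * b.
  rewrite /pert' mulrDr mulr1 !mulrA -[e * b * h]mulrA bh.
  by rewrite (sdr_mul_h S0) !mul0r addr0.
exact: e_b.
Qed.

Let d := d0 + del.

Lemma d_del : d * del = del * d0.
Proof.
have [dd _ _ _ _] := S0.
have -> : d * del = d * d + d * d0 by rewrite /d; expand; cancel_pairs.
by rewrite d_sq add0r mulrDl dd add0r.
Qed.

Lemma del_d : del * d = d0 * del.
Proof.
have [dd _ _ _ _] := S0.
have -> : del * d = d * d + d0 * d by rewrite /d; expand; cancel_pairs.
by rewrite d_sq add0r mulrDr dd add0r.
Qed.

Lemma pert_r : e * b * d = e * b * del * e * b.
Proof.
have [_ _ eE _ _] := S0.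
rewrite -[LHS]mulr1 -br mulrA; congr (_ * _).
rewrite mulrDr mulr1 -[_ * d * _]mulrA [d * (del * h)]mulrA d_del.
apply: eq_char2.
transitivity (e * (b * (d + del * d0 * h + del * e))).
  by rewrite !mulrDr !mulrA.
have -> : d + del * d0 * h + del * e = (1 + del * h) * d0.
  by rewrite eE /d; expand; cancel_pairs.
by rewrite [b * _]mulrA bl mul1r (sdr_mul_d S0).
Qed.

Lemma pert_f : d * pert' * e = pert' * e * b * del * e.
Proof.
have [_ _ eE de _] := S0.
rewrite -[LHS]mul1r -{1}pert'_l -!mulrA; congr (_ * _).
rewrite mulrDl mul1r -[h * del * _]mulrA [del * (d * _)]mulrA del_d.
rewrite [b * _]mulrA -del_b; apply: eq_char2.
transitivity (d0 * (1 + h * del) * pert' * e).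
  by rewrite eE /d; expand; cancel_pairs.
by rewrite -[d0 * _ * _]mulrA pert'_r mulr1 de.
Qed.

Lemma pert_fr : pert' * e * b + 1 = d * (h * b) + h * b * d.
Proof.
have [_ _ eE _ _] := S0.
rewrite {2}pert'E; apply: eq_char2.
have -> : 1 = pert' * ((1 + h * del) * (1 + del * h)) * b.
  by rewrite !mulrA pert'_l mul1r br.
have -> : d * (h * b) = pert' * ((1 + h * del) * d * h) * b.
  by rewrite !mulrA pert'_l mul1r.
have -> : pert' * h * d = pert' * (h * d * (1 + del * h)) * b.
  by rewrite -!mulrA br mulr1.
rewrite -!mulrDl -!mulrDr.
rewrite (_ : _ + _ = 0) ?mulr0 ?mul0r //.
have -> : (1 + h * del) * d * h = d * h + h * d0 * del * h.
  by rewrite [in LHS]mulrDl mul1r -[h * del * d]mulrA del_d mulrDl !mulrA.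
have -> : h * d * (1 + del * h) = h * d + h * del * d0 * h.
  by rewrite mulrDr mulr1 !mulrA -[h * d * del]mulrA d_del !mulrA.
have dd : h * (d0 * del + del * d0 + del * del) * h = 0.
  have -> : d0 * del + del * d0 + del * del = d * d.
    have [dd _ _ _ _] := S0.
    by rewrite /d mulrDl !mulrDr dd add0r !addrA.
  by rewrite d_sq mulr0 mul0r.
rewrite -dd eE /d; expand; cancel_pairs.
Qed.

End Perturb.
End Perturbation.

(** * Endomorphisms over F_2 as a ring, and conditions on matrix entries *)

Definition endo (J : finType) : Type := 'End(fspace J).

HB.instance Definition _ (J : finType) := GRing.Zmodule.on (endo J).
HB.instance Definition _ (J : finType) := GRing.Zmodule_isPzRing.Build (endo J)
  (@comp_lfunA _ _ _ _ _) (@comp_lfun1l _ _ _) (@comp_lfun1r _ _ _)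
  (@comp_lfunDl _ _ _ _) (@comp_lfunDr _ _ _ _).

Lemma F2_char2 (x : F2) : x + x = 0.
Proof. by rewrite -mulr2n -[x *+ 2]mulr_natr pchar_Zp ?mulr0. Qed.

Lemma F2_neq0 (x : F2) : x != 0 -> x = 1.
Proof. by case: x => [[|[|x]] Hx] // _; apply: val_inj. Qed.

Lemma fspace_char2 (J : finType) (x : fspace J) : x + x = 0.
Proof. by apply/ffunP => j; rewrite !ffunE; exact: F2_char2. Qed.

Lemma endo_char2 (J : finType) (x : endo J) : x + x = 0.
Proof. by apply/lfunP => v; rewrite !lfunE /= fspace_char2. Qed.

Lemma endo_mulE (J : finType) (f g : endo J) x : (f * g : endo J) x = f (g x).
Proof. exact: comp_lfunE. Qed.

Lemma endo_addE (J : finType) (f g : endo J) x : (f + g : endo J) x = f x + g x.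
Proof. by rewrite lfunE. Qed.

Lemma endo_1E (J : finType) x : (1 : endo J) x = x.
Proof. by rewrite lfunE. Qed.

Lemma endo_0E (J : finType) x : (0 : endo J) x = 0.
Proof. by rewrite lfunE. Qed.

Lemma basis_expand (J : finType) (x : fspace J) :
  x = \sum_j (x j : F2) *: basis_vec j.
Proof.
apply/ffunP=> k; rewrite sum_ffunE (bigD1 k) //= big1 => [|j jk].
  by rewrite !ffunE eqxx addr0 [RHS]mulr1.
by rewrite !ffunE eq_sym (negPf jk) [LHS]mulr0.
Qed.

Lemma lfun_coord (I J : finType) (f : 'Hom(fspace I, fspace J)) x k :
  f x k = \sum_i x i * f (basis_vec i) k.
Proof.
rewrite {1}[x]basis_expand linear_sum sum_ffunE; apply: eq_bigr => i _.
by rewrite linearZ !ffunE.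
Qed.

Lemma lfun_eq_basis (I J : finType) (f g : 'Hom(fspace I, fspace J)) :
  (forall i, f (basis_vec i) = g (basis_vec i)) -> f = g.
Proof.
move=> fg; apply/lfunP => x; apply/ffunP => k; rewrite !lfun_coord.
by apply: eq_bigr => i _; rewrite fg.
Qed.

Section Support.

(** Homogeneity, growth of a rank and preservation of subcubes are all bounds on the nonzero matrix
    entries, and pass to sums and composites in the same way. *)
Definition supported (I J : finType) (P : I -> J -> Prop)
    (f : 'Hom(fspace I, fspace J)) :=
  forall i j, f (basis_vec i) j != 0 -> P i j.

Lemma supported_comp (I J K : finType) (P : J -> K -> Prop)
    (Q : I -> J -> Prop) (S : I -> K -> Prop)
    (f : 'Hom(fspace J, fspace K)) (g : 'Hom(fspace I, fspace J)) :
  (forall i j k, Q i j -> P j k -> S i k) ->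
  supported P f -> supported Q g -> supported S (f \o g)%VF.
Proof.
move=> PQS sf sg i k; rewrite comp_lfunE lfun_coord => nz.
have [j] : exists j, g (basis_vec i) j * f (basis_vec j) k != 0.
  apply/existsP; apply: contraNT nz; rewrite negb_exists => /forallP z.
  by apply/eqP/big1 => j _; apply/eqP; move: (z j); rewrite negbK.
by rewrite mulf_eq0 negb_or => /andP[/sg q /sf]; exact: PQS.
Qed.

Lemma supportedD (I J : finType) (P : I -> J -> Prop)
    (f g : 'Hom(fspace I, fspace J)) :
  supported P f -> supported P g -> supported P (f + g).
Proof.
move=> sf sg i j; rewrite lfunE /= ffunE.
have [->|nz _] := eqVneq (f (basis_vec i) j) 0; first by rewrite add0r => /sg.
exact: sf.
Qed.

Lemma supported0 (I J : finType) (P : I -> J -> Prop) :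
  supported P (0 : 'Hom(fspace I, fspace J)).
Proof. by move=> i j; rewrite lfunE /= ffunE eqxx. Qed.

Lemma supported_sum (I J : finType) (P : I -> J -> Prop) (T : Type)
    (s : seq T) (Q : pred T) (F : T -> 'Hom(fspace I, fspace J)) :
  (forall t, Q t -> supported P (F t)) -> supported P (\sum_(t <- s | Q t) F t).
Proof.
by move=> sF; elim/big_ind: _; [exact: supported0|exact: supportedD|exact: sF].
Qed.

Lemma supported1 (J : finType) (P : J -> J -> Prop) :
  (forall j, P j j) -> supported P (\1 : 'End(fspace J)).
Proof. by move=> Pr i j; rewrite lfunE /= ffunE; have [->|] := eqVneq j i; rewrite ?eqxx. Qed.

End Support.

Section Homogeneous.
Variable A : zmodType.

Lemma homogeneous_comp (I J K : finType) (dI : I -> A) (dJ : J -> A)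
    (dK : K -> A) k l (f : 'Hom(fspace J, fspace K))
    (g : 'Hom(fspace I, fspace J)) :
  homogeneous dJ dK k f -> homogeneous dI dJ l g ->
  homogeneous dI dK (l + k) (f \o g)%VF.
Proof.
by apply: supported_comp => i j m -> ->; rewrite addrA.
Qed.

Lemma homogeneousD (I J : finType) (dI : I -> A) (dJ : J -> A) k
    (f g : 'Hom(fspace I, fspace J)) :
  homogeneous dI dJ k f -> homogeneous dI dJ k g ->
  homogeneous dI dJ k (f + g).
Proof. exact: supportedD. Qed.

Lemma homogeneous_sum (I J : finType) (dI : I -> A) (dJ : J -> A) k (T : Type)
    (s : seq T) (Q : pred T) (F : T -> 'Hom(fspace I, fspace J)) :
  (forall t, Q t -> homogeneous dI dJ k (F t)) ->
  homogeneous dI dJ k (\sum_(t <- s | Q t) F t).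
Proof. exact: supported_sum. Qed.

Lemma homogeneous1 (J : finType) (dJ : J -> A) :
  homogeneous dJ dJ 0 (\1 : 'End(fspace J)).
Proof. by apply: supported1 => j; rewrite addr0. Qed.

End Homogeneous.

(** * Perturbation of a graded retract along a filtration *)

Section PerturbRetract.
Variables (I J : finType) (A : zmodType) (degI : I -> A) (degJ : J -> A).
Variables (k : A) (rho : J -> nat).
Variables (d d0 h e : endo J).
Variables (f0 : 'Hom(fspace I, fspace J)) (r0 : 'Hom(fspace J, fspace I)).
Hypothesis sdr0 : sdr d0 h e.
Hypothesis d_sq : d * d = 0.
Hypothesis f0r0 : (f0 \o r0)%VF = e.
Hypothesis r0f0 : (r0 \o f0)%VF = \1%VF.
Hypothesis d_hom : homogeneous degJ degJ k d.
Hypothesis d0_hom : homogeneous degJ degJ k d0.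
Hypothesis h_hom : homogeneous degJ degJ (- k) h.
Hypothesis f0_hom : homogeneous degI degJ 0 f0.
Hypothesis r0_hom : homogeneous degJ degI 0 r0.
Hypothesis del_up : supported (fun i j => rho i < rho j)%N (d + d0).
Hypothesis h_up : supported (fun i j => rho i <= rho j)%N h.

Let del : endo J := d + d0.
Let x := del * h.

(** [del] strictly raises [rho] and [h] does not lower it, so the geometric series for the inverse
    of [1 + del * h] terminates. *)
Lemma x_pow_up m : supported (fun i j => rho i + m <= rho j)%N (x ^+ m).
Proof.
elim: m => [|m IH]; first by apply: supported1 => j; rewrite addn0.
rewrite exprS; apply: (supported_comp _ _ IH).
  move=> i j l; rewrite addnS => a b; exact: leq_ltn_trans a b.
apply: (supported_comp _ del_up h_up) => i j l; exact: leq_ltn_trans.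
Qed.

Let N := (\max_j rho j).+1.

Lemma x_nilpotent : x ^+ N = 0.
Proof.
apply: lfun_eq_basis => i; apply/ffunP => j.
rewrite lfunE /= ffunE; apply/eqP; apply/negPn/negP => /x_pow_up.
rewrite leqNgt => /negP; apply; rewrite addnS ltnS.
exact: leq_trans (leq_bigmax j) (leq_addl _ _).
Qed.

Let b : endo J := \sum_(i < N) x ^+ i.

Lemma b_geom : b * (1 + x) = 1 /\ (1 + x) * b = 1.
Proof.
have bx : b + b * x = 1.
  rewrite /b mulr_suml -big_split /= -(big_mkord predT (fun i => x ^+ i + x ^+ i * x)).
  rewrite (eq_bigr (fun i => x ^+ i.+1 - x ^+ i)); last first.
    move=> i _; rewrite exprSr addrC; congr (_ + _).
    by apply: (addrI (x ^+ i)); rewrite subrr endo_char2.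
  rewrite telescope_sumr // x_nilpotent sub0r expr0.
  by apply: (addrI 1); rewrite subrr endo_char2.
have cx : x * b = b * x.
  by rewrite /b mulr_sumr mulr_suml; apply: eq_bigr => i _; rewrite -exprS -exprSr.
by split; rewrite ?mulrDr ?mulrDl ?mulr1 ?mul1r ?cx.
Qed.

Lemma endo_hom_mul l m (u v : endo J) : homogeneous degJ degJ l u ->
  homogeneous degJ degJ m v -> homogeneous degJ degJ (m + l) (u * v).
Proof. exact: homogeneous_comp. Qed.

Lemma del_hom : homogeneous degJ degJ k del.
Proof. exact: homogeneousD. Qed.

Lemma b_hom : homogeneous degJ degJ 0 b.
Proof.
apply: homogeneous_sum => i _; elim: (val i) => [|m IH].
  exact: homogeneous1.
rewrite exprS -(addr0 0) -{2}(addNr k).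
apply: endo_hom_mul IH; exact: endo_hom_mul del_hom h_hom.
Qed.

Let b' : endo J := 1 + h * b * del.

Lemma b'_hom : homogeneous degJ degJ 0 b'.
Proof.
apply: homogeneousD; first exact: homogeneous1.
rewrite -(subrr k); apply: endo_hom_mul del_hom.
by rewrite -[- k]add0r; apply: endo_hom_mul h_hom b_hom.
Qed.

Theorem perturb_retract :
  exists (dI : 'End(fspace I)) (r : 'Hom(fspace J, fspace I))
         (f : 'Hom(fspace I, fspace J)) (h' : 'End(fspace J)),
  [/\ homogeneous degI degI k dI /\ (dI \o dI = 0)%VF,
      homogeneous degJ degI 0 r /\ (r \o d = dI \o r)%VF,
      homogeneous degI degJ 0 f /\ (f \o dI = d \o f)%VF,
      (r \o f = \1)%VF
    & homogeneous degJ degJ (- k) h' /\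
      (f \o r)%VF - \1%VF = (d \o h')%VF + (h' \o d)%VF].
Proof.
have c2 := @endo_char2 J.
have dE : d0 + del = d by rewrite /del addrCA c2 addr0.
have dsq : (d0 + del) * (d0 + del) = 0 by rewrite dE.
have [bl br] := b_geom.
pose dI := (r0 \o (b * del : endo J) \o f0)%VF.
pose r := (r0 \o b)%VF; pose f := (b' \o f0)%VF.
have r0e : r0 = (r0 \o e)%VF by rewrite -f0r0 comp_lfunA r0f0 comp_lfun1l.
have f0e : f0 = (e \o f0)%VF by rewrite -f0r0 -comp_lfunA r0f0 comp_lfun1r.
have rf : (r \o f = \1)%VF.
  rewrite /r /f r0e f0e.
  transitivity (r0 \o (e * b * b' * e : endo J) \o f0)%VF.
    by rewrite /GRing.mul /= -!comp_lfunA.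
  by rewrite (pert_ebbe c2 sdr0 bl) -f0r0 -!comp_lfunA r0f0 comp_lfun1r r0f0.
have rd : (r \o d = dI \o r)%VF.
  rewrite /r /dI {1}r0e.
  transitivity (r0 \o (e * b * d : endo J))%VF.
    by rewrite /GRing.mul /= -!comp_lfunA.
  have := pert_r c2 sdr0 dsq bl br; rewrite dE => ->.
  rewrite -f0r0 /GRing.mul /= -!comp_lfunA.
  by rewrite (comp_lfunA r0 f0 (r0 \o _)%VF) r0f0 comp_lfun1l.
have df : (f \o dI = d \o f)%VF.
  rewrite /f /dI {3}f0e.
  transitivity (d * b' * e \o f0 : 'Hom(_, _))%VF; last first.
    by rewrite /GRing.mul /= -!comp_lfunA.
  have := pert_f c2 sdr0 dsq bl br; rewrite dE => ->.
  by rewrite -f0r0 /GRing.mul /= -!comp_lfunA r0f0 comp_lfun1r.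
exists dI, r, f, (h * b : endo J); split=> //.
- split.
    have := homogeneous_comp (homogeneous_comp r0_hom
      (endo_hom_mul b_hom del_hom)) f0_hom.
    by rewrite !addr0 add0r.
  (* As [r \o f] is the identity, the square of [dI] is the square of [d] between [r] and [f]. *)
  transitivity ((dI \o dI) \o (r \o f))%VF; first by rewrite rf comp_lfun1r.
  rewrite comp_lfunA -[((dI \o dI) \o r)%VF]comp_lfunA -rd.
  rewrite [(dI \o (_ \o _))%VF]comp_lfunA -rd -[(_ \o d \o d)%VF]comp_lfunA.
  by rewrite [(d \o d)%VF]d_sq comp_lfun0r comp_lfun0l.
- split=> //; rewrite -(addr0 0); exact: homogeneous_comp r0_hom b_hom.
- split=> //; rewrite -(addr0 0); exact: homogeneous_comp b'_hom f0_hom.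
- split.
    by rewrite -[- k]add0r; exact: endo_hom_mul h_hom b_hom.
  have := pert_fr c2 sdr0 dsq bl br; rewrite dE => <-.
  have -> : (f \o r)%VF = (b' * e * b : endo J).
    by rewrite -f0r0 /f /r /GRing.mul /= -!comp_lfunA.
  congr (_ + _); apply: (addrI (1 : endo J)); rewrite c2; exact: subrr.
Qed.

End PerturbRetract.

(** * Circles of a smoothing *)

Lemma connect_ind (T : finType) (e : rel T) (P : T -> Prop) x y :
  P x -> (forall y z, P y -> e y z -> P z) -> connect e x y -> P y.
Proof.
move=> Px Pe /connectP[s]; elim: s x Px => [|z s IH] x Px /=; first by move=> _ ->.
by case/andP=> /(Pe _ _ Px) Pz; apply: IH.
Qed.

Section Dihedral.
Variables (T : finType) (a s : T -> T).
Hypotheses (aK : involutive a) (sK : involutive s).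
Hypotheses (a_neq : forall x, a x != x) (s_neq : forall x, s x != x).
Let f x := s (a x).

(** On a circle traversed by the two involutions in turn, x and [s x] are run through in opposite
    directions. If one orbit of f contained both, shortening the path between them from both ends
    would reach a fixed point of [s] or of [a]. *)
Lemma dihedral_orbit k x : iter k f x != s x.
Proof.
elim/ltn_ind: k x => -[|[|k]] IH x /=; first by rewrite eq_sym.
  by rewrite (can_eq sK).
rewrite (can_eq sK) -(can_eq aK) aK -iterS iterSr.
have -> : a x = s (f x) by rewrite /f sK.
exact: IH.
Qed.

Lemma dihedral_inj : injective f.
Proof. exact: inj_comp (inv_inj sK) (inv_inj aK). Qed.

(** Deleting the [s]-edge at x from the circle through x leaves a path, followed here along the
    orbit of x under f, whose length is [n.+1]. *)
Lemma dihedral_cut x :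
  connect (fun d d' => (d' == a d) || [&& d' == s d, d != x & d != s x]) x (s x).
Proof.
set e := (X in connect X).
have [n fn nmin] : exists2 n, iter n.+1 f x = x &
    forall i, (i < n)%N -> iter i.+1 f x != x.
  have ex : exists n, iter n.+1 f x == x.
    exists (order f x).-1; rewrite prednK ?order_gt0 //.
    by rewrite (iter_order dihedral_inj).
  case: (ex_minnP ex) => n /eqP fn nmin; exists n => // i.
  by rewrite ltnNge; apply: contra => /nmin.
have run k : (k <= n)%N -> connect e x (iter k f x).
  elim: k => [|k IH] kn; first exact: connect0.
  apply: connect_trans (IH (ltnW kn)) _.
  apply: (@connect_trans _ _ (a (iter k f x))); apply: connect1; rewrite /e.
    by rewrite eqxx.
  rewrite iterS -/(f _) eqxx /= orbC -(can_eq sK) -[s _]/(iter k.+1 f x).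
  rewrite dihedral_orbit -(can_eq sK) -[s _]/(iter k.+1 f x) sK nmin //.
apply: connect_trans (run n (leqnn n)) (connect1 _).
by rewrite /e -{1}fn /= sK eqxx.
Qed.

End Dihedral.

Section Flip.
Variable T : finType.
Implicit Types (v : {set T}) (c b : T).

Definition flip v c : {set T} := [set x | (x \in v) (+) (x == c)].

Lemma in_flip v c x : (x \in flip v c) = (x \in v) (+) (x == c).
Proof. by rewrite inE. Qed.

Lemma flipK v c : flip (flip v c) c = v.
Proof. by apply/setP => x; rewrite !inE addbK. Qed.

Lemma flipC v b c : flip (flip v b) c = flip (flip v c) b.
Proof. by apply/setP => x; rewrite !inE addbAC. Qed.

Lemma flip_add v c : c \notin v -> flip v c = c |: v.
Proof.
move=> cv; apply/setP => x; rewrite !inE.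
by have [->|] := eqVneq x c; rewrite ?(negPf cv) // addbF.
Qed.

Lemma flip_rem v c : c \in v -> flip v c = v :\ c.
Proof.
move=> cv; apply/setP => x; rewrite !inE.
by have [->|] := eqVneq x c; rewrite ?cv // addbF.
Qed.

Lemma card_flip v c : (#|flip v c| + (c \in v) = #|v| + (c \notin v))%N.
Proof.
have [cv|cv] := boolP (c \in v).
  by rewrite flip_rem //= addn1 addn0 (cardsD1 c v) cv.
by rewrite flip_add //= addn0 cardsU1 cv addnC.
Qed.

End Flip.

Section Circles.
Variable D : rotation_system.
Implicit Types (d x y : dart D) (c : crossing D) (v w : {set crossing D}).

Definition same v := connect (circle_adj v).
(** The ends 0 and 2 lie on different strands of c for both smoothings, so they test whether
    toggling c merges two circles. *)
Definition differ v c := ~~ same v (c, 0) (c, 2).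

Lemma I4_cases (P : 'I_4 -> Prop) : P 0 -> P 1 -> P 2 -> P 3 -> forall i, P i.
Proof.
move=> P0 P1 P2 P3 [[|[|[|[|//]]]] i4].
- by rewrite (_ : Ordinal i4 = 0) //; exact: val_inj.
- by rewrite (_ : Ordinal i4 = 1) //; exact: val_inj.
- by rewrite (_ : Ordinal i4 = 2) //; exact: val_inj.
- by rewrite (_ : Ordinal i4 = 3) //; exact: val_inj.
Qed.

Lemma smoothingK v : involutive (smoothing v).
Proof. by move=> [c i]; rewrite /smoothing /= subKr. Qed.

Lemma smoothing_neq v d : smoothing v d != d.
Proof.
case: d => c i; rewrite /smoothing /=; apply/eqP => -[].
by case: ifP => _; move: i; apply: I4_cases.
Qed.

Lemma circle_adj_sym v : symmetric (circle_adj v).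
Proof.
move=> x y; rewrite /circle_adj; congr (_ || _).
  by rewrite eq_sym (can2_eq (@arcK D) (@arcK D)).
by rewrite eq_sym (can2_eq (smoothingK v) (smoothingK v)).
Qed.

Lemma same_sym v : symmetric (same v).
Proof. exact/sym_connect_sym/circle_adj_sym. Qed.

Lemma same_refl v : reflexive (same v).
Proof. exact: connect0. Qed.

Lemma same_trans v : transitive (same v).
Proof. exact: connect_trans. Qed.

Lemma same_arc v d : same v d (arc d).
Proof. by apply: connect1; rewrite /circle_adj eqxx. Qed.

Lemma same_smoothing v d : same v d (smoothing v d).
Proof. by apply: connect1; rewrite /circle_adj eqxx orbT. Qed.

Lemma smoothing_flip v c d : d.1 != c -> smoothing (flip v c) d = smoothing v d.
Proof. by move=> dc; rewrite /smoothing in_flip (negPf dc) addbF. Qed.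

Lemma same_strand v c i : same v (c, i) (c, 0) || same v (c, i) (c, 2).
Proof.
have s0 := same_smoothing v (c, 0); have s2 := same_smoothing v (c, 2).
rewrite ![_ v (c, i) _]same_sym; move: s0 s2; rewrite /smoothing /=.
case: (c \in v).
  have -> : (1 - 0 : 'I_4) = 1 by exact: val_inj.
  have -> : (1 - 2 : 'I_4) = 3 by exact: val_inj.
  by move=> s0 s2; move: i; apply: I4_cases; rewrite ?same_refl ?s0 ?s2 ?orbT.
have -> : (- 1 - 0 : 'I_4) = 3 by exact: val_inj.
have -> : (- 1 - 2 : 'I_4) = 1 by exact: val_inj.
by move=> s0 s2; move: i; apply: I4_cases; rewrite ?same_refl ?s0 ?s2 ?orbT.
Qed.

Lemma smoothing_strand v c d : d.1 = c ->
  [|| d == (c, 0), d == smoothing v (c, 0), d == (c, 2) |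
      d == smoothing v (c, 2)].
Proof.
case: d => _ i /= ->; rewrite /smoothing /=; case: (c \in v); move: i; apply: I4_cases;
  by rewrite !xpair_eqE !eqxx.
Qed.

Lemma same_homo v w : (forall d, same w d (smoothing v d)) ->
  forall d d', same v d d' -> same w d d'.
Proof.
move=> h d d'; apply: connect_sub => x y /orP[/eqP->|/eqP->].
  exact: same_arc.
exact: h.
Qed.

Section Merge.
Variables (v : {set crossing D}) (c : crossing D).
Let w := flip v c.

(** The circle through [(c, i)], cut open at its strand of c, meets c nowhere else because the other
    strand lies on another circle. The toggle leaves this path intact, and it joins the two ends of
    the strand. *)
Lemma cut_same i : differ v c -> i = 0 \/ i = 2 ->
  same w (c, i) (smoothing v (c, i)).
Proof.
move=> dv i02; set x := (c, i) : dart D.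
have nsame j : j = 0 \/ j = 2 -> j != i -> ~~ same v x (c, j).
  by move: i02 @x => [->|->] x [->|->] //; rewrite same_sym.
suff : same v x (smoothing v x) /\ same w x (smoothing v x) by case.
apply: (@connect_ind _ _ (fun y => same v x y /\ same w x y) _ _ _ _
  (dihedral_cut (@arcK D) (smoothingK v) (@arc_neq D) (smoothing_neq v) x)).
  by rewrite !same_refl.
move=> y z [vy wy] /orP[/eqP->|/and3P[/eqP-> yx ysx]].
  by rewrite (same_trans vy) ?(same_trans wy) ?same_arc.
have vz : same v x (smoothing v y) by exact: same_trans vy (same_smoothing v y).
split=> //; apply: same_trans wy _.
suff yc : y.1 != c by rewrite -(smoothing_flip v yc); exact: same_smoothing.
apply: contraTneq vy => yc; move: (smoothing_strand v yc) yx ysx.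
move: i02 @x nsame {vz} => [->|->] x nsame + yx ysx;
  rewrite (negPf yx) (negPf ysx) /= ?orbF => /orP[]/eqP->.
- by apply: nsame; [right|].
- apply: contra (nsame 2 _ _); [|by right|by []].
  by move/same_trans; apply; rewrite same_sym same_smoothing.
- by apply: nsame; [left|].
- apply: contra (nsame 0 _ _); [|by left|by []].
  by move/same_trans; apply; rewrite same_sym same_smoothing.
Qed.

Lemma differ_merge d d' : differ v c -> same v d d' -> same w d d'.
Proof.
move=> dv; apply: same_homo => x; have [xc|xc] := eqVneq x.1 c; last first.
  by rewrite -(smoothing_flip v xc); exact: same_smoothing.
have s0 := cut_same dv (or_introl (erefl _)).
have s2 := cut_same dv (or_intror (erefl _)).
case/or4P: (smoothing_strand v xc) => /eqP->; rewrite ?smoothingK //.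
- by rewrite same_sym.
- by rewrite same_sym.
Qed.

Lemma differ_flip : differ v c -> ~~ differ w c.
Proof.
move=> dv; rewrite negbK.
have s0 : same w (c, 0) (smoothing w (c, 0)) by exact: same_smoothing.
have s2 : same w (c, 2) (smoothing v (c, 2)) by exact: cut_same dv (or_intror (erefl _)).
suff e : smoothing w (c, 0) = smoothing v (c, 2).
  by apply: same_trans s0 _; rewrite e same_sym.
rewrite /smoothing /= in_flip eqxx addbT; congr (_, _).
by case: (c \in v); exact: val_inj.
Qed.

Definition at_crossing d := same v (c, 0) d || same v (c, 2) d.

Lemma same_merge d d' : differ v c ->
  same w d d' = same v d d' || (at_crossing d && at_crossing d').
Proof.
move=> dv; apply/idP/idP; last first.
  have w02 : same w (c, 0) (c, 2) by have := differ_flip dv; rewrite negbK.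
  have m x y := @differ_merge x y dv.
  case/orP=> [/m //|/andP[]].
  suff h x : at_crossing x -> same w (c, 0) x.
    by move=> /h; rewrite same_sym => a /h; exact: same_trans.
  by case/orP=> /m //; apply: same_trans.
have zv x y : same v x y -> at_crossing x = at_crossing y.
  move=> xy; rewrite /at_crossing; congr (_ || _); apply/idP/idP => h;
    apply: same_trans h _; by rewrite // same_sym.
apply: (connect_ind (P := fun y => same v d y || (at_crossing d && at_crossing y))).
  by rewrite same_refl.
move=> y z Py /orP[/eqP->|/eqP->].
  case/orP: Py => [dy|/andP[-> dy]]; first by rewrite (same_trans dy (same_arc v y)).
  by rewrite -(zv _ _ (same_arc v y)) dy orbT.
have [yc|yc] := eqVneq y.1 c; last first.
  rewrite smoothing_flip //.
  case/orP: Py => [dy|/andP[-> dy]].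
    by rewrite (same_trans dy (same_smoothing v y)).
  by rewrite -(zv _ _ (same_smoothing v y)) dy orbT.
have zc i : at_crossing (c, i).
  by rewrite /at_crossing ![same v (c, _) (c, i)]same_sym same_strand.
have yz : at_crossing y by case: y yc {Py} => _ i /= ->.
have -> : at_crossing (smoothing w y).
  by case: y yc {Py yz} => _ i /= ->; rewrite /smoothing /=.
rewrite andbT; case/orP: Py => [dy|/andP[-> _]]; last by rewrite orbT.
by rewrite (zv _ _ dy) yz orbT.
Qed.

(** The one-to-one toggle of a nonorientable surface: before and after, the four ends at c lie on
    one circle, so the strands of either smoothing are connections in the other. *)
Lemma same_single d d' : ~~ differ v c -> ~~ differ w c ->
  same v d d' = same w d d'.
Proof.
rewrite !negbK => sv sw.
have vall (u : {set crossing D}) (i j : 'I_4) : same u (c, 0) (c, 2) -> same u (c, i) (c, j).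
  move=> s; apply: (@same_trans _ (c, 0)).
    by case/orP: (same_strand u c i) => // h; apply: same_trans h _; rewrite same_sym.
  rewrite same_sym.
  by case/orP: (same_strand u c j) => // h; apply: same_trans h _; rewrite same_sym.
apply/idP/idP; apply: same_homo => x; (have [xc|xc] := eqVneq x.1 c; last first).
- by rewrite -(smoothing_flip v xc) same_smoothing.
- by case: x xc => _ i /= ->; exact: vall.
- by rewrite (smoothing_flip v xc) same_smoothing.
- by case: x xc => _ i /= ->; exact: vall.
Qed.

End Merge.

End Circles.

(** * The edge maps of the cube *)

Section Classes.
Variables (T : finType) (A : {pred T}) (R R' : rel T) (a b : T).
Hypotheses (Rr : reflexive R) (Rs : symmetric R) (Rt : transitive R).
Let cls (Q : rel T) x : {set T} := [set y | Q x y].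
Let Z x := R a x || R b x.
Hypotheses (aA : a \in A) (bA : b \in A) (Rab : ~~ R a b).
Hypothesis R'E : forall x y, R' x y = R x y || (Z x && Z y).

Lemma cls_eq x y : R x y -> cls R x = cls R y.
Proof.
move=> xy; apply/setP => z; rewrite !inE; apply/idP/idP; apply: Rt => //.
by rewrite Rs.
Qed.

Lemma cls'_out x : ~~ Z x -> cls R' x = cls R x.
Proof. by move=> /negPf Zx; apply/setP => y; rewrite !inE R'E Zx orbF. Qed.

Lemma cls'_in x : Z x -> cls R' x = cls R' a.
Proof.
have Za : Z a by rewrite /Z Rr.
move=> Zx; apply/setP => y; rewrite !inE !R'E Zx Za /=.
suff h z : Z z -> R z y -> Z y.
  by rewrite [R x y || _]orb_idl ?[R a y || _]orb_idl //; exact: h.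
by case/orP=> zz zy; rewrite /Z (Rt zz zy) ?orbT.
Qed.

(** Abstract merging of two classes, applied both to the circles of a smoothing and to the
    components of a forest. *)
Lemma classes_new :
  (cls R' @: A) :\: (cls R @: A) = [set cls R' a].
Proof.
have Za : Z a by rewrite /Z Rr.
have Zb : Z b by rewrite /Z Rr orbT.
apply/setP => z; rewrite !inE; apply/andP/eqP => [[zn /imsetP[x xA zE]]|->].
  have [Zx|nZx] := boolP (Z x); first by rewrite zE cls'_in.
  by case/negP: zn; rewrite zE cls'_out //; apply: imset_f.
split; last exact: imset_f.
apply/imsetP => -[x xA /setP e].
have := e a; have := e b; rewrite !inE !R'E Za Zb Rr !orbT => /esym xb /esym xa.
by case/negP: Rab; rewrite (Rt _ xb) // Rs.
Qed.

Lemma classes_old :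
  (cls R @: A) :\: (cls R' @: A) = [set cls R a; cls R b].
Proof.
have Za : Z a by rewrite /Z Rr.
have Zb : Z b by rewrite /Z Rr orbT.
have out x : Z x -> cls R x \notin cls R' @: A.
  move=> Zx; apply/imsetP => -[y yA /setP e].
  have Zy : Z y.
    have := e x; rewrite !inE Rr R'E => /esym/orP[yx|/andP[]//].
    by case/orP: Zx => h; rewrite /Z; apply/orP; [left|right];
      rewrite Rs; apply: Rt yx _; rewrite Rs.
  have := e a; have := e b; rewrite !inE !R'E Zy Za Zb !orbT => xb xa.
  by case/negP: Rab; rewrite (Rt _ xb) // Rs.
apply/setP => z; rewrite !inE; apply/andP/orP => [[zn /imsetP[x xA zE]]|].
  have [/orP[]/cls_eq e|nZx] := boolP (Z x).
  - by left; rewrite zE e.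
  - by right; rewrite zE e.
  by case/negP: zn; rewrite zE -cls'_out //; apply: imset_f.
by case=> /eqP->; split; rewrite ?imset_f ?out.
Qed.

Lemma cls_ab_neq : cls R a != cls R b.
Proof. by apply/eqP => /setP/(_ b); rewrite !inE Rr (negPf Rab). Qed.

Lemma card_classes_merge : #|cls R @: A| = (#|cls R' @: A|).+1.
Proof.
rewrite -(cardsID (cls R' @: A) (cls R @: A)) classes_old cards2 cls_ab_neq.
rewrite -(cardsID (cls R @: A) (cls R' @: A)) classes_new cards1 setIC; lia.
Qed.

End Classes.

Section CircleSets.
Variable D : rotation_system.
Implicit Types (d : dart D) (c : crossing D) (v w : {set crossing D}).

Lemma circle_eq v d d' : (circle v d == circle v d') = same v d d'.
Proof.
apply/eqP/idP => [/setP/(_ d')|dd'].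
  by rewrite !inE -!/(same _ _ _) same_refl => ->.
apply: cls_eq dd'; [exact: same_sym|exact: same_trans].
Qed.

Lemma mem_circles v d : circle v d \in circles v.
Proof. exact: imset_f. Qed.

Section Differ.
Variables (v : {set crossing D}) (c : crossing D).
Hypothesis dv : differ v c.
Let w := flip v c.

Lemma circles_new : circles w :\: circles v = [set circle w (c, 0)].
Proof.
apply: (classes_new (R := same v) (R' := same w) (b := (c, 2))) => //.
- exact: same_refl.
- exact: same_sym.
- exact: same_trans.
- by move=> x y; exact: same_merge.
Qed.

Lemma circles_old :
  circles v :\: circles w = [set circle v (c, 0); circle v (c, 2)].
Proof.
apply: (classes_old (R := same v) (R' := same w)) => //.
- exact: same_refl.
- exact: same_sym.
- exact: same_trans.
- by move=> x y; exact: same_merge.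
Qed.

Lemma card_circles_merge : #|circles v| = #|circles w|.+1.
Proof.
apply: (card_classes_merge (R := same v) (R' := same w)
  (a := (c, 0)) (b := (c, 2))) => //.
- exact: same_refl.
- exact: same_sym.
- exact: same_trans.
- by move=> x y; exact: same_merge.
Qed.

Lemma circle_old_neq : circle v (c, 0) != circle v (c, 2).
Proof. by rewrite circle_eq. Qed.

Lemma circle_merge d :
  circle w d = if at_crossing v c d then circle w (c, 0) else circle v d.
Proof.
have R' x y := @same_merge D v c x y dv.
have [dc|dc] := boolP (at_crossing v c d); last exact: (cls'_out R').
apply/eqP; rewrite circle_eq R' dc /at_crossing same_refl orbT //.
Qed.

Lemma at_crossingE d : at_crossing v c d =
  (circle v d == circle v (c, 0)) || (circle v d == circle v (c, 2)).
Proof. by rewrite !circle_eq ![same v d _]same_sym. Qed.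

End Differ.

Lemma circles_single v c : ~~ differ v c -> ~~ differ (flip v c) c ->
  forall d, circle v d = circle (flip v c) d.
Proof.
by move=> nv nw d; apply/setP => d'; rewrite !inE; exact: same_single.
Qed.

End CircleSets.

Definition valid (D : rotation_system) (p : dart D)
    (v : {set crossing D}) (x : {set {set dart D}}) :=
  (x \subset circles v) && (circle v p \in x).

(* An abstract copy of [reduced_state p]: comparing two elements of the       *)
(* latter by computation is prohibitively expensive.                          *)
Record state_space (D : rotation_system) (p : dart D) := StateSpace {
  st :> finType;
  res : st -> {set crossing D};
  labels : st -> {set {set dart D}};
  st_valid : forall s, valid p (res s) (labels s);
  st_surj : forall v x, valid p v x -> exists s, res s = v /\ labels s = x;
  st_inj : forall s t, res s = res t -> labels s = labels t -> s = t }.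

Section Operators.
Variables (D : rotation_system) (p : dart D) (S : state_space p).
Implicit Types (d : dart D) (c : crossing D) (v w : {set crossing D}).
Implicit Types (x y : {set {set dart D}}) (l : seq (dart D)) (s t : S).

Definition ket v x : fspace S := [ffun s => ((res s == v) && (labels s == x))%:R].

Lemma ket_at v x t : ket v x t = ((res t == v) && (labels t == x))%:R.
Proof. by rewrite ffunE. Qed.

Lemma basis_ket s : basis_vec s = ket (res s) (labels s).
Proof.
apply/ffunP => t; rewrite !ffunE; congr (_%:R).
congr nat_of_bool; apply/eqP/andP => [->|[/eqP r /eqP l]]; first by rewrite !eqxx.
exact: st_inj.
Qed.

Lemma ket_basis v x : valid p v x ->
  exists s, [/\ res s = v, labels s = x & basis_vec s = ket v x].
Proof. by case/(st_surj S) => s [<- <-]; exists s; rewrite basis_ket. Qed.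

Lemma ket_invalid v x : ~~ valid p v x -> ket v x = 0.
Proof.
move=> nv; apply/ffunP => s; rewrite ket_at ffunE.
case: eqP => //= rv; case: eqP => //= lx; case/negP: nv; rewrite -rv -lx.
exact: st_valid.
Qed.

Definition on_basis (phi : S -> fspace S) : endo S :=
  extend (fun s t => phi s t).

Lemma on_basisE phi s : on_basis phi (basis_vec s) = phi s.
Proof. by apply/ffunP => t; rewrite extend_basis. Qed.

(** Multiplication by X on the circle marked by d; on the reduced complex [X d] squares to 0 and
    [X p] is 0. *)
Definition X d : endo S := on_basis (fun s =>
  if circle (res s) d \in labels s then 0
  else ket (res s) (circle (res s) d |: labels s)).

Lemma X_ket d v x : valid p v x ->
  X d (ket v x) = if circle v d \in x then 0 else ket v (circle v d |: x).
Proof. by case/ket_basis => s [<- <- <-]; rewrite on_basisE. Qed.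

(* The product of the multiplications by X on the circles through the darts   *)
(* in l; it vanishes as soon as two of these, or one of them and p, lie on    *)
(* the same circle.                                                           *)
Definition mon v l : fspace S :=
  foldr (fun d u => X d u) (ket v [set circle v p]) l.

Definition lab v l : {set {set dart D}} := [set z in map (circle v) (p :: l)].

Lemma lab_mem v l z : (z \in lab v l) = (z \in map (circle v) (p :: l)).
Proof. by rewrite inE. Qed.

Lemma lab_valid v l : valid p v (lab v l).
Proof.
rewrite /valid inE mem_head andbT; apply/subsetP => z; rewrite inE.
by case/mapP => d _ ->; exact: mem_circles.
Qed.

Lemma lab_cons v d l : lab v (d :: l) = circle v d |: lab v l.
Proof. by apply/setP => z; rewrite !inE orbCA. Qed.

Lemma monE v l : mon v l =
  if uniq (map (circle v) (p :: l)) then ket v (lab v l) else 0.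
Proof.
elim: l => [|d l IH] /=.
  by congr (ket v _); apply/setP => z; rewrite !inE.
rewrite -/(mon v l) IH.
have -> : [&& circle v p \notin circle v d :: map (circle v) l,
     circle v d \notin map (circle v) l & uniq (map (circle v) l)] =
    (circle v d \notin lab v l) && uniq (map (circle v) (p :: l)).
  rewrite /lab /= !inE !negb_or [circle v p == _]eq_sym.
  by case: (_ == _); rewrite //= andbCA.
case: ifP => _; last by rewrite andbF linear0.
by rewrite andbT X_ket ?lab_valid // lab_cons; case: (_ \in _).
Qed.

Lemma mon_cons v d l : mon v (d :: l) = X d (mon v l).
Proof. by []. Qed.

Lemma basis_mon s : exists l, basis_vec s = mon (res s) l.
Proof.
set v := res s.
have rep (zs : seq {set dart D}) : {subset zs <= circles v} ->
    exists l, map (circle v) l = zs.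
  elim: zs => [|z zs IH] sub; first by exists [::].
  case: IH => [y yz|l lE]; first by apply: sub; rewrite inE yz orbT.
  have /imsetP[d _ zd] := sub z (mem_head _ _).
  by exists (d :: l); rewrite /= lE zd.
have /andP[/subsetP sub ps] := st_valid s.
have [l lE] : exists l, map (circle v) l = enum (labels s :\ circle v p).
  by apply: rep => z; rewrite mem_enum inE => /andP[_ /sub].
exists l; rewrite monE /= lE enum_uniq mem_enum !inE eqxx /= basis_ket.
congr (ket _ _); apply/setP => z; rewrite /lab /= lE !inE mem_enum !inE.
by case: eqP => [->|].
Qed.

(** Monomials are preferred to states because an edge map keeps the list of marked darts, apart from
    a possible extra factor, whereas the circles themselves change. *)
Lemma endo_ext (f g : endo S) : (forall v l, f (mon v l) = g (mon v l)) ->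
  f = g.
Proof.
by move=> fg; apply: lfun_eq_basis => s; have [l ->] := basis_mon s.
Qed.

Lemma X_comm d d' u : X d (X d' u) = X d' (X d u).
Proof.
suff : X d * X d' = X d' * X d by move=> /lfunP/(_ u); rewrite !endo_mulE.
apply: endo_ext => v l; rewrite !endo_mulE -!mon_cons !monE.
have -> : lab v (d :: d' :: l) = lab v (d' :: d :: l).
  by rewrite !lab_cons setUCA.
congr (if _ then _ else _); apply: perm_uniq.
by rewrite perm_map // perm_cons (perm_catCA [:: d] [:: d'] l).
Qed.

Lemma mon_same v d d' l : same v d d' -> mon v (d :: l) = mon v (d' :: l).
Proof. by rewrite -circle_eq => /eqP e; rewrite !monE /lab /= e. Qed.

Lemma mon_dup v d d' l : same v d d' -> mon v (d :: d' :: l) = 0.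
Proof.
rewrite -circle_eq => /eqP e; rewrite monE /= e !inE eqxx /=.
by rewrite !negb_or andbF.
Qed.

Definition smooth_incidence v x w y : bool :=
  let old := circles v :\: circles w in
  let new := circles w :\: circles v in
  [&& x :\: old == y :\: new
    & [&& #|old| == 2, #|new| == 1 & merge_rule #|x :&: old| #|y :&: new|]
      || [&& #|old| == 1, #|new| == 2
           & split_rule #|x :&: old| #|y :&: new|] ]%N.

(* The edge maps of the cube at c, in both directions at once: also from a    *)
(* B-smoothing to an A-smoothing.                                             *)
Definition E c : endo S := extend (fun s t => ((res t == flip (res s) c) &&
  smooth_incidence (res s) (labels s) (res t) (labels t))%:R).

Lemma E_ket c v x t : valid p v x -> E c (ket v x) t =
  ((res t == flip v c) && smooth_incidence v x (res t) (labels t))%:R.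
Proof. by case/ket_basis => s [<- <- <-]; rewrite extend_basis. Qed.

Section EDiffer.
Variables (v : {set crossing D}) (c : crossing D).
Hypothesis dv : differ v c.
Let w := flip v c.
Let z1 := circle v (c, 0).
Let z2 := circle v (c, 2).
Let z := circle w (c, 0).
Let zz : {set {set dart D}} := [set z1; z2].

Lemma lab_merge l : lab w l :\ z = lab v l :\: zz.
Proof.
have zv : z \notin circles v.
  by have := set11 z; rewrite -(circles_new dv) in_setD => /andP[].
apply/setP => u; rewrite in_setD1 in_setD !lab_mem in_set2 negb_or.
apply/andP/andP => -[uz].
  move=> /mapP[d dl uE]; move: uz.
  rewrite uE (circle_merge dv) at_crossingE; case: ifP => [_|/norP[n1 n2] _].
    by rewrite eqxx.
  by rewrite n1 n2; split=> //; apply: map_f.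
move=> /mapP[d dl uE]; move: uz; rewrite uE -negb_or -at_crossingE => nd.
split; first by apply: contraNneq zv => <-; exact: mem_circles.
by apply/mapP; exists d => //; rewrite (circle_merge dv) (negPf nd).
Qed.

Lemma lab_merge_mem l : (z \in lab w l) = (z1 \in lab v l) || (z2 \in lab v l).
Proof.
have zv : z \notin circles v.
  by have := set11 z; rewrite -(circles_new dv) in_setD => /andP[].
rewrite !lab_mem; apply/idP/idP.
  case/mapP => d dl; rewrite (circle_merge dv) at_crossingE.
  case: ifP => [/orP[]/eqP h _|_ zE].
  - by apply/orP; left; rewrite /z1 -h; apply: map_f.
  - by apply/orP; right; rewrite /z2 -h; apply: map_f.
  by case/negP: zv; rewrite zE mem_circles.
case/orP=> /mapP[d dl h]; apply/mapP; exists d => //;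
  by rewrite (circle_merge dv) at_crossingE -h eqxx ?orbT.
Qed.

Lemma card_pairI y : #|y :&: zz| = ((z1 \in y) + (z2 \in y))%N.
Proof.
have n21 : z2 != z1 by rewrite eq_sym; exact: circle_old_neq.
rewrite (cardsD1 z1) (cardsD1 z2) !(in_setD1, in_setI, in_set2) !eqxx orbT.
rewrite n21 !andbT /= addnA (_ : _ :\ z2 = set0) ?cards0 ?addn0 //.
by apply/setP => u; rewrite !inE; do 2!case: (u == _); rewrite ?andbF.
Qed.

Lemma uniq_merge l : uniq (map (circle w) (p :: l)) =
  uniq (map (circle v) (p :: l)) && ~~ ((z1 \in lab v l) && (z2 \in lab v l)).
Proof.
have U (u : {set crossing D}) :
    uniq (map (circle u) (p :: l)) = (#|lab u l| == (size l).+1).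
  rewrite -(size_map (circle u) l) -[X in _ == X]/(size (map (circle u) (p :: l))).
  by rewrite cardsE; apply/card_uniqP/eqP.
have L (u : {set crossing D}) : (#|lab u l| <= (size l).+1)%N.
  by rewrite cardsE (leq_trans (card_size _)) //= size_map.
have := L v; have := L w.
rewrite !U (cardsD1 z (lab w l)) lab_merge lab_merge_mem.
rewrite -(cardsID zz (lab v l)).
rewrite card_pairI.
move: #|_ :\: zz| (size l) => k m.
case: (_ \in lab v l); case: (_ \in lab v l) => /=; rewrite ?add0n; lia.
Qed.

Lemma card_oneI y : #|y :&: [set z]| = (z \in y).
Proof.
rewrite (cardsD1 z) !inE eqxx andbT (_ : _ :\ z = set0) ?cards0 ?addn0 //.
by apply/setP => u; rewrite !inE; case: (u == _); rewrite ?andbF.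
Qed.

Lemma set_eq_off1 x y : (x == y) = (x :\ z == y :\ z) && ((z \in x) == (z \in y)).
Proof.
apply/eqP/andP => [->|[/eqP/setP e /eqP h]]; first by rewrite !eqxx.
apply/setP => u; have [->//|uz] := eqVneq u z.
by have := e u; rewrite !inE uz.
Qed.

Lemma set_eq_off2 x y : (x == y) = [&& x :\: zz == y :\: zz,
  (z1 \in x) == (z1 \in y) & (z2 \in x) == (z2 \in y)].
Proof.
apply/eqP/and3P => [->|[/eqP/setP e /eqP h1 /eqP h2]]; first by rewrite !eqxx.
apply/setP => u; have [->//|uz1] := eqVneq u z1.
have [->//|uz2] := eqVneq u z2.
by have := e u; rewrite !inE (negPf uz1) (negPf uz2).
Qed.

Lemma incidence_merge x y : smooth_incidence v x w y =
  (x :\: zz == y :\ z) &&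
  merge_rule ((z1 \in x) + (z2 \in x)) (z \in y).
Proof.
rewrite /smooth_incidence (circles_old dv) (circles_new dv) card_pairI card_oneI.
by rewrite cards1 cards2 (circle_old_neq dv) /= orbF.
Qed.

Lemma incidence_split x y : smooth_incidence w x v y =
  (x :\ z == y :\: zz) &&
  split_rule (z \in x) ((z1 \in y) + (z2 \in y)).
Proof.
rewrite /smooth_incidence (circles_old dv) (circles_new dv) card_pairI card_oneI.
by rewrite cards1 cards2 (circle_old_neq dv) /=.
Qed.

(** Multiplication is a ring map, so the marked darts just move to the merged circle; two factors
    that meet there give [X * X = 0]. *)
Lemma E_merge l : E c (mon v l) = mon w l.
Proof.
rewrite !monE uniq_merge; case: ifP => _; last by rewrite linear0.
apply/ffunP => t; rewrite E_ket ?lab_valid // -/w.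
transitivity ((if ~~ ((z1 \in lab v l) && (z2 \in lab v l)) then ket w (lab w l)
   else 0) t); last by [].
rewrite (fun_if (fun f : fspace S => f t)) ket_at ffunE.
case: eqP => [->|_]; last by case: ifP.
rewrite incidence_merge [labels t == _]set_eq_off1 lab_merge lab_merge_mem.
rewrite [labels t :\ z == _]eq_sym.
do 2!case: (_ \in lab v l); case: (_ \in labels t) => //=;
  by rewrite ?andbT ?andbF.
Qed.

(** After lifting a label to either new circle, comultiplication is multiplication by the sum of the
    two X's, one for each strand of c. *)
Lemma E_split l : E c (mon w l) = mon v ((c, 0) :: l) + mon v ((c, 2) :: l).
Proof.
have swap d : uniq (map (circle v) [:: p, d & l]) =
    (circle v d \notin lab v l) && uniq (map (circle v) (p :: l)).
  rewrite (perm_uniq (_ : perm_eq _ (map (circle v) [:: d, p & l]))).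
    by rewrite /= !inE.
  by rewrite perm_map // (perm_catCA [:: p] [:: d] l).
have off d : d = (c, 0) \/ d = (c, 2) ->
    (circle v d |: lab v l) :\: zz = lab v l :\: zz.
  move=> h; apply/setP => u; rewrite !inE -/z1 -/z2.
  by case: h => ->; rewrite -/z1 -/z2; do 2!case: (u == _).
have wv : flip w c = v by exact: flipK.
have n12 : (z1 == z2) = false by apply/negbTE/circle_old_neq.
rewrite !monE !swap uniq_merge; case: (uniq _); rewrite ?andbT ?andbF /=;
  last by rewrite linear0 addr0.
apply/ffunP => t; rewrite [RHS]ffunE !(fun_if (fun f : fspace S => f t)).
rewrite !(fun_if (E c)) linear0 (fun_if (fun f : fspace S => f t)).
rewrite E_ket ?lab_valid // wv !ket_at !ffunE -/z1 -/z2.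
case: eqP => [->|_]; last by do 2!case: (_ \in lab v l); rewrite /= addr0.
rewrite incidence_split ![labels t == _]set_eq_off2 lab_merge lab_merge_mem.
rewrite !lab_cons !off; try by [left|right].
rewrite !in_setU !in_set1 !eqxx -/z1 -/z2 n12 [z2 == z1]eq_sym n12 /=.
rewrite [lab v l :\: zz == _]eq_sym.
case: (_ == lab v l :\: zz) => /=; last first.
  by do 2!case: (_ \in lab v l); rewrite /= addr0.
by do 2!case: (_ \in lab v l); do 2!case: (_ \in labels t);
  apply/eqP.
Qed.

End EDiffer.

Lemma E_none v c l : ~~ differ v c -> ~~ differ (flip v c) c ->
  E c (mon v l) = 0.
Proof.
move=> nv nw; rewrite monE; case: ifP => _; last by rewrite linear0.
apply/ffunP => t; rewrite E_ket ?lab_valid // [RHS]ffunE.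
case: eqP => //= ->; rewrite /smooth_incidence.
have -> : circles (flip v c) = circles v.
  by apply: eq_imset => d; rewrite -circles_single.
by rewrite setDv cards0 andbF.
Qed.

Definition Y c : endo S := X (c, 0) + X (c, 2).

(** One formula for merge, split and one-to-one toggle: the edge map carries the marked darts along
    and multiplies by this factor. *)
Definition Yfac v c : endo S :=
  if differ v c then 1 else if differ (flip v c) c then Y c else 0.

Lemma Y_mon v c l :
  Y c (mon v l) = mon v ((c, 0) :: l) + mon v ((c, 2) :: l).
Proof. exact: endo_addE. Qed.

Lemma E_mon v c l : E c (mon v l) = Yfac v c (mon (flip v c) l).
Proof.
rewrite /Yfac; case: ifP => [dv|/negbT nv]; first by rewrite endo_1E E_merge.
case: ifP => [dw|/negbT nw]; last by rewrite endo_0E E_none.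
by rewrite Y_mon -{1}(flipK v c) (E_split dw).
Qed.

Lemma XX_comm d d' : GRing.comm (X d) (X d').
Proof. by apply/lfunP => u; rewrite !endo_mulE X_comm. Qed.

Lemma XY_comm d c : GRing.comm (X d) (Y c).
Proof. by apply: commrD; exact: XX_comm. Qed.

Lemma YY_comm b c : GRing.comm (Y b) (Y c).
Proof. by apply/commr_sym/commrD; apply/commr_sym/XY_comm. Qed.

Lemma XYfac_comm d v c : GRing.comm (X d) (Yfac v c).
Proof.
rewrite /Yfac; case: ifP => _; first exact: commr1.
case: ifP => _; [exact: XY_comm|exact: commr0].
Qed.

Lemma EX_comm c d : GRing.comm (E c) (X d).
Proof.
apply: endo_ext => v l; rewrite !endo_mulE -mon_cons !E_mon mon_cons.
by rewrite -!endo_mulE XYfac_comm.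
Qed.

Lemma EY_comm b c : GRing.comm (E b) (Y c).
Proof. by apply: commrD; exact: EX_comm. Qed.

Lemma EYfac_comm b v c : GRing.comm (E b) (Yfac v c).
Proof.
rewrite /Yfac; case: ifP => _; first exact: commr1.
case: ifP => _; [exact: EY_comm|exact: commr0].
Qed.

Lemma Y_zero v c l : ~~ differ v c -> Y c (mon v l) = 0.
Proof.
rewrite negbK => s; rewrite Y_mon (mon_same l s); exact: fspace_char2.
Qed.

Lemma differ_excl v c : ~~ (differ v c && differ (flip v c) c).
Proof. by apply/negP => /andP[/differ_flip/negP]. Qed.

Lemma differ_card v c : (#|circles (flip v c)| + differ v c =
  #|circles v| + differ (flip v c) c)%N.
Proof.
have [dv|nv] := boolP (differ v c).
  by rewrite (negPf (differ_flip dv)) (card_circles_merge dv) addn1 addn0.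
have [dw|nw] := boolP (differ (flip v c) c).
  by rewrite (card_circles_merge dw) flipK addn1 addn0.
by congr (#|pred_of_set _| + _)%N; apply: eq_imset => d; rewrite -circles_single.
Qed.

Lemma differ_single v a b : ~~ differ v a -> ~~ differ (flip v a) a ->
  differ (flip v a) b = differ v b.
Proof. by move=> na nfa; rewrite /differ -(same_single _ _ na nfa). Qed.

(** Merging at b prevents a merge at a only if a and b connect the same pair of circles. *)
Lemma Y_merge2 v a b l : differ v a -> differ v b -> ~~ differ (flip v b) a ->
  Y a (mon v l) = Y b (mon v l).
Proof.
move=> da db; rewrite negbK (same_merge _ _ db) (negPf da) /=.
case/andP=> ha hb; rewrite !Y_mon.
have m d d' : same v d d' -> mon v (d' :: l) = mon v (d :: l).
  by move/(mon_same l).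
case/orP: ha => h0; case/orP: hb => h2; rewrite (m _ _ h0) (m _ _ h2) //.
- by case/negP: da; apply: same_trans h2; rewrite same_sym.
- by rewrite addrC.
- by case/negP: da; apply: same_trans h2; rewrite same_sym.
Qed.

Variant toggle_spec (m n : nat) : bool -> bool -> Type :=
  | ToggleMerge of m = n.+1 : toggle_spec m n true false
  | ToggleSplit of n = m.+1 : toggle_spec m n false true
  | ToggleSingle of n = m : toggle_spec m n false false.

Lemma toggleP v c : toggle_spec #|circles v| #|circles (flip v c)|
  (differ v c) (differ (flip v c) c).
Proof.
have := differ_excl v c; have := differ_card v c.
case: (differ v c); case: (differ _ c) => // e _; constructor; move: e; lia.
Qed.

(** Circle counts leave few combinations of toggles around the square. The characteristic matters
    when a split followed by a merge faces two one-to-one toggles: that composite is multiplication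
    by 2X, hence 0. *)
Lemma EE_comm a b : GRing.comm (E a) (E b).
Proof.
have [->|ab] := eqVneq a b; first exact: commr_refl.
apply: endo_ext => v l; rewrite !endo_mulE !E_mon.
rewrite -!endo_mulE !EYfac_comm !endo_mulE !E_mon [flip (flip v b) a]flipC.
set va := flip v a; set vb := flip v b; set u := flip va b.
have vbu : flip vb a = u by rewrite /u flipC.
have uva : flip u b = va by exact: flipK.
have uvb : flip u a = vb by rewrite -vbu flipK.
have YYu : Y a (Y b (mon u l)) = Y b (Y a (mon u l)).
  by rewrite -!endo_mulE YY_comm.
have Yu c : differ u c = false -> Y c (mon u l) = 0.
  by move=> h; rewrite Y_zero // h.
have Ya := Yu a; have Yb := Yu b.
have ma := @Y_merge2 u a b l; have Sa := @differ_single v a b.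
have Sb := @differ_single v b a.
rewrite uva -/va -/vb in ma Sa Sb; rewrite /Yfac vbu -/u -/va -/vb.
have Ta := toggleP v a; have Tb := toggleP v b.
have Tab := toggleP va b; have Tba := toggleP vb a.
rewrite ?vbu -/u -/va -/vb in Ta Tb Tab Tba.
move: Ya Yb ma Sa Sb Ta Tb Tab Tba YYu {Yu uva uvb vbu}.
move: (mon u l) (Y a) (Y b) => m ya yb.
move: (differ v a) (differ va a) (differ v b) (differ vb b).
move: (differ va b) (differ u b) (differ vb a) (differ u a).
move: #|circles v| #|circles va| #|circles vb| #|circles u|.
move=> n0 n1 n2 n3 b0 b1 b2 b3 b4 b5 b6 b7 Ya Yb ma Sa Sb Ta Tb Tab Tba YYu.
move: Ya Yb ma Sa Sb.
case: Ta => na; case: Tb => nb; case: Tab => nab; case: Tba => nba;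
  move=> Ya Yb ma Sa Sb; rewrite ?(endo_1E, endo_0E, linear0) //;
  try (exfalso; clear -na nb nab nba; lia);
  by [rewrite Ya|rewrite Yb|rewrite ma|have := Sa isT isT|have := Sb isT isT|
      rewrite Ya // Yb].
Qed.

End Operators.

(** * Projections and derivations of the cube *)

Section Derivations.
Variables (D : rotation_system) (p : dart D) (S : state_space p).
Implicit Types (d : dart D) (c : crossing D) (v w : {set crossing D}).
Implicit Types (x y : {set {set dart D}}) (l : seq (dart D)) (s t : S).
Arguments mon : simpl never.
Local Notation X := (@X D p S).
Local Notation E := (@E D p S).
Local Notation Y := (@Y D p S).
Local Notation mon := (@mon D p S).
Local Notation ket := (@ket D p S).

Definition proj (Q : pred {set crossing D}) : endo S :=
  on_basis (fun s => if Q (res s) then basis_vec s else 0).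

Lemma proj_ket Q v x : proj Q (ket v x) = if Q v then ket v x else 0.
Proof.
have [val|nval] := boolP (valid p v x); last first.
  by rewrite ket_invalid // linear0 if_same.
by have [s [rs ls <-]] := ket_basis S val; rewrite on_basisE rs.
Qed.

Lemma proj_mon Q v l : proj Q (mon v l) = if Q v then mon v l else 0.
Proof.
rewrite monE; case: ifP => _; first exact: proj_ket.
by rewrite linear0 if_same.
Qed.

Lemma proj_E Q c : proj Q * E c = E c * proj (fun v => Q (flip v c)).
Proof.
apply: endo_ext => v l; rewrite !endo_mulE proj_mon !(fun_if (E c)) linear0.
rewrite E_mon /Yfac; case: ifP => _.
  by rewrite endo_1E proj_mon.
case: ifP => _; last by rewrite endo_0E linear0 if_same.
rewrite Y_mon linearD /= !proj_mon; case: ifP => //; by rewrite addr0.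
Qed.

Lemma projM Q Q' : proj Q * proj Q' = proj (fun v => Q v && Q' v).
Proof.
apply: endo_ext => v l; rewrite !endo_mulE !proj_mon.
by case: (Q' v); rewrite ?andbT ?andbF ?linear0 // proj_mon.
Qed.

Lemma eq_proj Q Q' : Q =1 Q' -> proj Q = proj Q'.
Proof. by move=> QQ; apply: endo_ext => v l; rewrite !proj_mon QQ. Qed.

Lemma proj0 Q : Q =1 xpred0 -> proj Q = 0.
Proof. by move=> Q0; apply: endo_ext => v l; rewrite !proj_mon Q0 endo_0E. Qed.

Lemma proj_addC Q : proj Q + proj (fun v => ~~ Q v) = 1.
Proof.
apply: endo_ext => v l; rewrite endo_addE endo_1E !proj_mon.
by case: (Q v); rewrite ?addr0 ?add0r.
Qed.

Definition on_circle (lam : pred (dart D)) (z : {set dart D}) :=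
  [exists d in z, lam d].

(* The derivation that sends X on a circle to lam of this circle and 1 to 0.  *)
Definition Der (lam : {set crossing D} -> pred (dart D)) : endo S :=
  on_basis (fun s => \sum_(z in labels s | on_circle (lam (res s)) z)
    ket (res s) (labels s :\ z)).

(** Vanishing at p keeps the label X on the basepoint circle, so that [Der] acts on the reduced
    complex. *)
Definition circle_labeling (lam : {set crossing D} -> pred (dart D)) :=
  (forall v d d', same v d d' -> lam v d = lam v d') /\ forall v, lam v p = false.

Section Der.
Variable lam : {set crossing D} -> pred (dart D).
Hypothesis lam_circle : circle_labeling lam.

Lemma on_circleE v d : on_circle (lam v) (circle v d) = lam v d.
Proof.
have [h _] := lam_circle.
apply/existsP/idP => [[d']|ld]; last by exists d; rewrite inE connect0.
by rewrite inE => /andP[/h ->].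
Qed.

Lemma Der_ket v x : valid p v x -> Der lam (ket v x) =
  \sum_(z in x | on_circle (lam v) z) ket v (x :\ z).
Proof. by case/(ket_basis S) => s [<- <- <-]; rewrite on_basisE. Qed.

(** The Leibniz rule: X on a circle is sent to a scalar, so [Der] and [X d] commute up to the scalar
    [lam v d]. *)
Lemma Der_X_ket d v x : valid p v x ->
  Der lam (X d (ket v x)) =
  X d (Der lam (ket v x)) + (if lam v d then ket v x else 0).
Proof.
move=> val; have [xv px] := andP val; rewrite X_ket // Der_ket //.
set z := circle v d.
have base : on_circle (lam v) (circle v p) = false.
  by rewrite on_circleE; case: lam_circle.
have nb u : on_circle (lam v) u -> circle v p != u by apply: contraTneq => <-; rewrite base.
have valD u : on_circle (lam v) u -> valid p v (x :\ u).
  move=> /nb pu; rewrite /valid in_setD1 pu px !andbT.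
  exact: subset_trans (subsetDl _ _) xv.
have lz : on_circle (lam v) z = lam v d by exact: on_circleE.
rewrite linear_sum /=.
have XE u : on_circle (lam v) u -> X d (ket v (x :\ u)) =
    if z \in x :\ u then 0 else ket v (z |: x :\ u).
  by move=> ou; rewrite X_ket ?valD.
rewrite (eq_bigr (fun u => if z \in x :\ u then 0 else ket v (z |: x :\ u)));
  last by move=> u /andP[_ /XE].
have [zx|zx] := boolP (z \in x).
  rewrite linear0; have [ld|nld] := boolP (lam v d).
    rewrite (bigD1 z) ?zx ?lz //= in_setD1 eqxx /= setD1K //.
    rewrite big1 ?addr0 ?fspace_char2 // => u /andP[_ uz].
    by rewrite in_setD1 zx eq_sym uz.
  rewrite big1 ?addr0 // => u /andP[ux ou].
  have uz : z != u by apply: contraNneq nld => uz; rewrite -lz uz.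
  by rewrite in_setD1 zx uz.
have valz : valid p v (z |: x).
  by rewrite /valid in_setU1 px orbT andbT subUset sub1set mem_circles.
rewrite Der_ket //; have [ld|nld] := boolP (lam v d).
  rewrite (bigD1 z) ?setU11 ?lz //= setU1K // addrC; congr (_ + _).
  apply: eq_big => [u|u].
    rewrite in_setU1; have [->|uz] := eqVneq u z; last by rewrite andbT.
    by rewrite (negPf zx) andbF.
  case/andP=> /andP[_ ou] uz; rewrite in_setD1 (negPf zx) andbF.
  congr ket; apply/setP => t; rewrite !inE.
  by have [->|] := eqVneq t u; rewrite ?(negPf uz).
rewrite addr0; apply: eq_big => [u|u].
  rewrite in_setU1; have [->|//] := eqVneq u z.
  by rewrite lz (negPf nld) !andbF.
rewrite in_setU1; have [->|uz /andP[_ ou]] := eqVneq u z.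
  by rewrite lz (negPf nld) andbF.
rewrite in_setD1 (negPf zx) andbF.
congr ket; apply/setP => t; rewrite !inE.
by have [->|] := eqVneq t u; rewrite ?(negPf uz).
Qed.

Lemma Der_cons v d l : Der lam (mon v (d :: l)) =
  X d (Der lam (mon v l)) + (if lam v d then mon v l else 0).
Proof.
rewrite mon_cons monE; case: ifP => _; last by rewrite !linear0 if_same addr0.
exact: Der_X_ket (lab_valid _ _ _).
Qed.

Lemma Der_nil v : Der lam (mon v [::]) = 0.
Proof.
have val : valid p v [set circle v p] by rewrite /valid set11 sub1set mem_circles.
rewrite [mon _ _]/(ket _ _) Der_ket // big1 // => z; rewrite in_set1.
by case/andP=> /eqP->; rewrite on_circleE; case: lam_circle => _ ->.
Qed.

Lemma proj_Der Q : proj Q * Der lam = Der lam * proj Q.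
Proof.
apply: endo_ext => v l; rewrite !endo_mulE proj_mon !(fun_if (Der lam)) linear0.
elim: l => [|d l IH]; first by rewrite Der_nil linear0 if_same.
have pX u : proj Q (X d u) = X d (proj Q u).
  rewrite -!endo_mulE; congr (fun_of_lfun _ u); apply: endo_ext => v' l'.
  by rewrite !endo_mulE -mon_cons !proj_mon !(fun_if (X d)) linear0.
rewrite Der_cons linearD /= pX IH (fun_if (proj Q)) linear0 proj_mon.
by case: (Q v); case: (lam v d); rewrite ?linear0 ?addr0.
Qed.

Lemma Der_Y v c l : Der lam (Y c (mon v l)) = Y c (Der lam (mon v l)) +
  (if lam v (c, 0) (+) lam v (c, 2) then mon v l else 0).
Proof.
rewrite Y_mon linearD /= !Der_cons [Y c _]endo_addE addrACA; congr (_ + _).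
by do 2!case: (lam v _); rewrite ?fspace_char2 ?addr0 ?add0r.
Qed.

Lemma Der_zero v l : (forall d, lam v d = false) -> Der lam (mon v l) = 0.
Proof.
by move=> h; elim: l => [|d l IH]; rewrite ?Der_nil // Der_cons IH h linear0 addr0.
Qed.

(** The derivative of a split factor [Y b] is the sum of the values of [lam] at the two strands of
    b, and equal values cancel. *)
Lemma E_Der v b l : (forall d, lam (flip v b) d = lam v d) ->
  lam v (b, 0) = lam v (b, 2) ->
  E b (Der lam (mon v l)) = Der lam (E b (mon v l)).
Proof.
move=> lv lb; elim: l => [|d l IH].
  rewrite Der_nil linear0 E_mon /Yfac; case: ifP => _.
    by rewrite endo_1E Der_nil.
  case: ifP => _; last by rewrite endo_0E linear0.
  by rewrite Der_Y Der_nil !lv lb addbb linear0 addr0.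
have XE u : X d (E b u) = E b (X d u) by rewrite -!endo_mulE EX_comm.
rewrite Der_cons linearD /= -XE IH mon_cons -XE (fun_if (E b)) linear0.
rewrite !E_mon /Yfac.
set w := flip v b in lv *; case: ifP => _.
  by rewrite !endo_1E -mon_cons Der_cons lv.
case: ifP => _; last by rewrite !endo_0E !linear0 if_same addr0.
have XY u : X d (Y b u) = Y b (X d u) by rewrite -!endo_mulE XY_comm.
rewrite Der_Y linearD /= XY XY -mon_cons Der_Y Der_cons !linearD /= !lv lb addbb.
rewrite addr0 linear0 addr0; congr (_ + _).
by rewrite (fun_if (Y b)) linear0.
Qed.

End Der.

Lemma Der_Der lam mu : circle_labeling lam -> circle_labeling mu ->
  GRing.comm (Der lam) (Der mu).
Proof.
move=> hl hm; apply: endo_ext => v l; rewrite !endo_mulE.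
elim: l => [|d l IH]; first by rewrite !Der_nil // !linear0.
(* The Leibniz rule is needed for vectors over v that are not given as monomials. *)
have XD nu (h : circle_labeling nu) (w : fspace S) :
   proj (pred1 v) w = w -> Der nu (X d w) = X d (Der nu w) + (if nu v d then w else 0).
  move=> pw; have cX u : proj (pred1 v) (X d u) = X d (proj (pred1 v) u).
    rewrite -!endo_mulE; congr (fun_of_lfun _ u); apply: endo_ext => v' l'.
    by rewrite !endo_mulE -mon_cons !proj_mon !(fun_if (X d)) linear0.
  suff : Der nu * X d * proj (pred1 v) = X d * Der nu * proj (pred1 v) +
      (if nu v d then proj (pred1 v) else 0).
    move=> /lfunP/(_ w); rewrite endo_addE !endo_mulE pw => ->; congr (_ + _).
    by case: (nu v d); rewrite ?pw // endo_0E.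
  apply: endo_ext => v' l'; rewrite endo_addE !endo_mulE proj_mon /=.
  case: eqP => [->|nv]; last first.
    rewrite !linear0 add0r; case: ifP => _; rewrite ?endo_0E // proj_mon.
    by rewrite /= (introF eqP nv).
  rewrite -mon_cons Der_cons //; congr (_ + _).
  by case: ifP => _; rewrite ?endo_0E ?proj_mon /= ?eqxx.
have pD nu (h : circle_labeling nu) : proj (pred1 v) (Der nu (mon v l)) = Der nu (mon v l).
  by rewrite -endo_mulE proj_Der // endo_mulE proj_mon /= eqxx.
rewrite !Der_cons // !linearD /= !XD ?pD // IH.
rewrite -!addrA; congr (_ + _); rewrite addrC.
by case: (lam v d); case: (mu v d); rewrite ?linear0 ?addr0 ?add0r // addrC.
Qed.

End Derivations.

(** * Retraction onto one generator for each subcube *)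

Section Blocks.
Variables (D : rotation_system) (p : dart D) (S : state_space p).
Implicit Types (d : dart D) (a b c : crossing D) (v w : {set crossing D}).
Implicit Types (x y : {set {set dart D}}) (l : seq (dart D)) (s t : S).
Arguments mon : simpl never.
Local Notation X := (@X D p S).
Local Notation E := (@E D p S).
Local Notation Y := (@Y D p S).
Local Notation mon := (@mon D p S).
Local Notation ket := (@ket D p S).
Local Notation proj := (@proj D p S).
Local Notation Der := (@Der D p S).

(* The cube is partitioned into the subcubes spanned by the crossings in      *)
(* [act T] at the one-circle vertices [vt T]; [tr] sends a vertex to the      *)
(* subcube containing it.                                                     *)
Variables (TT : finType) (tr : {set crossing D} -> TT).
Variables (vt act : TT -> {set crossing D}).
Implicit Types T : TT.
Hypothesis trP : forall v T,
  (tr v == T) = [forall c, ((c \in v) (+) (c \in vt T)) ==> (c \in act T)].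
Hypothesis act_differ : forall v c, c \in act (tr v) ->
  (c \in v) (+) (c \in vt (tr v)) -> differ v c.
Hypothesis vt_single : forall T d d', same (vt T) d d'.

Definition toggled v c := (c \in v) (+) (c \in vt (tr v)).

Lemma tr_eq v T :
  (forall c, (c \in v) (+) (c \in vt T) -> c \in act T) -> tr v = T.
Proof. by move=> h; apply/eqP; rewrite trP; apply/forallP => c; apply/implyP/h. Qed.

Lemma toggled_act v c : toggled v c -> c \in act (tr v).
Proof. by have := eqxx (tr v); rewrite trP => /forallP/(_ c)/implyP. Qed.

Lemma tr_vt T : tr (vt T) = T.
Proof. by apply: tr_eq => c; rewrite addbb. Qed.

Lemma tr_flip v c : c \in act (tr v) -> tr (flip v c) = tr v.
Proof.
move=> ca; apply: tr_eq => b; rewrite in_flip.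
have [->//|bc] := eqVneq b c; rewrite addbF; exact: toggled_act.
Qed.

Lemma act_flip v c : (c \in act (tr (flip v c))) = (c \in act (tr v)).
Proof.
apply/idP/idP => h; last by rewrite tr_flip.
by rewrite -[v](flipK v c) tr_flip.
Qed.

Lemma toggled_flip v b c : b \in act (tr v) ->
  toggled (flip v b) c = toggled v c (+) (c == b).
Proof. by move=> ba; rewrite /toggled tr_flip // in_flip addbAC. Qed.

Lemma untoggled_differ v c : c \in act (tr v) -> ~~ toggled v c ->
  differ (flip v c) c /\ ~~ differ v c.
Proof.
move=> ca nt; have dw : differ (flip v c) c.
  apply: act_differ; first by rewrite tr_flip.
  by have := toggled_flip c ca; rewrite /toggled eqxx addbT => ->.
by split=> //; have := differ_flip dw; rewrite flipK.
Qed.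

(** Toggling an active a at the one-circle vertex splits the circle; this selects the half without
    the basepoint. *)
Definition far T a d := ~~ same (flip (vt T) a) p d.

Lemma far_p T a : far T a p = false.
Proof. by rewrite /far same_refl. Qed.

Lemma act_flip_differ T a : a \in act T -> differ (flip (vt T) a) a.
Proof.
move=> aT; apply: act_differ; first by rewrite tr_flip tr_vt.
by rewrite tr_flip ?tr_vt // in_flip eqxx; case: (_ \in _).
Qed.

Lemma far_same T a d d' : same (flip (vt T) a) d d' -> far T a d = far T a d'.
Proof.
move=> dd; congr (~~ _); apply/idP/idP => h; apply: same_trans h _ => //.
by rewrite same_sym.
Qed.

(** After toggling a, the crossing b is still untoggled, so it would split a circle: both its
    strands lie on the same half. In other words, active crossings do not interlace. *)
Lemma far_other T a b i j : a \in act T -> b \in act T -> b != a ->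
  far T a (b, i) = far T a (b, j).
Proof.
move=> aT bT ba; apply: far_same; set w := flip (vt T) a.
have tw : tr w = T by rewrite /w tr_flip tr_vt.
have : ~~ differ w b.
  apply: (proj2 (untoggled_differ _ _)); first by rewrite tw.
  by rewrite /toggled tw in_flip (negPf ba) addbF addbb.
rewrite negbK => s.
have h k : same w (b, 0) (b, k).
  rewrite same_sym; case/orP: (same_strand w b k) => // h.
  by apply: same_trans h _; rewrite same_sym.
by apply: (same_trans _ (h j)); rewrite same_sym.
Qed.

Lemma far_self T a d d' : a \in act T -> ~~ same (flip (vt T) a) d d' ->
  far T a d != far T a d'.
Proof.
move=> aT; set w := flip (vt T) a => nd.
have dw := act_flip_differ aT; have wE : flip w a = vt T by exact: flipK.
have two e e' : ~~ same w e e' -> at_crossing w a e.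
  have := @same_merge _ w a e e' dw; rewrite wE vt_single.
  by move=> /esym; case: (same w e e') => //= /andP[].
have at2 e e' e'' : ~~ same w e e' -> same w e e'' || same w e' e''.
  move=> ne; have he := two _ _ ne.
  have he' : at_crossing w a e' by apply: (two e' e); rewrite same_sym.
  have [|n1] := boolP (same w e e'') => //=.
  have he'' : at_crossing w a e'' by apply: (two e'' e); rewrite same_sym.
  rewrite /at_crossing in he he' he''.
  have tr3 (x y z : dart D) : same w x y -> same w x z -> same w y z.
    by move=> xy; apply: same_trans; rewrite same_sym.
  by case/orP: he => h; case/orP: he' => h'; case/orP: he'' => h'';
    first [exact: tr3 h' h'' | by case/negP: n1; exact: tr3 h h''
          | by case/negP: ne; exact: tr3 h h'].
rewrite /far; have := at2 _ _ p nd.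
rewrite ![same w _ p]same_sym -/w.
case sd: (same w p d); case sd': (same w p d') => //= _.
by case/negP: nd; apply: same_trans sd'; rewrite same_sym.
Qed.

Lemma far_strands T a : a \in act T -> far T a (a, 0) (+) far T a (a, 2).
Proof.
by move=> aT; have := far_self aT (act_flip_differ aT); do 2!case: (far _ _ _).
Qed.

Definition far_label c v d := toggled v c && far (tr v) c d.

(** The vertices v and [flip (vt (tr v)) c] differ only at toggled crossings other than c, each of
    which has all its ends in one half, so no circle of v passes from one half to the other. *)
Lemma far_label_circle c : circle_labeling p (far_label c).
Proof.
split=> [v d d'|v]; last by rewrite /far_label far_p andbF.
rewrite /far_label; have [tc|//] := boolP (toggled v c) => /=.
have ca := toggled_act tc.
apply: (connect_ind (P := fun e => far (tr v) c d = far (tr v) c e)) => //.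
move=> e f -> /orP[]/eqP->; first exact/far_same/same_arc.
have [te|nte] := boolP (toggled v e.1 && (e.1 != c)).
  have /andP[te' ec] := te; case: e te te' ec => b i /= _ te' ec.
  exact: far_other ca (toggled_act te') ec.
have -> : smoothing v e = smoothing (flip (vt (tr v)) c) e; last first.
  exact/far_same/same_smoothing.
rewrite /smoothing; suff -> : (e.1 \in v) = (e.1 \in flip (vt (tr v)) c) by [].
move: nte; rewrite in_flip /toggled; have [->|ec] := eqVneq e.1 c.
  by move: tc; rewrite /toggled; do 2!case: (_ \in _).
by rewrite andbT addbF; do 2!case: (_ \in _).
Qed.

(* Locked, so that rewriting with [endo_mulE] does not unfold them. *)
Definition e c : endo S := locked (E c * proj (fun v => c \in act (tr v))).
Definition far_der c : endo S := locked (Der (far_label c)).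
Definition K c : endo S := locked (e c * far_der c + far_der c * e c).

Lemma eE c : e c = E c * proj (fun v => c \in act (tr v)).
Proof. by rewrite /e -lock. Qed.

Lemma far_derE c : far_der c = Der (far_label c).
Proof. by rewrite /far_der -lock. Qed.

Lemma K_def c : K c = e c * far_der c + far_der c * e c.
Proof. by rewrite /K -lock. Qed.

(** [e c] and [K c] toggle c in either direction; the projections keep the direction of the
    differential in [dn] and the opposite one in [hn]. *)
Definition dn c : endo S := e c * proj (fun v => c \notin v).
Definition hn c : endo S := K c * proj (fun v => c \in v).

Lemma e_mon c v l : c \in act (tr v) -> e c (mon v l) =
  if toggled v c then mon (flip v c) l else Y c (mon (flip v c) l).
Proof.
move=> ca; rewrite eE endo_mulE proj_mon ca E_mon /Yfac.
have [tc|nt] := boolP (toggled v c).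
  by rewrite act_differ // endo_1E.
by have [-> /negPf->] := untoggled_differ ca nt.
Qed.

Lemma e_mon0 c v l : c \notin act (tr v) -> e c (mon v l) = 0.
Proof. by move=> /negPf ca; rewrite eE endo_mulE proj_mon ca linear0. Qed.

Lemma proj_e Q c : proj Q * e c = e c * proj (fun v => Q (flip v c)).
Proof.
rewrite eE mulrA proj_E -!mulrA !projM; congr (_ * _); apply: eq_proj => v.
exact: andbC.
Qed.

Lemma proj_da Q c : GRing.comm (proj Q) (far_der c).
Proof. rewrite far_derE; exact/proj_Der/far_label_circle. Qed.

Lemma ee_comm b c : GRing.comm (e b) (e c).
Proof.
have [->|bc] := eqVneq b c; first exact: commr_refl.
rewrite /GRing.comm !eE -!mulrA ![proj _ * (E _ * _)]mulrA !proj_E -!mulrA.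
rewrite !projM !mulrA EE_comm; congr (_ * _); apply: eq_proj => v.
by apply/andP/andP => -[h ca]; move: h; rewrite tr_flip // => h;
  rewrite tr_flip.
Qed.

Lemma ada_comm b c : GRing.comm (far_der b) (far_der c).
Proof. by rewrite !far_derE; apply: Der_Der; exact: far_label_circle. Qed.

Lemma eda_comm b c : b != c -> GRing.comm (e b) (far_der c).
Proof.
move=> bc; rewrite /GRing.comm eE -mulrA proj_da far_derE.
apply: endo_ext => v l; rewrite !endo_mulE proj_mon.
case: ifP => ba; last by rewrite !linear0.
have cb : (c == b) = false by rewrite eq_sym; exact: negbTE.
apply: E_Der; first exact: far_label_circle.
  by move=> d; rewrite /far_label toggled_flip // tr_flip // cb addbF.
rewrite /far_label; have [tc|//] := boolP (toggled v c) => /=.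
by apply: far_other => //; exact: toggled_act.
Qed.

Lemma K_comm b c : b != c -> GRing.comm (K b) (K c).
Proof.
move=> bc; have cb : c != b by rewrite eq_sym.
have h1 : GRing.comm (K b) (e c).
  rewrite K_def; apply/commr_sym/commrD; apply: commrM; first exact: ee_comm.
  - exact: eda_comm.
  - exact: eda_comm.
  - exact: ee_comm.
have h2 : GRing.comm (K b) (far_der c).
  rewrite K_def; apply/commr_sym/commrD; apply: commrM; try exact: ada_comm.
  - by apply/commr_sym/eda_comm.
  - by apply/commr_sym/eda_comm.
by rewrite (K_def c); apply: commrD; apply: commrM.
Qed.

Lemma eK_comm b c : b != c -> GRing.comm (e b) (K c).
Proof.
move=> bc; rewrite K_def; apply: commrD; apply: commrM;
  try exact: ee_comm; exact: eda_comm.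
Qed.

Lemma proj_K Q c : proj Q * K c = K c * proj (fun v => Q (flip v c)).
Proof.
rewrite K_def mulrDr mulrDl; congr (_ + _).
  by rewrite mulrA proj_e -mulrA proj_da mulrA.
by rewrite mulrA proj_da -mulrA proj_e mulrA.
Qed.

Lemma projK_comm (Q : pred {set crossing D}) c :
  (forall v, Q (flip v c) = Q v) -> GRing.comm (proj Q) (K c).
Proof. by move=> h; rewrite /GRing.comm proj_K (eq_proj S (h : _ =1 _)). Qed.

Lemma proje_comm (Q : pred {set crossing D}) c :
  (forall v, Q (flip v c) = Q v) -> GRing.comm (proj Q) (e c).
Proof. by move=> h; rewrite /GRing.comm proj_e (eq_proj S (h : _ =1 _)). Qed.

Lemma mem_flip_neq b c v : b != c -> (b \in flip v c) = (b \in v).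
Proof. by move=> bc; rewrite in_flip (negPf bc) addbF. Qed.

Lemma projC_comm Q Q' : GRing.comm (proj Q) (proj Q').
Proof. by rewrite /GRing.comm !projM; apply: eq_proj => v; exact: andbC. Qed.

Lemma dn_comm b c : b != c -> GRing.comm (dn b) (dn c).
Proof.
move=> bc; have cb : c != b by rewrite eq_sym.
apply: commrM; apply: commr_sym; apply: commrM.
- exact: ee_comm.
- by apply/commr_sym/proje_comm => v; rewrite mem_flip_neq.
- by apply: proje_comm => v; rewrite mem_flip_neq.
- exact: projC_comm.
Qed.

Lemma dnhn_comm b c : b != c -> GRing.comm (dn b) (hn c).
Proof.
move=> bc; have cb : c != b by rewrite eq_sym.
apply: commrM; apply: commr_sym; apply: commrM.
- by apply/commr_sym/eK_comm.
- by apply/commr_sym/projK_comm => v; rewrite mem_flip_neq.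
- by apply: proje_comm => v; rewrite mem_flip_neq.
- exact: projC_comm.
Qed.

Lemma hn_comm b c : b != c -> GRing.comm (hn b) (hn c).
Proof.
move=> bc; have cb : c != b by rewrite eq_sym.
apply: commrM; apply: commr_sym; apply: commrM.
- by apply: K_comm.
- by apply/commr_sym/projK_comm => v; rewrite mem_flip_neq.
- by apply: projK_comm => v; rewrite mem_flip_neq.
- exact: projC_comm.
Qed.

Lemma projX_comm Q d : GRing.comm (proj Q) (X d).
Proof.
apply: endo_ext => v l; rewrite !endo_mulE -mon_cons !proj_mon.
by rewrite !(fun_if (X d)) linear0.
Qed.

Lemma eY_comm b c : GRing.comm (e b) (Y c).
Proof.
have h d : GRing.comm (e b) (X d).
  rewrite eE; apply/commr_sym/commrM; apply/commr_sym; first exact: EX_comm.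
  exact: projX_comm.
exact: commrD.
Qed.

Lemma eYE b c u : e b (Y c u) = Y c (e b u).
Proof. by rewrite -!endo_mulE eY_comm. Qed.

Lemma e_untoggled0 c : far_der c * proj (fun v => ~~ toggled v c) = 0.
Proof.
apply: endo_ext => v l; rewrite endo_mulE proj_mon endo_0E.
case: ifP => nt; last by rewrite linear0.
rewrite far_derE; apply: Der_zero; first exact: far_label_circle.
by move=> d; rewrite /far_label (negPf nt).
Qed.

Lemma far_der_untoggled c v l : ~~ toggled v c -> far_der c (mon v l) = 0.
Proof.
move=> nt; have := congr1 (fun f : endo S => f (mon v l)) (e_untoggled0 c).
by rewrite /= endo_mulE proj_mon nt endo_0E.
Qed.

Lemma far_der_Y_self c v l : toggled v c ->
  far_der c (Y c (mon v l)) = Y c (far_der c (mon v l)) + mon v l.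
Proof.
move=> tc; rewrite far_derE Der_Y; last exact: far_label_circle.
by rewrite /far_label tc /= far_strands // toggled_act.
Qed.

Lemma far_der_Y_other c b v l : b \in act (tr v) -> b != c ->
  far_der c (Y b (mon v l)) = Y b (far_der c (mon v l)).
Proof.
move=> ba bc; rewrite far_derE Der_Y; last exact: far_label_circle.
rewrite /far_label; have [tc|_] := boolP (toggled v c); last by rewrite addr0.
have /= -> := far_other 0 2 (toggled_act tc) ba bc.
by rewrite addbb addr0.
Qed.

Lemma KE c u : K c u = e c (far_der c u) + far_der c (e c u).
Proof. by rewrite K_def endo_addE !endo_mulE. Qed.

Lemma e_inactive c : e c * proj (fun v => c \notin act (tr v)) = 0.
Proof.
by rewrite eE -mulrA projM (proj0 S) ?mulr0 // => v; rewrite andbN.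
Qed.

Lemma Y_e_toggled c : Y c * e c * proj (fun v => toggled v c) = 0.
Proof.
apply: endo_ext => v l; rewrite !endo_mulE proj_mon endo_0E.
case: ifP => tc; last by rewrite !linear0.
have ca := toggled_act tc; rewrite e_mon // tc Y_zero //.
by apply: differ_flip; exact: act_differ.
Qed.

Lemma e_e_toggled c :
  e c * e c * proj (fun v => toggled v c) = Y c * proj (fun v => toggled v c).
Proof.
apply: endo_ext => v l; rewrite !endo_mulE proj_mon.
case: ifP => tc; last by rewrite !linear0.
have ca := toggled_act tc; rewrite e_mon // tc e_mon ?act_flip // flipK.
by rewrite toggled_flip // tc eqxx.
Qed.

Lemma proj_da_mon (Q : pred {set crossing D}) c v l : Q v -> proj Q (far_der c (mon v l)) = far_der c (mon v l).
Proof. by move=> Qv; rewrite -endo_mulE proj_da endo_mulE proj_mon Qv. Qed.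

(** Leibniz gives [Y c] times the derivative plus the vector itself. Merging puts both strands of c
    on one circle, where [Y c] is 0, so only the second term survives. *)
Lemma e_da_Y c v l : c \in act (tr v) -> ~~ toggled v c ->
  e c (far_der c (Y c (mon (flip v c) l))) = mon v l.
Proof.
move=> ca nt; have ca' : c \in act (tr (flip v c)) by rewrite tr_flip.
have tw : toggled (flip v c) c by rewrite toggled_flip // (negPf nt) eqxx.
rewrite far_der_Y_self // linearD /= eYE e_mon // tw flipK.
have := congr1 (fun f : endo S => f (far_der c (mon (flip v c) l))) (Y_e_toggled c).
by rewrite !endo_mulE proj_da_mon // endo_0E => ->; rewrite add0r.
Qed.

Lemma K_e c v l : c \in act (tr v) -> ~~ toggled v c ->
  K c (e c (mon v l)) = mon v l.
Proof.
move=> ca nt; have ca' : c \in act (tr (flip v c)) by rewrite tr_flip.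
have tw : toggled (flip v c) c by rewrite toggled_flip // (negPf nt) eqxx.
rewrite e_mon // (negPf nt) KE e_da_Y // eYE e_mon // tw flipK.
rewrite Y_zero ?linear0 ?addr0 //.
by have [] := untoggled_differ ca nt.
Qed.

Lemma e_K c v l : c \in act (tr v) -> ~~ toggled v c ->
  e c (K c (mon v l)) = mon v l.
Proof.
move=> ca nt; rewrite KE far_der_untoggled // linear0 add0r e_mon // (negPf nt).
exact: e_da_Y.
Qed.

Lemma K_e_proj c (Q := fun v => (c \in act (tr v)) && ~~ toggled v c) :
  K c * e c * proj Q = proj Q.
Proof.
apply: endo_ext => v l; rewrite !endo_mulE proj_mon.
by case: ifP => [/andP[ca nt]|_]; rewrite ?linear0 // K_e.
Qed.

Lemma eKe c : e c * K c * e c = e c.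
Proof.
apply: endo_ext => v l; rewrite !endo_mulE.
have [ca|nca] := boolP (c \in act (tr v)); last by rewrite e_mon0 ?linear0.
have [tc|nt] := boolP (toggled v c); last by rewrite K_e.
rewrite e_mon // tc e_K ?act_flip //.
by rewrite toggled_flip // tc eqxx.
Qed.

Lemma K_mon0 c v l : c \notin act (tr v) -> K c (mon v l) = 0.
Proof.
move=> nca; rewrite KE e_mon0 // linear0 addr0.
rewrite -(proj_da_mon (Q := fun v => c \notin act (tr v))) //.
by rewrite -endo_mulE e_inactive endo_0E.
Qed.

Lemma KeK c : K c * e c * K c = K c.
Proof.
apply: endo_ext => v l; rewrite !endo_mulE.
have [ca|nca] := boolP (c \in act (tr v)); last by rewrite K_mon0 ?linear0.
have [tc|nt] := boolP (toggled v c); last by rewrite e_K.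
have := K_e_proj c; set Q := (fun v => _) => KQ.
have y : proj Q (K c (mon v l)) = K c (mon v l).
  rewrite -endo_mulE proj_K endo_mulE proj_mon /Q act_flip ca.
  by rewrite toggled_flip // tc eqxx.
by rewrite -{1}y -!endo_mulE [LHS](_ : _ = (K c * e c * proj Q) (K c (mon v l)));
  rewrite ?KQ ?y // !endo_mulE.
Qed.

Lemma proj_flip_mem (f : endo S) c :
  (forall Q, proj Q * f = f * proj (fun v => Q (flip v c))) ->
  proj (fun v => c \in v) * f = f * proj (fun v => c \notin v) /\
  proj (fun v => c \notin v) * f = f * proj (fun v => c \in v).
Proof.
move=> h; split; rewrite h; congr (_ * _); apply: eq_proj => v;
  by rewrite in_flip eqxx addbT ?negbK.
Qed.

(* In the subcubes, [K c] is the anticommutator of the edge map at c with     *)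
(* the derivation supported on the circles which c, when toggled from [vt T], *)
(* separates from the basepoint; it inverts the edge map up to projections.   *)
Lemma sdr_local c : sdr (dn c) (hn c) (1 + dn c * hn c + hn c * dn c).
Proof.
have [Me Ne] := proj_flip_mem (fun Q => proj_e Q c).
have [MK NK] := proj_flip_mem (fun Q => proj_K Q c).
set M := proj (fun v => c \in v) in Me Ne MK NK *.
set N := proj (fun v => c \notin v) in Me Ne MK NK *.
have MN : M * N = 0 by rewrite projM (proj0 S) // => v; exact: andbN.
have NM : N * M = 0 by rewrite projM (proj0 S) // => v; exact: andNb.
have NN : N * N = N by rewrite projM; apply: eq_proj => v; exact: andbb.
have MM : M * M = M by rewrite projM; apply: eq_proj => v; exact: andbb.
apply: (sdr_intro (@endo_char2 S)); rewrite /dn /hn -/M -/N.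
- by rewrite -mulrA [N * _]mulrA Ne -[e c * M * N]mulrA MN !mulr0.
- by rewrite -mulrA [M * _]mulrA MK -[K c * N * M]mulrA NM !mulr0.
- rewrite -!mulrA [M * _]mulrA Me -[e c * N * N]mulrA NN.
  rewrite [N * _]mulrA NK -[K c * M * _]mulrA [M * (e c * _)]mulrA Me.
  by rewrite -[e c * N * N]mulrA NN !mulrA eKe.
- rewrite -!mulrA [N * _]mulrA NK -[K c * M * M]mulrA MM.
  rewrite [M * _]mulrA Me -[e c * N * _]mulrA [N * (K c * _)]mulrA NK.
  by rewrite -[K c * M * M]mulrA MM !mulrA KeK.
Qed.

Definition pr c := proj1 dn hn c.

Lemma pr_inactive c v l : c \notin act (tr v) -> pr c (mon v l) = mon v l.
Proof.
move=> nca; rewrite /pr /proj1 !endo_addE endo_1E !endo_mulE !proj_mon.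
rewrite !(fun_if (K c)) !(fun_if (e c)) K_mon0 ?e_mon0 // !linear0 !if_same.
by rewrite !linear0 !addr0.
Qed.

Lemma pr_untoggled c v l : c \in act (tr v) -> ~~ toggled v c ->
  pr c (mon v l) = 0.
Proof.
move=> ca nt; rewrite /pr /proj1.
have [Me Ne] := proj_flip_mem (fun Q => proj_e Q c).
have [MK NK] := proj_flip_mem (fun Q => proj_K Q c).
rewrite !endo_addE endo_1E /dn /hn -[_ * _ * (_ * _)]mulrA.
rewrite [proj _ * (_ * _)]mulrA NK -[X in _ + X + _]/(_ (mon v l)).
rewrite -[K c * _ * (_ * _)]mulrA [proj (fun v => c \in v) * (e c * _)]mulrA Me.
rewrite !endo_mulE !proj_mon.
case: (boolP (c \in v)) => cv; rewrite /= ?proj_mon ?cv ?linear0 /=.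
  by rewrite e_K // addr0 fspace_char2.
by rewrite ?proj_mon ?cv K_e // addr0 fspace_char2.
Qed.

Lemma hn_mon c v l : hn c (mon v l) = if c \in v then K c (mon v l) else 0.
Proof. by rewrite /hn endo_mulE proj_mon (fun_if (K c)) linear0. Qed.

Lemma dn_mon c v l : dn c (mon v l) = if c \in v then 0 else e c (mon v l).
Proof. by rewrite /dn endo_mulE proj_mon -if_neg !(fun_if (e c)) linear0 negbK. Qed.

Lemma prE c u : pr c u = u + dn c (hn c u) + hn c (dn c u).
Proof. by rewrite /pr /proj1 !endo_addE endo_1E !endo_mulE. Qed.

Lemma dn_K c v l : c \in v -> dn c (K c (mon v l)) = e c (K c (mon v l)).
Proof.
have [_ NK] := proj_flip_mem (fun Q => proj_K Q c).
move=> cv; rewrite /dn endo_mulE -[proj _ (K c _)]endo_mulE NK endo_mulE.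
by rewrite proj_mon cv.
Qed.

(** Here the differential at c arrives by splitting, with the multiples of [Y c] as image; the
    projection kills them and represents the cokernel. *)
Lemma pr_split c v l : toggled v c -> c \in v ->
  pr c (mon v l) = mon v l + Y c (far_der c (mon v l)).
Proof.
move=> tc cv; have ca := toggled_act tc.
rewrite prE hn_mon dn_mon cv linear0 addr0 dn_K //; congr (_ + _).
rewrite KE linearD /= e_mon // tc [far_der c (mon (flip v c) l)]far_der_untoggled;
  last by rewrite toggled_flip ?tc ?eqxx.
rewrite linear0 addr0 -(proj_da_mon (Q := fun v => toggled v c)) //.
have := congr1 (fun f : endo S => f (far_der c (mon v l))) (e_e_toggled c).
by rewrite /= !endo_mulE.
Qed.

(** Here the differential at c leaves by merging; the projection is onto its kernel, the multiples
    of [Y c]. *)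
Lemma pr_merge c v l : toggled v c -> c \notin v ->
  pr c (mon v l) = Y c (far_der c (mon v l)).
Proof.
move=> tc cv; have ca := toggled_act tc.
rewrite prE hn_mon dn_mon (negPf cv) linear0 addr0 e_mon // tc hn_mon.
rewrite in_flip (negPf cv) eqxx /= KE.
rewrite [far_der c (mon (flip v c) l)]far_der_untoggled ?toggled_flip ?tc ?eqxx //.
rewrite linear0 add0r.
rewrite e_mon ?act_flip // toggled_flip // tc eqxx flipK far_der_Y_self //=.
by rewrite addrCA fspace_char2 addr0.
Qed.

Implicit Types C : seq (crossing D).

Definition Yprod (C : seq (crossing D)) (u : fspace S) : fspace S :=
  foldr (fun c u => Y c u) u C.

Lemma YYc c c' u : Y c (Y c' u) = Y c' (Y c u).
Proof. by rewrite -!endo_mulE YY_comm. Qed.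

Lemma Yprod_Y c C u : Yprod C (Y c u) = Y c (Yprod C u).
Proof. by elim: C => //= b C ->; rewrite YYc. Qed.

Lemma Yprod_D C u u' : Yprod C (u + u') = Yprod C u + Yprod C u'.
Proof. by elim: C => //= b C ->; rewrite linearD. Qed.

Lemma Yprod_0 C : Yprod C 0 = 0.
Proof. by elim: C => //= b C ->; rewrite linear0. Qed.

Lemma Yprod_agree (F G : endo S) v : (forall l, F (mon v l) = G (mon v l)) ->
  forall C l, F (Yprod C (mon v l)) = G (Yprod C (mon v l)).
Proof.
move=> FG; elim=> [|b C IH] l //=.
by rewrite -Yprod_Y Y_mon Yprod_D !linearD /= !IH.
Qed.

Lemma Yprod_zero v C l c : c \in C -> Y c (Yprod C (mon v l)) = 0.
Proof.
have YYz m : Y c (Y c (mon v m)) = 0.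
  rewrite !Y_mon linearD /= !Y_mon.
  have -> : mon v [:: (c, 0), (c, 0) & m] = 0 by apply/mon_dup/same_refl.
  have -> : mon v [:: (c, 2), (c, 2) & m] = 0 by apply/mon_dup/same_refl.
  by rewrite add0r addr0 !mon_cons X_comm fspace_char2.
elim: C => //= b C IH; rewrite in_cons => /predU1P[<-|/IH h]; last first.
  by rewrite YYc h linear0.
rewrite -Yprod_Y -Yprod_Y; have := @Yprod_agree (Y c * Y c) 0 v _ C l.
rewrite !Yprod_Y endo_mulE endo_0E; apply=> m.
by rewrite endo_mulE endo_0E YYz.
Qed.

Lemma Yprod_perm C C' u : perm_eq C C' -> Yprod C u = Yprod C' u.
Proof.
elim: C C' => [|c C IH] C'; first by rewrite perm_sym => /perm_nilP->.
move=> CC; have cC : c \in C' by rewrite -(perm_mem CC) mem_head.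
have CE : perm_eq C (rem c C').
  by rewrite -(perm_cons c) (perm_trans CC) // perm_to_rem.
rewrite /= (IH _ CE) {IH CC CE C}; elim: C' cC => //= b C' IH.
rewrite in_cons; have [->//|bc /=] := eqVneq c b.
by move=> /IH <-; rewrite YYc.
Qed.

Lemma far_der_YY c v C l : {subset C <= act (tr v)} -> c \notin C ->
  far_der c (Yprod C (mon v l)) = Yprod C (far_der c (mon v l)).
Proof.
elim: C => //= b C IH sub; rewrite in_cons negb_or => /andP[cb cC].
rewrite -IH //; last by move=> x xC; apply: sub; rewrite in_cons xC orbT.
have := @Yprod_agree (far_der c * Y b) (Y b * far_der c) v _ C l.
rewrite !endo_mulE; apply=> m; rewrite !endo_mulE far_der_Y_other //.
  by apply: sub; rewrite mem_head.
by rewrite eq_sym.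
Qed.

Lemma far_der_nil c v : far_der c (mon v [::]) = 0.
Proof. rewrite far_derE; apply: Der_nil; exact: far_label_circle. Qed.

Definition vmax T : {set crossing D} := [set c | (c \in vt T) (+) (c \in act T)].

Lemma tr_vmax T : tr (vmax T) = T.
Proof. by apply: tr_eq => c; rewrite inE addbC addKb. Qed.

Lemma toggled_vmax T c : toggled (vmax T) c = (c \in act T).
Proof. by rewrite /toggled tr_vmax inE addbC addKb. Qed.

(** The active crossings whose differential ends at [vt T] by merging circles. Each puts its factor
    [Y], the generator of a kernel, into [crit]; a splitting crossing contributes 1, which
    represents a cokernel. *)
Definition mergers T := enum (act T :&: vt T).
Definition crit T : fspace S := Yprod (mergers T) (mon (vmax T) [::]).

Definition Pi : endo S := \prod_(c <- enum (crossing D)) pr c.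
Definition Hn : endo S := homotopy dn hn (enum (crossing D)).
Definition Dn : endo S := \sum_(c <- enum (crossing D)) dn c.

Lemma sdr_block : sdr Dn Hn Pi.
Proof.
apply: sdr_family; rewrite ?enum_uniq //.
- exact: endo_char2.
- exact: sdr_local.
- exact: dn_comm.
- exact: dnhn_comm.
- exact: hn_comm.
Qed.

Lemma Pi_pr c u : Pi (pr c u) = Pi u.
Proof.
rewrite -endo_mulE; congr (fun_of_lfun _ u).
have cE : c \in enum (crossing D) by rewrite mem_enum.
exact: (proj_proj1 sdr_local dn_comm dnhn_comm hn_comm
  cE (enum_uniq _)).
Qed.

Lemma Pi_fix u : (forall c, pr c u = u) -> Pi u = u.
Proof.
move=> h; rewrite /Pi; elim: (enum _) => [|c s IH].
  by rewrite big_nil endo_1E.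
by rewrite big_cons endo_mulE IH.
Qed.

Lemma mergers_act T : {subset mergers T <= act (tr (vmax T))}.
Proof. by move=> c; rewrite mem_enum inE tr_vmax => /andP[]. Qed.

Lemma mem_vmax T c : c \in act T -> (c \in vmax T) = (c \notin vt T).
Proof. by move=> ca; rewrite inE ca addbT. Qed.

Lemma pr_vmax_split T C l c : c \in act T -> c \notin vt T ->
  pr c (Yprod C (mon (vmax T) l)) =
  Yprod C (mon (vmax T) l) + Y c (far_der c (Yprod C (mon (vmax T) l))).
Proof.
move=> ca cv.
rewrite (@Yprod_agree (pr c) (1 + Y c * far_der c)) => [|m].
  by rewrite endo_addE endo_1E endo_mulE.
rewrite [RHS]endo_addE endo_1E endo_mulE pr_split // ?toggled_vmax //.
by rewrite mem_vmax.
Qed.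

Lemma pr_vmax_merge T C l c : c \in act T -> c \in vt T ->
  pr c (Yprod C (mon (vmax T) l)) = Y c (far_der c (Yprod C (mon (vmax T) l))).
Proof.
move=> ca cv.
rewrite (@Yprod_agree (pr c) (Y c * far_der c)) => [|m]; first by rewrite endo_mulE.
by rewrite [RHS]endo_mulE pr_merge // ?toggled_vmax // mem_vmax // cv.
Qed.

Lemma far_der_Y_vmax T C l c : c \in act T ->
  far_der c (Y c (Yprod C (mon (vmax T) l))) =
  Y c (far_der c (Yprod C (mon (vmax T) l))) + Yprod C (mon (vmax T) l).
Proof.
move=> ca; rewrite -endo_mulE (@Yprod_agree _ (Y c * far_der c + 1)) => [|m].
  by rewrite endo_addE endo_1E endo_mulE.
by rewrite endo_addE endo_1E !endo_mulE far_der_Y_self // toggled_vmax.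
Qed.

Lemma pr_crit T c : pr c (crit T) = crit T.
Proof.
have [ca|nca] := boolP (c \in act T); last first.
  rewrite /crit (@Yprod_agree _ 1) ?endo_1E // => l.
  by rewrite endo_1E pr_inactive // tr_vmax.
have da0 C : {subset C <= act T} -> c \notin C -> far_der c (Yprod C (mon (vmax T) [::])) = 0.
  by move=> sub cC; rewrite far_der_YY ?tr_vmax // far_der_nil Yprod_0.
have [cv|ncv] := boolP (c \in vt T); last first.
  rewrite /crit pr_vmax_split // da0 ?linear0 ?addr0 //.
    by move=> b; rewrite -{2}[T]tr_vmax; exact: mergers_act.
  by rewrite mem_enum inE (negPf ncv) andbF.
rewrite /crit pr_vmax_merge //.
have cm : c \in mergers T by rewrite mem_enum inE ca cv.
rewrite (Yprod_perm _ (perm_to_rem cm)) /= far_der_Y_vmax // linearD /=.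
rewrite da0 ?linear0 ?add0r //.
  move=> b /mem_rem; rewrite -{2}[T]tr_vmax; exact: mergers_act.
by rewrite mem_rem_uniqF // enum_uniq.
Qed.

Lemma Pi_crit T : Pi (crit T) = crit T.
Proof. by apply: Pi_fix => c; exact: pr_crit. Qed.

(** [Pi] gives 0 if a factor is repeated, belongs to a splitting crossing or is missing for a
    merging one; otherwise C is [mergers T] up to order. *)
Lemma Pi_YY T C : {subset C <= act T} ->
  let u := Yprod C (mon (vmax T) [::]) in Pi u = 0 \/ Pi u = crit T.
Proof.
move=> sub u.
have [uC|nuC] := boolP (uniq C); last first.
  left; suff -> : u = 0 by rewrite linear0.
  rewrite /u; elim: C nuC {sub u} => //= c C IH.
  rewrite negb_and negbK => /orP[/Yprod_zero->//|/IH->]; exact: linear0.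
have [/hasP[c cC ncv]|nhas] := boolP (has (fun c => c \notin vt T) C).
  left; rewrite -(Pi_pr c) /u pr_vmax_split ?sub //.
  have := far_der_Y_vmax C [::] (sub c cC); rewrite Yprod_zero // linear0.
  by rewrite addrC => <-; rewrite linear0.
have CM : {subset C <= mergers T}.
  move=> c cC; rewrite mem_enum inE sub //=.
  by apply: contraNT nhas => ncv; apply/hasP; exists c.
have [/allP MC|] := boolP (all (mem C) (mergers T)).
  right; rewrite -[RHS]Pi_crit; congr (Pi _); apply: Yprod_perm.
  apply: uniq_perm => //; first exact: enum_uniq.
  by move=> c; apply/idP/idP => [/CM|/MC].
case/allPn => c; rewrite mem_enum inE => /andP[ca cv] /= cC.
left; rewrite -(Pi_pr c) /u pr_vmax_merge //.
by rewrite far_der_YY ?tr_vmax // far_der_nil Yprod_0 !linear0.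
Qed.

Lemma mon_base v l : mon v (p :: l) = 0.
Proof. by rewrite monE /= inE eqxx. Qed.

Lemma strand_sep w v b (f : dart D) : f.1 = b -> (b \in w) != (b \in v) ->
  same w f (b, 0) && same w (smoothing v f) (b, 2) ||
  same w f (b, 2) && same w (smoothing v f) (b, 0).
Proof.
case: f => _ i /= -> wv.
have s0 := same_smoothing w (b, 0); have s2 := same_smoothing w (b, 2).
rewrite ![same w _ (b, 0)]same_sym ![same w _ (b, 2)]same_sym.
move: wv s0 s2; rewrite /smoothing /=.
have h10 : (1 - 0 : 'I_4) = 1 by exact: val_inj.
have h12 : (1 - 2 : 'I_4) = 3 by exact: val_inj.
have h13 : (1 - 3 : 'I_4) = 2 by exact: val_inj.
have h11 : (1 - 1 : 'I_4) = 0 by exact: val_inj.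
have g0 : (- 1 - 0 : 'I_4) = 3 by exact: val_inj.
have g1 : (- 1 - 1 : 'I_4) = 2 by exact: val_inj.
have g2 : (- 1 - 2 : 'I_4) = 1 by exact: val_inj.
have g3 : (- 1 - 3 : 'I_4) = 0 by exact: val_inj.
case: (b \in w); case: (b \in v) => // _; rewrite ?h10 ?h12 ?g0 ?g2 => s0 s2;
  move: i; apply: I4_cases; rewrite ?h10 ?h11 ?h12 ?h13 ?g0 ?g1 ?g2 ?g3;
  by rewrite ?same_refl ?s0 ?s2 ?orbT.
Qed.

(** Telescoping along the single circle of [vt T] from p, where X is 0: passing a strand of an
    active b changes the left side by [Y b] and switches [far T b], and nothing changes elsewhere.
    Hence monomials at [vmax T] reduce to products of the [Y a]. *)
Lemma X_vmax T d l : X d (mon (vmax T) l) =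
  \sum_(a in act T | far T a d) Y a (mon (vmax T) l).
Proof.
set v := vmax T.
pose g d' := X d' (mon v l) + \sum_(a in act T | far T a d') Y a (mon v l).
suff g0 : g d = 0.
  by apply: (addrI (\sum_(a in act T | far T a d) Y a (mon v l)));
     rewrite fspace_char2 addrC.
have -> : 0 = g p.
  rewrite /g -mon_cons mon_base add0r big1 // => a /andP[_].
  by rewrite far_p.
apply: (connect_ind (P := fun f => g d = g f) _ _ (vt_single T d p)) => //.
move=> f f' -> /orP[]/eqP->.
  rewrite /g -!mon_cons (mon_same S l (same_arc v f)); congr (_ + _).
  apply: eq_bigl => a; congr (_ && _); exact/far_same/same_arc.
set f1 := smoothing (vt T) f; pose b := f.1.
have farE a : a != b -> a \in act T -> far T a f = far T a f1.
  move=> ab aT; rewrite /f1.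
  have -> : smoothing (vt T) f = smoothing (flip (vt T) a) f.
    by rewrite smoothing_flip // eq_sym.
  exact/far_same/same_smoothing.
have [bT|nbT] := boolP (b \in act T); last first.
  rewrite /g -!mon_cons.
  have -> : mon v (f :: l) = mon v (f1 :: l).
    apply: mon_same; rewrite /f1.
    have -> : smoothing (vt T) f = smoothing v f.
      by rewrite /smoothing /v inE -/b (negPf nbT) addbF.
    exact: same_smoothing.
  congr (_ + _); apply: eq_bigl => a; apply: andb_id2l => aT; apply: farE => //.
  by apply: contraNneq nbT => <-.
have sep w : (b \in w) != (b \in vt T) -> _ := @strand_sep w (vt T) b f erefl.
have Xs : X f (mon v l) + X f1 (mon v l) = Y b (mon v l).
  rewrite Y_mon -!mon_cons.
  have /sep : (b \in v) != (b \in vt T) by rewrite /v inE bT; case: (_ \in _).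
  by case/orP=> /andP[/(mon_same S l)-> /(mon_same S l)->] //; rewrite addrC.
have fb : far T b f1 = ~~ far T b f.
  have /sep : (b \in flip (vt T) b) != (b \in vt T).
    by rewrite in_flip eqxx; case: (_ \in _).
  have := far_strands bT.
  by move=> + /orP[]/andP[/far_same-> /far_same->]; do 2!case: (far _ _ _).
have split h : \sum_(a in act T | far T a h) Y a (mon v l) =
    (if far T b h then Y b (mon v l) else 0) +
    \sum_(a in act T | far T a h && (a != b)) Y a (mon v l).
  rewrite (bigID (pred1 b)) /=; congr (_ + _); last first.
    by apply: eq_bigl => a; rewrite andbA.
  case: ifP => fh.
    rewrite (bigD1 b) /= ?bT ?fh ?eqxx // big1 ?addr0 // => a.
    by case/andP=> /andP[_ /eqP->]; rewrite eqxx.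
  by rewrite big1 // => a /andP[/andP[_ fa] /eqP ab]; rewrite -ab fa in fh.
rewrite /g !split fb.
have -> : \sum_(a in act T | far T a f1 && (a != b)) Y a (mon v l) =
          \sum_(a in act T | far T a f && (a != b)) Y a (mon v l).
  apply: eq_bigl => a; apply: andb_id2l => aT; apply: andb_id2r => ab.
  by rewrite farE.
rewrite -Xs; case: (far T b f) => /=; rewrite ?add0r !addrA; congr (_ + _).
  by rewrite fspace_char2 add0r.
by rewrite addrAC addrC fspace_char2 addr0.
Qed.

Lemma Pi_vmax T l C : {subset C <= act T} ->
  exists k : F2, Pi (Yprod C (mon (vmax T) l)) = k *: crit T.
Proof.
elim: l C => [|d l IH] C sub.
  by have [/= ->|/= ->] := Pi_YY sub; [exists 0|exists 1]; rewrite ?scale0r ?scale1r.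
rewrite mon_cons X_vmax.
have -> : Yprod C (\sum_(a in act T | far T a d) Y a (mon (vmax T) l)) =
    \sum_(a in act T | far T a d) Yprod (a :: C) (mon (vmax T) l).
  elim/big_rec2: _ => [|a u1 u2 _ <-]; first exact: Yprod_0.
  by rewrite Yprod_D Yprod_Y.
rewrite linear_sum /=; elim/big_ind: _ => [|u1 u2 [k1 ->] [k2 ->]|a /andP[aT _]].
- by exists 0; rewrite scale0r.
- by exists (k1 + k2); rewrite scalerDl.
by apply: (IH (a :: C)) => c; rewrite in_cons => /predU1P[->|/sub].
Qed.

(* Each subcube retracts to the line through [crit T].                        *)
Lemma Pi_mon v l : exists k : F2, Pi (mon v l) = k *: crit (tr v).
Proof.
have [/existsP[c /andP[ca nt]]|] :=
    boolP [exists c, (c \in act (tr v)) && ~~ toggled v c].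
  by exists 0; rewrite -(Pi_pr c) pr_untoggled // linear0 scale0r.
rewrite negb_exists => /forallP all.
have vE : v = vmax (tr v).
  apply/setP => c; rewrite inE; have := all c; have := @toggled_act v c.
  rewrite /toggled; case: (c \in v); case: (c \in vt _) => /=;
    by case: (c \in act _) => //= h; have := h isT.
rewrite {1}vE; exact: (@Pi_vmax (tr v) l [::]).
Qed.

Lemma ket_base_neq0 v : mon v [::] != 0.
Proof.
have val : valid p v [set circle v p] by rewrite /valid set11 sub1set mem_circles.
have [s [rs ls _]] := ket_basis S val; apply/eqP => /ffunP/(_ s)/eqP.
by rewrite [mon _ _]/(ket _ _) ket_at rs ls !eqxx ffunE oner_eq0.
Qed.

(** Applying [far_der c] strips the factor [Y c]; removing all factors in this way leads down to a
    basis vector. *)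
Lemma crit_neq0 T : crit T != 0.
Proof.
have : {subset mergers T <= act T}.
  by move=> c; rewrite mem_enum inE => /andP[].
have : uniq (mergers T) by exact: enum_uniq.
rewrite /crit; elim: (mergers T) => [|c C IH] /=; first by rewrite ket_base_neq0.
case/andP=> cC uC sub.
have sub' : {subset C <= act T} by move=> b bC; apply: sub; rewrite in_cons bC orbT.
apply/eqP => z; have ca : c \in act T by apply: sub; rewrite mem_head.
have := far_der_Y_vmax C [::] ca.
rewrite z !linear0 far_der_YY ?tr_vmax // far_der_nil Yprod_0 linear0 add0r => /esym/eqP.
by apply/negP/IH.
Qed.

(** A state where [crit T] has coefficient 1; on a multiple of [crit T], the coefficient at this
    state is the scalar. *)
Definition crit_state T : option S := [pick s | crit T s != 0].

Lemma crit_stateP T : exists2 s, crit_state T = Some s & crit T s = 1.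
Proof.
rewrite /crit_state; case: pickP => [s nz|none]; first by exists s; rewrite ?(F2_neq0 nz).
case/eqP: (crit_neq0 T); apply/ffunP => s; rewrite ffunE.
by apply/eqP; move/negbT: (none s); rewrite negbK.
Qed.

Definition f0 : 'Hom(fspace TT, fspace S) := extend (fun T s => crit T s).
Definition r0 : 'Hom(fspace S, fspace TT) := extend (fun s T =>
  if crit_state T is Some s' then Pi (basis_vec s) s' else 0).

Lemma f0_basis T : f0 (basis_vec T) = crit T.
Proof. by apply/ffunP => s; rewrite extend_basis. Qed.

Lemma r0E u T : exists s, [/\ crit_state T = Some s, crit T s = 1 & r0 u T = Pi u s].
Proof.
have [s sT cs] := crit_stateP T; exists s; split=> //.
rewrite !lfun_coord; apply: eq_bigr => s' _; congr (_ * _).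
by rewrite extend_basis sT.
Qed.

Lemma mon_res v l s : mon v l s != 0 -> res s = v.
Proof.
rewrite monE; case: ifP => _; last by rewrite ffunE eqxx.
by rewrite ket_at; have [//|_] := eqVneq (res s) v; rewrite eqxx.
Qed.

Lemma Yprod_res v C l s : Yprod C (mon v l) s != 0 -> res s = v.
Proof.
elim: C l => [|b C IH] l /=; first exact: mon_res.
rewrite -Yprod_Y Y_mon Yprod_D ffunE.
have [->|/IH //] := eqVneq (Yprod C (mon v ((b, 0) :: l)) s) 0.
by rewrite add0r => /IH.
Qed.

Lemma r0_crit T T' : r0 (crit T) T' = (T == T')%:R.
Proof.
have [s [_ cs ->]] := r0E (crit T) T'; rewrite Pi_crit.
have [->|TT'] := eqVneq T T'; first by [].
apply/eqP; apply: contraNT TT' => /Yprod_res rs.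
have /Yprod_res rs' : crit T' s != 0 by rewrite cs.
by rewrite -[T]tr_vmax -[T']tr_vmax -rs rs'.
Qed.

Lemma r0f0 : (r0 \o f0)%VF = \1%VF.
Proof.
apply: lfun_eq_basis => T; apply/ffunP => T'.
by rewrite comp_lfunE f0_basis r0_crit lfunE /= ffunE eq_sym.
Qed.

Lemma r0_Pi u : r0 (Pi u) = r0 u.
Proof.
apply/ffunP => T; have [s [sT _ ->]] := r0E (Pi u) T.
have [s' [sT' _ ->]] := r0E u T; have : Some s = Some s' by rewrite -sT.
case=> <-; rewrite -endo_mulE (sdr_idem sdr_block) //.
Qed.

Lemma f0r0 : (f0 \o r0)%VF = Pi.
Proof.
apply: (@endo_ext _ _ S) => v l; rewrite comp_lfunE -r0_Pi.
have [k ->] := Pi_mon v l; rewrite linearZ linearZ /=.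
congr (_ *: _); rewrite -[RHS]f0_basis; congr (f0 _).
by apply/ffunP => T; rewrite r0_crit ffunE eq_sym.
Qed.

(** The second component is the number of labels 1 minus the number of labels X, which every edge
    map lowers by 1. *)
Definition cube_degree s : int * int :=
  (#|res s|%:Z, #|circles (res s)|%:Z - (2 * #|labels s|)%:Z).

Definition shift (k : int * int) s t := tr (res s) = tr (res t) /\ cube_degree t = cube_degree s + k.

Lemma shift_comp k m s t u : shift k s t -> shift m t u -> shift (k + m) s u.
Proof. by move=> [t1 e1] [t2 e2]; split; rewrite ?t1 // e2 e1 addrA. Qed.

Lemma shift0 s : shift 0 s s.
Proof. by split; rewrite ?addr0. Qed.

Lemma endo_supported_comp k m (F G : endo S) : supported (shift k) F ->
  supported (shift m) G -> supported (shift (m + k)) (F * G : endo S).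
Proof. by apply: supported_comp => s t u; exact: shift_comp. Qed.

Lemma proj_supported (Q : pred {set crossing D}) : supported (fun s t => s = t /\ Q (res s)) (proj Q).
Proof.
move=> s t; rewrite on_basisE; case: ifP => [Qs|_]; last by rewrite ffunE eqxx.
by rewrite ffunE; have [->|] := eqVneq t s; rewrite ?eqxx.
Qed.

Definition incidence_sup c s t := res t = flip (res s) c /\
  smooth_incidence (res s) (labels s) (res t) (labels t).

Lemma E_supported c : supported (incidence_sup c) (E c).
Proof.
move=> s t; rewrite extend_basis; have [rt|_] := eqVneq (res t) (flip (res s) c);
  last by rewrite eqxx.
by case h: (smooth_incidence _ _ _ _); rewrite ?eqxx.
Qed.

Lemma incidence_degree v x w y : smooth_incidence v x w y ->
  (#|circles w| + 2 * #|x| + 1 = #|circles v| + 2 * #|y|)%N.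
Proof.
rewrite /smooth_incidence => /andP[/eqP xy].
rewrite -[#|x|](cardsID (circles v :\: circles w)) xy.
rewrite -[#|y|](cardsID (circles w :\: circles v)).
rewrite -[#|circles w|](cardsID (circles v)) -[#|circles v|](cardsID (circles w)).
rewrite (setIC (circles w)).
case/orP=> /and3P[/eqP-> /eqP->] /orP[]/eqP[-> ->]; lia.
Qed.

Lemma gd_E c s t : incidence_sup c s t ->
  cube_degree t = cube_degree s + (if c \in res s then - 1 else 1, - 1).
Proof.
case=> rt /incidence_degree cd; rewrite /cube_degree rt; rewrite rt in cd.
have := card_flip (res s) c; move=> cf; congr (_, _).
  case: ifP cf => cs /=; lia.
have arith (n1 n2 n3 n4 : nat) : (n1 + 2 * n4 + 1 = n2 + 2 * n3)%N ->
    n1%:Z - (2 * n3)%N%:Z = n2%:Z - (2 * n4)%N%:Z - 1 by lia.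
exact: arith cd.
Qed.

Lemma e_shift c (Q : pred {set crossing D}) :
  supported (fun s t => shift (if c \in res s then - 1 else 1, - 1) s t /\ Q (res s))
  (e c * proj Q : endo S).
Proof.
rewrite eE -mulrA projM.
apply: (supported_comp _ (@E_supported c) (@proj_supported _)).
move=> s t u [<- /andP[cs Qs]] h; split=> //; split; last exact: gd_E.
by case: h => ->; rewrite tr_flip.
Qed.

Lemma Der_shift lam : supported (shift (0, 2)) (Der lam).
Proof.
move=> s t; rewrite on_basisE sum_ffunE => nz.
have [z zs] : exists2 z, z \in labels s & ket (res s) (labels s :\ z) t != 0.
  apply/exists_inP; apply: contraNT nz; rewrite negb_exists_in => /forall_inP h.
  by apply/eqP/big1 => z /andP[/h zs _]; apply/eqP; move: zs; rewrite negbK.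
rewrite ket_at; have [rt|_] := eqVneq (res t) (res s); last by rewrite eqxx.
have [lt _|_] := eqVneq (labels t) (labels s :\ z); last by rewrite eqxx.
rewrite /shift /cube_degree rt lt (cardsD1 z (labels s)) zs; split=> //.
congr (_, _); rewrite /=; lia.
Qed.

Lemma dn_shift c : supported (shift (1, - 1)) (dn c).
Proof.
by move=> s t /(@e_shift c)[+ /negPf cs]; rewrite cs.
Qed.

Lemma hn_shift c : supported (shift (- 1, 1)) (hn c).
Proof.
(* Each term has one edge map from B to A, of degree (-1, -1), and one derivation, of degree (0,
   2). *)
have -> : hn c = e c * proj (fun v => c \in v) * far_der c +
                 far_der c * (e c * proj (fun v => c \in v)).
  by rewrite /hn K_def mulrDl -!mulrA (proj_da _ c).
have es : supported (shift (- 1, - 1)) (e c * proj (fun v => c \in v) : endo S).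
  by move=> s t /(@e_shift c)[+ cs]; rewrite cs.
have ds : supported (shift (0, 2)) (far_der c) by rewrite far_derE; exact: Der_shift.
apply: supportedD.
  have -> : (- 1, 1) = (0, 2) + (- 1, - 1) :> (int * int)%type by [].
  exact: endo_supported_comp.
have -> : (- 1, 1) = (- 1, - 1) + (0, 2) :> (int * int)%type by [].
exact: endo_supported_comp.
Qed.

Lemma Dn_shift : supported (shift (1, - 1)) Dn.
Proof. by apply: supported_sum => c _; exact: dn_shift. Qed.

Lemma one_shift : supported (shift 0) (1 : endo S).
Proof. by apply: supported1 => s; exact: shift0. Qed.

Lemma pr_shift c : supported (shift 0) (pr c).
Proof.
apply: supportedD; first apply: supportedD; first exact: one_shift.
  have -> : 0 = (- 1, 1) + (1, - 1) :> (int * int)%type by [].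
  by apply: endo_supported_comp; [exact: dn_shift|exact: hn_shift].
have -> : 0 = (1, - 1) + (- 1, 1) :> (int * int)%type by [].
by apply: endo_supported_comp; [exact: hn_shift|exact: dn_shift].
Qed.

Lemma Hn_shift : supported (shift (- 1, 1)) Hn.
Proof.
rewrite /Hn; elim: (enum _) => [|c s IH] /=; first exact: supported0.
apply: supportedD; first exact: hn_shift.
by rewrite -[(- 1, 1)]addr0; apply: endo_supported_comp; [exact: pr_shift|].
Qed.

Lemma Pi_shift : supported (shift 0) Pi.
Proof.
rewrite /Pi; elim: (enum _) => [|c s IH]; first by rewrite big_nil; exact: one_shift.
rewrite big_cons -[0](addr0 0); apply: endo_supported_comp => //; exact: pr_shift.
Qed.

Definition khd : endo S := \sum_(c <- enum (crossing D)) E c * proj (fun v => c \notin v).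

Lemma khd_sq : khd * khd = 0.
Proof.
have comm b c : GRing.comm (E b * proj (fun v => b \notin v))
    (E c * proj (fun v => c \notin v)).
  have [->|bc] := eqVneq b c; first exact: commr_refl.
  have cb : c != b by rewrite eq_sym.
  have pE f g : f != g -> GRing.comm (proj (fun v => f \notin v)) (E g).
    move=> fg; rewrite /GRing.comm proj_E; congr (_ * _); apply: eq_proj => v.
    by rewrite mem_flip_neq.
  apply: commrM; apply: commr_sym; apply: commrM.
  - exact: EE_comm.
  - by apply/commr_sym/pE.
  - exact: pE.
  - exact: projC_comm.
have sq c : E c * proj (fun v => c \notin v) * (E c * proj (fun v => c \notin v)) = 0.
  rewrite -mulrA [proj _ * (E c * _)]mulrA proj_E -!mulrA projM proj0 ?mulr0 //.
  by move=> v; rewrite in_flip eqxx addbT negbK andbN.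
rewrite /khd; elim: (enum _) => [|c s IH]; first by rewrite big_nil mul0r.
rewrite big_cons mulrDl !mulrDr sq IH add0r addr0.
have -> : (\sum_(j <- s) E j * proj (fun v => j \notin v)) *
    (E c * proj (fun v => c \notin v)) = (E c * proj (fun v => c \notin v)) *
    (\sum_(j <- s) E j * proj (fun v => j \notin v)).
  by apply: commr_sym; apply: commr_sum => j _; exact: comm.
exact: endo_char2.
Qed.

(** The edges at active crossings cancel modulo 2, so the perturbation consists of those at inactive
    crossings. *)
Lemma Dn_E : khd + Dn = \sum_(c <- enum (crossing D))
  E c * proj (fun v => (c \notin v) && (c \notin act (tr v))) :> endo S.
Proof.
rewrite /khd /Dn -big_split /=; apply: eq_bigr => c _.
rewrite /dn eE -mulrA -mulrDr projM; congr (_ * _).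
rewrite -(mulr1 (proj (fun v => c \notin v))) -(proj_addC S (fun v => c \in act (tr v))).
rewrite mulrDr !projM addrAC.
rewrite (eq_proj S (_ : (fun v => (c \notin v) && (c \in act (tr v))) =1
  (fun v => (c \in act (tr v)) && (c \notin v)))); last by move=> v; rewrite andbC.
by rewrite endo_char2 add0r.
Qed.

Lemma incidence_toggle c s t : incidence_sup c s t ->
  differ (res s) c || differ (flip (res s) c) c.
Proof.
case=> rt; rewrite rt; apply: contraLR; rewrite negb_or => /andP[n1 n2].
have e : circles (flip (res s) c) = circles (res s).
  by apply: eq_imset => d; rewrite -circles_single.
by rewrite /smooth_incidence e setDv cards0 andbF.
Qed.

(** An active crossing that is still untoggled splits a circle when toggled, whatever active
    crossings have been toggled before. *)
Lemma circles_toggle v (B : {set crossing D}) : B \subset act (tr v) ->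
  (forall c, c \in B -> ~~ toggled v c) ->
  #|circles [set c | (c \in v) (+) (c \in B)]| = (#|circles v| + #|B|)%N.
Proof.
elim: {B}#|B| {-2}B (erefl #|B|) => [|n IH] B Bn sub nt.
  rewrite Bn addn0; congr #|pred_of_set (circles _)|.
  by apply/setP => c; rewrite inE (cards0_eq Bn) inE addbF.
have [b bB] : exists b, b \in B by apply/set0Pn; rewrite -card_gt0 Bn.
have Bn' : #|B :\ b| = n by move: Bn; rewrite (cardsD1 b) bB => -[].
have sub' : B :\ b \subset act (tr v) by exact: subset_trans (subsetDl _ _) sub.
have nt' c : c \in B :\ b -> ~~ toggled v c by rewrite inE => /andP[_ /nt].
have := IH _ Bn' sub' nt'; set w := [set c | _] => cw.
have bw : (b \in w) = (b \in v) by rewrite !inE eqxx addbF.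
have tw : tr w = tr v.
  apply: tr_eq => c; rewrite /w in_set in_setD1.
  case: eqP => [->|_]; first by rewrite addbF; exact: toggled_act.
  have [/(subsetP sub) //|_] := boolP (c \in B).
  by rewrite addbF; exact: toggled_act.
have [dw _] : differ (flip w b) b /\ ~~ differ w b.
  apply: untoggled_differ; first by rewrite tw (subsetP sub).
  by rewrite /toggled tw bw; exact: nt.
have -> : [set c | (c \in v) (+) (c \in B)] = flip w b.
  apply/setP => c; rewrite in_flip !inE.
  by have [->|cb] := eqVneq c b; rewrite ?bB /= ?addbF /=.
by rewrite (card_circles_merge dw) flipK cw Bn' Bn addnS.
Qed.

Lemma circles_vmax T : #|circles (vmax T)| = (1 + #|act T|)%N.
Proof.
have -> : vmax T = [set c | (c \in vt T) (+) (c \in act T)] by [].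
rewrite circles_toggle ?tr_vt //; last first.
  by move=> c _; rewrite /toggled tr_vt addbb.
congr (_ + _)%N.
have -> : circles (vt T) = [set circle (vt T) p].
  apply/setP => z; rewrite in_set1; apply/imsetP/eqP => [[d _ ->]|->].
    by apply/eqP; rewrite circle_eq vt_single.
  by exists p.
by rewrite cards1.
Qed.

Section Main.
Variables (rho : TT -> nat) (col : TT -> bool).
Hypothesis step : forall v c, c \notin v ->
  differ v c || differ (flip v c) c -> tr (flip v c) != tr v ->
  (rho (tr v) < rho (tr (flip v c)))%N /\ col (tr v) = col (tr (flip v c)).

Definition degJ s : int * int * int := (cube_degree s, (col (tr (res s)))%:Z).
(** The degree of the states in [crit T]: they have one label X for the basepoint and one for each
    factor [Y]. *)
Definition degI T : int * int * int :=
  (#|vmax T|%:Z, #|circles (vmax T)|%:Z - (2 * (#|act T :&: vt T| + 1))%N%:Z,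
   (col T)%:Z).

Lemma shift_homogeneous k (F : endo S) : supported (shift k) F ->
  homogeneous degJ degJ (k, 0) F.
Proof.
by move=> sF s t /sF[tr_st gd_st]; rewrite /degJ tr_st gd_st; congr (_, _); rewrite /= addr0.
Qed.

Lemma khd_hom : homogeneous degJ degJ (1, - 1, 0) khd.
Proof.
apply: homogeneous_sum => c _.
apply: (supported_comp _ (@E_supported c) (@proj_supported _)).
move=> s _ t [<- cs] h; rewrite /degJ (gd_E h) (negPf cs); congr (_, _).
rewrite /= addr0; congr (_ : bool)%:Z.
have [<-//|ne] := eqVneq (tr (res t)) (tr (res s)).
have := incidence_toggle h; case: h ne => -> _ ne dd.
by have [] := step cs dd ne.
Qed.

Lemma del_up : supported (fun s t => rho (tr (res s)) < rho (tr (res t)))%N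
  (khd + Dn : endo S).
Proof.
rewrite Dn_E; apply: supported_sum => c _.
apply: (supported_comp _ (@E_supported c) (@proj_supported _)).
move=> s _ t [<- /andP[cs nact]] h.
have := incidence_toggle h; case: h => -> _ dd.
have [|] := step cs dd; last by [].
(* If the edge stayed in one subcube, c would be toggled at one of its two vertices, hence
   active. *)
apply: contra nact => /eqP e.
have := @toggled_act (flip (res s) c) c; have := @toggled_act (res s) c.
rewrite /toggled e in_flip eqxx.
case: (c \in res s); case: (c \in vt _) => /=; by [exact: (fun h _ => h isT)|exact: (fun _ h => h isT)].
Qed.

Lemma Yprod_labels v C l s : Yprod C (mon v l) s != 0 ->
  #|labels s| = (size C + size l).+1.
Proof.
elim: C l => [|b C IH] l /=.
  rewrite monE; case: ifP => u; last by rewrite ffunE eqxx.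
  rewrite ket_at; have [_|_] := eqVneq (res s) v; last by rewrite eqxx.
  have [-> _|_] := eqVneq (labels s) (lab p v l); last by rewrite eqxx.
  by rewrite cardsE (card_uniqP u) /= size_map.
rewrite -Yprod_Y Y_mon Yprod_D ffunE.
have [->|/IH-> _] := eqVneq (Yprod C (mon v ((b, 0) :: l)) s) 0; last by rewrite /= addnS.
by rewrite add0r => /IH->; rewrite /= addnS.
Qed.

Lemma crit_deg T s : crit T s != 0 -> degJ s = degI T.
Proof.
move=> nz; have rs := Yprod_res nz; have ls := Yprod_labels nz.
rewrite /degJ /cube_degree /degI ls rs tr_vmax -cardE addn0 addn1.
by [].
Qed.

Lemma f0_hom : homogeneous degI degJ 0 f0.
Proof. by move=> T s; rewrite f0_basis => /crit_deg->; rewrite addr0. Qed.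

Lemma r0_hom : homogeneous degJ degI 0 r0.
Proof.
move=> s T; have [s' [_ cs ->]] := r0E (basis_vec s) T.
move=> /(shift_homogeneous Pi_shift) <-; apply/esym/crit_deg.
by rewrite cs oner_eq0.
Qed.

Theorem block_retract :
  exists (dI : 'End(fspace TT)) (r : 'Hom(fspace S, fspace TT))
         (f : 'Hom(fspace TT, fspace S)) (h : 'End(fspace S)),
  [/\ homogeneous degI degI (1, - 1, 0) dI /\ (dI \o dI = 0)%VF,
      homogeneous degJ degI 0 r /\ (r \o khd = dI \o r)%VF,
      homogeneous degI degJ 0 f /\ (f \o dI = khd \o f)%VF,
      (r \o f = \1)%VF
    & homogeneous degJ degJ (- (1, - 1, 0)) h /\
      (f \o r)%VF - \1%VF = (khd \o h)%VF + (h \o khd)%VF].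
Proof.
apply: (perturb_retract (rho := fun s => rho (tr (res s))) sdr_block khd_sq
  f0r0 r0f0 khd_hom _ _ f0_hom r0_hom del_up).
- exact: (shift_homogeneous Dn_shift).
- exact: (shift_homogeneous Hn_shift).
- by move=> s t /Hn_shift[-> _].
Qed.

End Main.

End Blocks.

(** * Spanning trees and activities *)

Section Matroid.
Variables (V E : finType) (G : multigraph V E).
Implicit Types (u v : V) (e f : E) (H K T : {set E}).

Definition conn H := connect (edge_adj G H).

Lemma edge_adj_sym H : symmetric (edge_adj G H).
Proof. by move=> u v; apply: eq_existsb => e; rewrite orbC. Qed.

Lemma conn_sym H : symmetric (conn H).
Proof. exact/sym_connect_sym/edge_adj_sym. Qed.

Lemma conn_refl H : reflexive (conn H).
Proof. exact: connect0. Qed.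

Lemma conn_trans H : transitive (conn H).
Proof. exact: connect_trans. Qed.

Lemma conn_closure H K u v : {in H, forall f, joined G K f} ->
  conn H u v -> conn K u v.
Proof.
move=> HK; apply: connect_sub => x y /existsP[e /andP[eH]].
have j := HK e eH; rewrite /joined in j.
case/orP=> /eqP ex; rewrite ex in j => //.
by rewrite -/(conn K x y) conn_sym.
Qed.

Lemma joined_in H e : e \in H -> joined G H e.
Proof.
move=> eH; apply: connect1; apply/existsP; exists e.
by rewrite eH -surjective_pairing eqxx.
Qed.

Lemma joined_closure H K e : {in H, forall f, joined G K f} ->
  joined G H e -> joined G K e.
Proof. exact: conn_closure. Qed.

Lemma joined_mono H K e : H \subset K -> joined G H e -> joined G K e.
Proof. by move=> /subsetP HK; apply: joined_closure => f /HK /joined_in. Qed.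

Lemma conn_mono H K u v : H \subset K -> conn H u v -> conn K u v.
Proof. by move=> /subsetP HK; apply: conn_closure => f /HK /joined_in. Qed.

Lemma conn_add H f u v (a := (ends G f).1) (b := (ends G f).2) :
  conn (f |: H) u v = [|| conn H u v, conn H u a && conn H b v
                       | conn H u b && conn H a v].
Proof.
have sub : H \subset f |: H by rewrite subsetUr.
have fj : conn (f |: H) a b by apply: joined_in; rewrite setU11.
apply/idP/idP; last first.
  case/or3P=> [|/andP[h1 h2]|/andP[h1 h2]]; first exact: conn_mono.
    exact: conn_trans (conn_mono sub h1) (conn_trans fj (conn_mono sub h2)).
  rewrite conn_sym in fj.
  exact: conn_trans (conn_mono sub h1) (conn_trans fj (conn_mono sub h2)).
apply: (connect_ind (P := fun v => [|| conn H u v, conn H u a && conn H b v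
                       | conn H u b && conn H a v])).
  by rewrite conn_refl.
move=> y z Py /existsP[e /andP[]]; rewrite in_setU1 => /predU1P[->|eH] yz.
  have ab : y = a /\ z = b \/ y = b /\ z = a.
    by case/orP: yz; rewrite [ends G f]surjective_pairing -/a -/b => /eqP[-> ->];
      [left|right].
  by case: ab Py => -[-> ->] /or3P[->|/andP[-> _]|/andP[-> _]];
    rewrite ?conn_refl ?orbT.
have yz1 : conn H y z by apply: connect1; apply/existsP; exists e; rewrite eH.
case/or3P: Py => [h|/andP[-> h]|/andP[-> h]]; rewrite (conn_trans h yz1) ?orbT //.
Qed.

(** The exchange property of the graphic matroid. *)
Lemma joined_exchange H e f : joined G (f |: H) e -> ~~ joined G H e ->
  joined G (e |: H) f.
Proof.
rewrite {1}/joined -/(conn _ _ _) conn_add.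
rewrite {1}/joined -/(conn _ _ _) => + /negPf ne; rewrite ne /=.
rewrite /joined -/(conn _ _ _) conn_add.
case/orP=> /andP[h1 h2]; apply/or3P.
  by apply: Or32; rewrite conn_sym h1 conn_sym h2.
by apply: Or33; rewrite h1 h2.
Qed.

Section Tree.
Variable T : {set E}.
Hypothesis treeT : spanning_tree G T.
Hypothesis ends_in : forall e,
  (ends G e).1 \in vertices G /\ (ends G e).2 \in vertices G.

Lemma tree_joined e : joined G T e.
Proof.
have [e1 e2] := ends_in e.
by case/andP: treeT => /forall_inP/(_ _ e1)/forall_inP/(_ _ e2).
Qed.

Lemma tree_conn u v : u \in vertices G -> v \in vertices G -> conn T u v.
Proof. by case/andP: treeT => h _ uG vG; move/forall_inP: h => /(_ u uG)/forall_inP/(_ v vG). Qed.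

Lemma tree_acyclic e : e \in T -> ~~ joined G (T :\ e) e.
Proof. by case/andP: treeT => _ /forallP/(_ e); rewrite /on_cycle => /nandP[/negP|]. Qed.

Lemma Cut_self e : e \in T -> e \in Cut G T e.
Proof. by move=> eT; rewrite inE tree_acyclic. Qed.

Lemma Cut_tree e f : e \in T -> f \in Cut G T e -> f \in T -> f = e.
Proof.
move=> eT; rewrite inE => nf fT; apply/eqP; apply: contraNT nf => fe.
by apply: joined_in; rewrite in_setD1 fe.
Qed.

Lemma Cyc_self e : e \notin T -> e \in Cyc G T e.
Proof.
move=> eT; rewrite inE /on_cycle setU11 setU1K //; exact: tree_joined.
Qed.

Lemma Cyc_sub e : Cyc G T e \subset e |: T.
Proof. by apply/subsetP => f; rewrite inE => /andP[]. Qed.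

(** Fundamental cycles and cuts are dual: both memberships say that e may replace f in T. *)
Lemma Cyc_Cut e f : e \notin T -> f \in T -> (f \in Cyc G T e) = (e \in Cut G T f).
Proof.
move=> eT fT; have ef : e != f by apply: contraNneq eT => ->.
rewrite !inE /on_cycle in_setU1 fT orbT /=.
have -> : (e |: T) :\ f = e |: (T :\ f).
  by apply/setP => g; rewrite !inE; have [->|] := eqVneq g e; rewrite ?ef ?andbF.
apply/idP/idP => [h|nj].
  apply: contra (tree_acyclic fT) => j; apply: joined_closure h => g.
  by rewrite in_setU1 => /predU1P[->//|]; exact: joined_in.
apply: joined_exchange nj.
by rewrite setD1K //; exact: tree_joined.
Qed.

Lemma joined_sub_Cyc e f H : e \notin T -> H \subset T -> joined G H e ->
  f \in Cyc G T e -> f != e -> f \in H.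
Proof.
move=> eT HT jH fC fe; have fT : f \in T.
  by have := subsetP (Cyc_sub e) f fC; rewrite in_setU1 (negPf fe).
rewrite Cyc_Cut // inE in fC; apply: contraNT fC => fH.
apply: joined_mono jH; apply/subsetP => g gH; rewrite in_setD1 (subsetP HT) //.
by rewrite andbT; apply: contraNneq fH => <-.
Qed.

Lemma Cyc_joined e : e \notin T -> joined G (Cyc G T e :\ e) e.
Proof.
move=> eT; have ex : (T \subset T) && joined G T e by rewrite subxx tree_joined.
(* A minimal subset of T joining the ends of e lies on the fundamental cycle. *)
case: (@arg_minnP _ T (fun K => (K \subset T) && joined G K e) (fun K => #|K|) ex).
move=> K /andP[KT jK] Kmin; apply: (joined_mono _ jK); apply/subsetP => f fK.
have fT := subsetP KT f fK.
rewrite in_setD1; apply/andP; split; first by apply: contraNneq eT => <-.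
have nj : ~~ joined G (K :\ f) e.
  apply/negP => j; have := Kmin (K :\ f).
  rewrite j (subset_trans (subsetDl _ _) KT) (cardsD1 f K) fK => /(_ isT).
  by rewrite ltnn.
rewrite Cyc_Cut // inE; apply: contra (tree_acyclic fT) => j.
have : joined G (e |: (K :\ f)) f by apply: joined_exchange nj; rewrite setD1K.
apply: joined_closure => g; rewrite in_setU1 => /predU1P[->//|].
rewrite in_setD1 => /andP[gf gK]; apply: joined_in.
by rewrite in_setD1 gf (subsetP KT).
Qed.

Lemma tree_not_joined e H : e \in T -> H \subset T -> joined G H e -> e \in H.
Proof.
move=> eT HT jH; apply: contraTT jH => eH.
apply: contra (tree_acyclic eT); apply: joined_mono.
by rewrite subsetD1 HT.
Qed.

End Tree.

Lemma tree_sub_eq T T' : spanning_tree G T -> spanning_tree G T' ->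
  (forall e, (ends G e).1 \in vertices G /\ (ends G e).2 \in vertices G) ->
  T \subset T' -> T = T'.
Proof.
move=> tT tT' ends_in TT'; apply/eqP; rewrite eqEsubset TT'.
apply/subsetP => e eT'; exact: (tree_not_joined tT' eT' TT' (tree_joined tT ends_in e)).
Qed.

Section CardTree.
Hypothesis ends_in : forall e,
  (ends G e).1 \in vertices G /\ (ends G e).2 \in vertices G.
Hypothesis vertices_neq0 : vertices G != set0.

Lemma card_tree T : spanning_tree G T -> #|T|.+1 = #|vertices G|.
Proof.
(* Each edge of the tree merges two components, from one component per vertex down to a single
   one. *)
move=> tT; pose cls H := [set [set y | conn H x y] | x in vertices G].
have card_cls H : H \subset T -> (#|cls H| + #|H| = #|vertices G|)%N.
  elim: {H}#|H| {-2}H (erefl #|H|) => [|n IH] H Hn HT.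
    rewrite Hn addn0 card_in_imset // => x y xG yG /setP/(_ y).
    rewrite !inE conn_refl => xy.
    suff h z : conn H x z -> x = z by exact: h.
    apply: (connect_ind (P := fun z => x = z)) => // a b _ /existsP[e].
    by rewrite (cards0_eq Hn) inE.
  have [e eH] : exists e, e \in H by apply/set0Pn; rewrite -card_gt0 Hn.
  have Hn' : #|H :\ e| = n by move: Hn; rewrite (cardsD1 e) eH => -[].
  have sub : H :\ e \subset T by exact: subset_trans (subsetDl _ _) HT.
  have := IH _ Hn' sub; rewrite Hn' Hn => <-; rewrite addnS -addSn; congr (_ + _)%N.
  have eT := subsetP HT e eH; have [e1 e2] := ends_in e.
  symmetry; apply: (card_classes_merge (R := conn (H :\ e)) (R' := conn H)
    (a := (ends G e).1) (b := (ends G e).2)) => //.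
  - exact: conn_refl.
  - exact: conn_sym.
  - exact: conn_trans.
  - apply: contra (tree_acyclic tT eT); apply: conn_mono.
    by rewrite setSD.
  - move=> x y; rewrite -{1}(setD1K eH) conn_add.
    set R := conn (H :\ e); set a := _.1; set b := _.2.
    rewrite ![R x a]conn_sym ![R x b]conn_sym -/R.
    have Rs u v : R u v = R v u by exact: conn_sym.
    have Rt u v w : R u v -> R u w -> R v w.
      by move=> uv; apply: conn_trans; rewrite conn_sym.
    apply/or3P/orP.
      case=> [->|/andP[-> ->]|/andP[-> ->]]; [by left|right|right];
        by rewrite ?orbT.
    case=> [h|/andP[/orP[]h1 /orP[]h2]]; first by apply: Or31.
    - by apply: Or31; exact: Rt h1 h2.
    - by apply: Or32; rewrite h1 h2.
    - by apply: Or33; rewrite h1 h2.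
    - by apply: Or31; exact: Rt h1 h2.
have := card_cls T (subxx T); have [v0 v0G] := set0Pn _ vertices_neq0.
suff -> : cls T = [set [set y | conn T v0 y]] by rewrite cards1 add1n.
apply/setP => z; rewrite in_set1; apply/imsetP/eqP => [[x xG ->]|->]; last by exists v0.
have vx := tree_conn tT v0G xG.
apply/setP => y; rewrite !inE; apply/idP/idP; last first.
  by apply: conn_trans; rewrite conn_sym.
exact: conn_trans vx.
Qed.

End CardTree.
End Matroid.

(** * Kruskal's algorithm and activities *)

Section Greedy.
Variables (D : rotation_system) (V : finType) (G : multigraph V (crossing D)).
Implicit Types (e f g c : crossing D) (H K T : {set crossing D}).
Hypothesis ends_in : forall e,
  (ends G e).1 \in vertices G /\ (ends G e).2 \in vertices G.
Hypothesis connected : forall u v, u \in vertices G -> v \in vertices G ->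
  conn G setT u v.

(** The edges treated before e. An edge of H is rejected when larger edges of H close a cycle with
    it, so it is smallest on that cycle; an edge outside H is accepted when H and all smaller edges
    leave its ends apart, so it is smallest in its cut. *)
Definition pre H e : {set crossing D} :=
  if e \in H then [set f : crossing D in H | (e < f)%N] else H :|: [set f : crossing D | (f < e)%N].

(* Kruskal's algorithm, treating the edges of H first in decreasing order,    *)
(* then the other ones in increasing order.                                   *)
Definition greedy H : {set crossing D} := [set e | ~~ joined G (pre H e) e].

Lemma pre_irr H e : e \notin pre H e.
Proof. by rewrite /pre; case: ifP => eH; rewrite !inE ?ltnn ?andbF ?eH. Qed.

Lemma pre_total H e f : e != f -> (e \in pre H f) || (f \in pre H e).
Proof.
move=> ef; have {ef} : (e < f)%N || (f < e)%N by rewrite -neq_ltn.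
by rewrite /pre; case: ifP => fH; case: ifP => eH; rewrite !inE ?eH ?fH //= orbC.
Qed.

Lemma pre_trans H e f : f \in pre H e -> pre H f \subset pre H e.
Proof.
rewrite {1 3}/pre; case: ifP => eH; rewrite !inE.
  case/andP=> fH ef; rewrite /pre fH; apply/subsetP => g; rewrite !inE.
  by case/andP=> -> fg; exact: ltn_trans ef fg.
rewrite /pre; case: ifP => fH /= fe; apply/subsetP => g; rewrite !inE.
  by case/andP=> ->.
by case: (g \in H) => //= gf; exact: ltn_trans gf fe.
Qed.

Lemma greedy_span H e g : joined G (pre H e) g ->
  joined G (greedy H :&: pre H e) g.
Proof.
elim: {e}#|pre H e| {-2}e (leqnn #|pre H e|) g => [|n IH] e en g.
  move: en; rewrite leqn0 cards_eq0 => /eqP->; apply: joined_mono; exact: sub0set.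
apply: joined_closure => f fe; have [fg|nfg] := boolP (f \in greedy H).
  by apply: joined_in; rewrite inE fg.
have fn : (#|pre H f| <= n)%N.
  rewrite -ltnS; apply: leq_trans _ en; apply: proper_card.
  rewrite properE pre_trans //=; apply/subsetPn; exists f => //; exact: pre_irr.
move: nfg; rewrite inE negbK => /(IH _ fn); apply: joined_mono.
exact/setIS/pre_trans.
Qed.

Lemma greedy_joined H e : joined G (greedy H) e.
Proof.
have [eg|] := boolP (e \in greedy H); first exact: joined_in.
by rewrite inE negbK => /greedy_span; apply: joined_mono; exact: subsetIl.
Qed.

Lemma greedy_acyclic H e : e \in greedy H -> ~~ joined G (greedy H :\ e) e.
Proof.
move=> eg; apply/negP => je.
have ex : (greedy H :\ e \subset greedy H :\ e) && joined G (greedy H :\ e) e.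
  by rewrite subxx.
case: (@arg_minnP _ _ (fun K => (K \subset greedy H :\ e) && joined G K e)
  (fun K => #|K|) ex) => K /andP[KT jK] Kmin {ex}.
(* On a minimal cycle through e, the ends of the edge m treated last are already joined by edges
   treated before it, so m was rejected. *)
have [m mK mmax] := @arg_maxnP _ e (mem (e |: K)) (fun f => #|pre H f|) (setU11 _ _).
have below f : f \in e |: K -> f != m -> f \in pre H m.
  move=> fK /(pre_total H)/orP[//|mf]; have := mmax f fK.
  rewrite /= leqNgt => /negP[]; apply: proper_card; rewrite properE pre_trans //=.
  by apply/subsetPn; exists m => //; exact: pre_irr.
have nm : ~~ joined G (pre H m) m.
  move: mK; rewrite !inE => /predU1P[->|mK]; first by move: eg; rewrite inE.
  by have := subsetP KT m mK; rewrite !inE => /andP[].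
have [me|me] := eqVneq m e.
  case/negP: nm; rewrite me; apply: joined_mono jK; apply/subsetP => f fK.
  rewrite -me; apply: below; first by rewrite in_setU1 fK orbT.
  rewrite me; by have := subsetP KT f fK; rewrite in_setD1 => /andP[].
have mK' : m \in K by move: mK; rewrite !inE (negPf me).
case/negP: nm; have nj : ~~ joined G (K :\ m) e.
  apply/negP => j; have := Kmin (K :\ m).
  rewrite j (subset_trans (subsetDl _ _) KT) (cardsD1 m K) mK' => /(_ isT).
  by rewrite ltnn.
have : joined G (e |: (K :\ m)) m by apply: joined_exchange nj; rewrite setD1K.
apply: joined_mono; apply/subsetP => f; rewrite in_setU1 in_setD1.
case/predU1P=> [->|/andP[fm fK]]; apply: below => //.
- by rewrite setU11.
- by rewrite eq_sym.
- by rewrite in_setU1 fK orbT.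
Qed.

Lemma greedy_tree H : spanning_tree G (greedy H).
Proof.
apply/andP; split.
  apply/forall_inP => u uG; apply/forall_inP => v vG.
  apply: conn_closure (connected uG vG) => f _; exact: greedy_joined.
apply/forallP => e; rewrite /on_cycle negb_and orbC.
by have [/greedy_acyclic->|] := boolP (e \in greedy H); rewrite ?orbT.
Qed.

Lemma greedy_in_joined H e : e \in H -> e \notin greedy H ->
  joined G (greedy H :&: [set f : crossing D in H | (e < f)%N]) e.
Proof.
by move=> eH; rewrite inE negbK => /greedy_span; rewrite [pre H e]/pre eH.
Qed.

Lemma greedy_Cyc H e : e \in H -> e \notin greedy H ->
  smallest e (Cyc G (greedy H) e) /\ Cyc G (greedy H) e \subset H.
Proof.
move=> eH eg; have j := greedy_in_joined eH eg.
have sub f : f \in Cyc G (greedy H) e -> f != e -> f \in H /\ (e < f)%N.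
  move=> fC fe; have := joined_sub_Cyc (greedy_tree H) ends_in eg (subsetIl _ _) j fC fe.
  by rewrite !inE => /and3P[].
split; last first.
  by apply/subsetP => f fC; have [->//|/(sub f fC)[]] := eqVneq f e.
rewrite /smallest Cyc_self ?greedy_tree //=; apply/forall_inP => f fC.
by have [->//|/(sub f fC)[_ /ltnW]] := eqVneq f e.
Qed.

Lemma greedy_Cut H e : e \in greedy H -> e \notin H ->
  smallest e (Cut G (greedy H) e).
Proof.
move=> eg eH; rewrite /smallest Cut_self ?greedy_tree //=.
apply/forall_inP => f; rewrite inE => nj; rewrite leqNgt; apply: contra nj => fe.
have : joined G (pre H e) f.
  by apply: joined_in; rewrite /pre (negPf eH) !inE fe orbT.
move/greedy_span; apply: joined_mono; rewrite subsetD1 subsetIl inE.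
by rewrite (negPf (pre_irr H e)) andbF.
Qed.

(** T and H differ only at edges that are active for T, locality aside. *)
Definition fits H T := (forall e, e \in T -> e \notin H -> smallest e (Cut G T e)) /\
  (forall e, e \in H -> e \notin T -> smallest e (Cyc G T e)).

(** If some f treated before e lay in the cut of e, then e would lie on the cycle of f, and the
    minimality conditions of [fits] would contradict the order of treatment. *)
Lemma greedy_unique H T : spanning_tree G T -> fits H T -> T = greedy H.
Proof.
move=> tT [cutT cycT]; apply: (tree_sub_eq tT (greedy_tree H) ends_in).
apply/subsetP => e eT; rewrite inE; apply: contra (tree_acyclic tT eT).
apply: joined_closure => f fe; apply: contraT => nj.
have fC : f \in Cut G T e by rewrite inE.
have fne : f != e by apply: contraTneq fe => ->; exact: pre_irr.
have fT : f \notin T by apply: contraNN fne => /(Cut_tree eT fC)->.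
have eC : e \in Cyc G T f by rewrite (Cyc_Cut tT ends_in).
have small : f \in H -> (f <= e)%N.
  by move=> /cycT/(_ fT)/andP[_ /forall_inP/(_ e eC)].
move: fe; rewrite /pre; case: ifP => eH; rewrite !inE.
  by case/andP=> /small; rewrite leqNgt => /negP.
have /andP[_ /forall_inP/(_ f fC) ef] := cutT e eT (negbT eH).
case/orP=> [/small fle|]; last by rewrite ltnNge ef.
by case/negP: fne; rewrite -(inj_eq val_inj) eqn_leq fle ef.
Qed.

(** If m were smallest in its cut, T' would cross this cut above m; but there the trees agree, and T
    meets the cut only in m. The second half is the dual argument for the cycle of m in T'. *)
Lemma inactive_step H H' T T' (m : crossing D) : spanning_tree G T -> spanning_tree G T' ->
  fits H T -> fits H' T' -> (forall f, (m < f)%N -> (f \in T) = (f \in T')) ->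
  m \in T -> m \notin T' -> m \in H /\ m \notin H'.
Proof.
move=> tT tT' [cutT _] [_ cycT'] eqm mT mT'; split.
  apply: contraT => mH; have /andP[_ /forall_inP small] := cutT m mT mH.
  case/negP: (tree_acyclic tT mT); move: (tree_joined tT' ends_in m).
  apply: joined_closure => f fT'; have [mf|] := ltnP m f.
    by apply: joined_in; rewrite in_setD1 eqm // fT' andbT -(inj_eq val_inj) gtn_eqF.
  move=> fm; apply: contraT => nj.
  have mf : (m <= f)%N by apply: small; rewrite inE.
  case/negP: mT'; rewrite (_ : m = f) //.
  by apply/val_inj/eqP; rewrite eqn_leq mf fm.
apply/negP => mH'; have /andP[_ /forall_inP small] := cycT' m mH' mT'.
case/negP: (tree_acyclic tT mT); move: (Cyc_joined tT' ends_in mT').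
apply: joined_mono; apply/subsetP => f; rewrite !in_setD1 => /andP[fm fC].
have mf := small f fC; rewrite fm /= eqm.
  by have := subsetP (Cyc_sub G T' m) f fC; rewrite in_setU1 (negPf fm).
by rewrite ltn_neqAle mf andbT eq_sym (inj_eq val_inj).
Qed.

(** At the largest crossing where the trees differ, each agrees with its own edge set by
    [inactive_step]. So the edge sets differ there too, and this crossing is c. *)
Lemma tree_step H H' T T' c : spanning_tree G T -> spanning_tree G T' ->
  fits H T -> fits H' T' -> (forall f, f != c -> (f \in H) = (f \in H')) ->
  T != T' ->
  [/\ (c \in T) = (c \in H), (c \in T') = (c \in H'),
      (c \in H) != (c \in H')
    & forall f, (c < f)%N -> (f \in T) = (f \in T')].
Proof.
move=> tT tT' fT fT' eqH neT.
have [m0 m0P] : exists m : crossing D, (m \in T) != (m \in T').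
  apply/existsP; apply: contraNT neT; rewrite negb_exists => /forallP h.
  by apply/eqP/setP => f; apply/eqP; move: (h f); rewrite negbK.
have [m mP mmax] := @arg_maxnP _ m0 (fun m => (m \in T) != (m \in T')) val m0P.
have eqm (f : crossing D) : (m < f)%N -> (f \in T) = (f \in T').
  by move=> mf; apply/eqP; apply: contraTT mf => /mmax; rewrite /= -leqNgt.
have res : [/\ (m \in T) = (m \in H), (m \in T') = (m \in H')
    & (m \in H) != (m \in H')].
  have eqm' (f : crossing D) : (m < f)%N -> (f \in T') = (f \in T) by move/eqm.
  have [mT|mT] := boolP (m \in T); have [mT'|mT'] := boolP (m \in T').
  - by rewrite mT mT' in mP.
  - by have [-> /negPf->] := inactive_step tT tT' fT fT' eqm mT mT'.
  - by have [-> /negPf->] := inactive_step tT' tT fT' fT eqm' mT' mT.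
  - by rewrite (negPf mT) (negPf mT') in mP.
have cm : c = m by case: res => _ _; apply: contraNeq; rewrite eq_sym => /eqH->.
by rewrite cm; case: res => e1 e2 e3; split.
Qed.

End Greedy.

(** * Regions of a diagram *)

Section LinearDuality.
Variables (I K J : finType) (f : I -> J -> F2) (g : K -> J -> F2) (w : J -> F2).

Let vec (T : finType) (u : T -> F2) : 'rV[F2]_#|T| := \row_j u (enum_val j).
Let mx (T : finType) (m : T -> J -> F2) : 'M[F2]_(#|T|, #|J|) :=
  \matrix_(i, j) m (enum_val i) (enum_val j).
Let unvec (T : finType) (u : 'rV[F2]_#|T|) (i : T) : F2 := u 0 (enum_rank i).

Let unvecK (T : finType) (u : 'rV[F2]_#|T|) : vec (unvec u) = u.
Proof. by apply/rowP => j; rewrite mxE /unvec enum_valK. Qed.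

Let sum_enum (T : finType) (F : T -> F2) :
  \sum_i F i = \sum_(i < #|T|) F (enum_val i).
Proof.
by rewrite (reindex (@enum_val T T)) //; apply: onW_bij; exact: enum_val_bij.
Qed.

Let mul_vec_mx (T : finType) (u : T -> F2) (m : T -> J -> F2) :
  vec u *m mx m = vec (fun j => \sum_i u i * m i j).
Proof.
apply/rowP => j; rewrite !mxE [RHS]sum_enum.
by apply: eq_bigr => i _; rewrite !mxE.
Qed.

Let mul_mx_vec (T : finType) (u : J -> F2) (m : T -> J -> F2) :
  vec u *m (mx m)^T = vec (fun i => \sum_j m i j * u j).
Proof.
apply/rowP => i; rewrite !mxE [RHS]sum_enum.
by apply: eq_bigr => j _; rewrite !mxE mulrC.
Qed.

Let vec_inj (T : finType) (u u' : T -> F2) : vec u = vec u' -> u =1 u'.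
Proof. by move=> /rowP e i; have := e (enum_rank i); rewrite !mxE enum_rankK. Qed.

Let rank_bound (T : finType) (m : T -> J -> F2) :
  (forall u, (forall j, \sum_i u i * m i j = 0) -> forall i i', u i = u i') ->
  (#|T| <= \rank (mx m) + 1)%N.
Proof.
move=> hm; have := mxrank_ker (mx m).
have : (\rank (kermx (mx m)) <= 1)%N.
  apply: leq_trans (rank_leq_row (const_mx 1 : 'rV[F2]_#|T|)).
  apply: mxrankS; apply/rV_subP => u /sub_kermxP um.
  have cst i i' : unvec u i = unvec u i'.
    apply: hm => j; move: um; rewrite -[u]unvecK mul_vec_mx => /rowP/(_ (enum_rank j)).
    by rewrite !mxE enum_rankK unvecK.
  have [/eqP T0|] := posnP #|T|.
    by apply/submxP; exists 0; apply/rowP => j; have := ltn_ord j; rewrite {2}(eqP T0).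
  case/card_gt0P => i0 _; apply/submxP; exists (unvec u i0)%:M.
  by apply/rowP => j; rewrite mul_scalar_mx !mxE mulr1 (cst i0 (enum_val j)) /unvec enum_valK.
move=> k1 kE; have := rank_leq_row (mx m); lia.
Qed.

Lemma double_orthogonal (c : J -> F2) :
  (forall z : J -> F2, (forall i, \sum_j f i j * z j = 0) ->
     \sum_j c j * z j = 0) ->
  exists b : I -> F2, forall j, c j = \sum_i b i * f i j.
Proof.
move=> hc; suff /submxP[b cE] : (vec c <= mx f)%MS.
  by exists (unvec b) => j; move: j; apply: vec_inj; rewrite cE -{1}[b]unvecK mul_vec_mx.
rewrite submxE; apply/eqP/rowP => q; rewrite [RHS]mxE.
pose z j := cokermx (mx f) (enum_rank j) q.
rewrite mxE; transitivity (\sum_j c j * z j).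
  by rewrite [RHS]sum_enum; apply: eq_bigr => j _; rewrite mxE /z enum_valK.
apply: hc => i; transitivity ((mx f *m cokermx (mx f)) (enum_rank i) q); last first.
  by rewrite mulmx_coker mxE.
rewrite mxE (sum_enum (fun j => f i j * z j)).
by apply: eq_bigr => j _; rewrite /z enum_valK !mxE enum_rankK.
Qed.

Hypothesis fg : forall i k, \sum_j f i j * g k j = 0.
Hypothesis fw : forall i, \sum_j f i j * w j = 0.
Hypothesis f_ker : forall u, (forall j, \sum_i u i * f i j = 0) ->
  forall i i', u i = u i'.
Hypothesis g_ker : forall u, (forall j, \sum_k u k * g k j = 0) ->
  forall k k', u k = u k'.
Hypothesis w_new : ~ exists a : K -> F2, forall j, w j = \sum_k a k * g k j.
Hypothesis card_le : (#|J| + 1 <= #|I| + #|K|)%N.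

Let Z := kermx (mx f)^T.
Let B := (mx g + vec w)%MS.

Let B_Z : (B <= Z)%MS.
Proof.
rewrite addsmx_sub; apply/andP; split.
  apply/sub_kermxP/matrixP => k i; rewrite !mxE.
  rewrite -[RHS](fg (enum_val i) (enum_val k)) [RHS]sum_enum.
  by apply: eq_bigr => j _; rewrite !mxE mulrC.
apply/sub_kermxP; rewrite mul_mx_vec; apply/rowP => i; rewrite !mxE.
exact: fw.
Qed.

Let rank_B : (#|K| <= \rank B)%N.
Proof.
apply: leq_trans (rank_bound g_ker) _; rewrite addn1.
apply: rank_ltmx; rewrite ltmxE addsmxSl /=.
apply/negP => h; apply: w_new.
have /submxP[a wa] : (vec w <= mx g)%MS by apply: submx_trans h; exact: addsmxSr.
exists (unvec a) => j; move: j; apply: vec_inj.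
by rewrite wa -{1}[a]unvecK mul_vec_mx.
Qed.

Let rank_Z : (\rank Z + #|I| <= #|J| + 1)%N.
Proof.
have := mxrank_ker (mx f)^T; rewrite mxrank_tr -/Z => ->.
have := rank_bound f_ker; have := rank_leq_col (mx f); lia.
Qed.

(** Let [I], [K], [J] be regions, crossings and arcs. Coboundaries of crossings and [w] span at
    least [#|K|] dimensions of the cocycles, which have at most [#|J| + 1 - #|I|]. The Euler
    characteristic bound forces equality, so [w] generates the first cohomology. *)
Lemma dual_card : (#|I| + #|K| = #|J| + 1)%N.
Proof. have := rank_Z; have := rank_B; have := mxrankS B_Z; move: card_le; lia. Qed.

Lemma dual_cocycle (z : J -> F2) : (forall i, \sum_j f i j * z j = 0) ->
  exists (a : K -> F2) (t : F2), forall j, z j = \sum_k a k * g k j + t * w j.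
Proof.
move=> hz; have /submx_trans : (vec z <= Z)%MS.
  apply/sub_kermxP; rewrite mul_mx_vec; apply/rowP => i; rewrite !mxE; exact: hz.
have ZB : (Z <= B)%MS.
  have le := mxrank_leqif_sup B_Z; rewrite -(geq_leqif le).
  have := rank_Z; have := rank_B; move: card_le; lia.
move=> /(_ _ _ ZB)/sub_addsmxP[[a t] /= zE].
exists (unvec a), (t 0 0) => j; move: j; apply: vec_inj; rewrite zE.
rewrite -{1}[a]unvecK mul_vec_mx; apply/rowP => j; rewrite !mxE.
by rewrite big_ord1 !mxE.
Qed.

(** A cycle on which [w] vanishes is orthogonal to all cocycles, hence a boundary. *)
Lemma dual_boundary (c : J -> F2) : (forall k, \sum_j g k j * c j = 0) ->
  \sum_j w j * c j = 0 ->
  exists b : I -> F2, forall j, c j = \sum_i b i * f i j.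
Proof.
move=> gc wc; apply: double_orthogonal => z /dual_cocycle[a [t zE]].
transitivity (\sum_k a k * (\sum_j g k j * c j) + t * \sum_j w j * c j); last first.
  by rewrite wc mulr0 addr0 big1 // => k _; rewrite gc mulr0.
under [X in _ = X + _]eq_bigr => k _ do rewrite mulr_sumr.
rewrite exchange_big mulr_sumr -big_split /=; apply: eq_bigr => j _.
rewrite zE mulrDr mulr_sumr; congr (_ + _); last by rewrite mulrC mulrA.
by apply: eq_bigr => k _; rewrite mulrC mulrA.
Qed.

End LinearDuality.

Section Surface.
Variable D : rotation_system.
Implicit Types (d x y : dart D) (c : crossing D) (R : {set dart D}).

Lemma turnK d k : turn (turn d k) (- k) = d.
Proof. by case: d => c i; rewrite /turn /= addrK. Qed.

Lemma turnNK d k : turn (turn d (- k)) k = d.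
Proof. by case: d => c i; rewrite /turn /= addrNK. Qed.

(** One side of an end of an arc. [flag_cross] follows this side to the other end of the arc,
    [flag_swap] moves to the other end bounding the same corner; alternating them runs around a
    region. *)
Definition flag : finType := (dart D * bool)%type.
Definition flag_corner (b : flag) := corner b.1 b.2.
Definition flag_cross (b : flag) : flag := (arc b.1, b.2 (+) ~~ wraps b.1).
Definition flag_swap (b : flag) : flag :=
  if b.2 then (turn b.1 1, false) else (turn b.1 (- 1), true).

Lemma flag_crossK : involutive flag_cross.
Proof.
by move=> [d l]; rewrite /flag_cross /= arcK wraps_arc -addbA addbb addbF.
Qed.

Lemma flag_swapK : involutive flag_swap.
Proof. by move=> [d []]; rewrite /flag_swap /= ?turnK ?turnNK. Qed.

Lemma flag_cross_neq b : flag_cross b != b.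
Proof. by case: b => d l; rewrite /flag_cross xpair_eqE negb_and arc_neq. Qed.

Lemma flag_swap_neq b : flag_swap b != b.
Proof. by case: b => d []; rewrite /flag_swap xpair_eqE andbF. Qed.

Let next b := flag_swap (flag_cross b).
Let next_inj : injective next := dihedral_inj flag_crossK flag_swapK.

Let orbit_rank b : nat := enum_rank (froot next b).

Let rank_next b : orbit_rank (next b) = orbit_rank b.
Proof.
rewrite /orbit_rank; congr (nat_of_ord (enum_rank _)); apply/eqP.
rewrite (root_connect (fconnect_sym next_inj)) fconnect_sym //.
exact: fconnect1.
Qed.

Let rank_swap b : orbit_rank (flag_swap b) != orbit_rank b.
Proof.
rewrite (inj_eq val_inj) (inj_eq enum_rank_inj).
rewrite (root_connect (fconnect_sym next_inj)) fconnect_sym //.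
apply/negP => /iter_findex e.
have := dihedral_orbit flag_crossK flag_swapK flag_cross_neq flag_swap_neq
  (findex next b (flag_swap b)) b.
by rewrite -/next e eqxx.
Qed.

(* Of the two orbits of flags bordering a region, running in opposite         *)
(* directions, [side] selects one.                                            *)
Let side b := (orbit_rank b < orbit_rank (flag_swap b))%N.

Let side_swap b : side (flag_swap b) = ~~ side b.
Proof.
by rewrite /side flag_swapK -leqNgt ltn_neqAle rank_swap.
Qed.

Let side_cross b : side (flag_cross b) = ~~ side b.
Proof.
have -> : flag_cross b = flag_swap (next b) by rewrite /next flag_swapK.
rewrite side_swap; congr (~~ _); rewrite /side rank_next.
have -> : flag_swap (next b) = flag_cross b by rewrite /next flag_swapK.
rewrite -[orbit_rank (flag_cross b)]rank_next /next flag_crossK //.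
Qed.

(* The regions are disks, so that the passages through the boundary of the    *)
(* drawing disk have a potential on each of them.                             *)
Lemma region_potential : exists q : dart D -> bool, forall d l,
  q (corner (arc d) (l (+) ~~ wraps d)) = q (corner d l) (+) wraps d.
Proof.
(* This compares the chosen direction around the region with the orientation of the picture, which
   each passage through the boundary of the disk reverses. *)
pose q x := side (x, true).
have qE d l : q (corner d l) = side (d, l) (+) ~~ l.
  case: l => /=; first by rewrite addbF.
  have -> : (d, false) = flag_swap (turn d (- 1), true) :> flag.
    by rewrite /flag_swap /= turnNK.
  by rewrite side_swap addbT negbK.
exists q => d l; rewrite !qE.
rewrite -[(arc d, _)]/(flag_cross (d, l)) side_cross.
by case: (side _); case: l; case: (wraps d).
Qed.

Lemma region_step_sym t : symmetric (@region_step D t).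
Proof.
move=> x y; apply/idP/idP => /existsP[d /existsP[l /and3P[/eqP w /eqP-> /eqP->]]];
  apply/existsP; exists (arc d); apply/existsP; exists (l (+) ~~ t);
  by rewrite wraps_arc w arcK -addbA addbb addbF !eqxx.
Qed.

Lemma region_adj_sym : symmetric (@region_adj D).
Proof. by move=> x y; apply: eq_existsb => t; exact: region_step_sym. Qed.

Lemma region_adj_flag b : region_adj (flag_corner b) (flag_corner (flag_cross b)).
Proof.
apply/existsP; exists (wraps b.1); apply/existsP; exists b.1.
by apply/existsP; exists b.2; rewrite !eqxx.
Qed.

Lemma region_adjP x y : region_adj x y ->
  exists b : flag, x = flag_corner b /\ y = flag_corner (flag_cross b).
Proof.
case/existsP => t /existsP[d /existsP[l /and3P[/eqP w /eqP-> /eqP->]]].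
by exists (d, l); rewrite /flag_corner /flag_cross /= w.
Qed.

Lemma region_connect_sym : connect_sym (@region_adj D).
Proof. exact/sym_connect_sym/region_adj_sym. Qed.

Lemma mem_region x y : (y \in region x) = connect (@region_adj D) x y.
Proof. by rewrite inE. Qed.

Lemma region_eq x y : (region x == region y) = connect (@region_adj D) x y.
Proof.
apply/eqP/idP => [e|xy]; first by rewrite -mem_region e mem_region connect0.
apply/setP => z; rewrite !mem_region.
apply/idP/idP; first by apply: connect_trans; rewrite region_connect_sym.
exact: connect_trans.
Qed.

Lemma region_of R x : R \in regions D -> x \in R -> R = region x.
Proof.
case/imsetP => y _ ->; rewrite mem_region => xy; apply/eqP.
by rewrite region_eq.
Qed.

Lemma mem_regions x : region x \in regions D.
Proof. exact: imset_f. Qed.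

Lemma sum_corners (h : dart D -> F2) :
  \sum_d (h (corner d true) + h (corner d false)) = 0.
Proof.
rewrite big_split /= -[X in X + _]/(\sum_d h d).
rewrite (reindex_inj (h := fun d : dart D => turn d (- 1))); last first.
  by apply: (can_inj (g := fun d : dart D => turn d 1)) => d; exact: turnNK.
exact: F2_char2.
Qed.

Section Arcs.
Variable o : orientation D.

Definition out : pred (dart D) := outgoing o.
(** An arc is represented by its end at which the orientation leaves a crossing. *)
Definition arcs : finType := {d in out}.

Lemma out_arc d : (arc d \in out) = (d \notin out).
Proof. exact: outgoing_arc. Qed.

Lemma sum_arcs (k : dart D -> F2) :
  \sum_(a : arcs) (k (val a) + k (arc (val a))) = \sum_d k d.
Proof.
rewrite big_split /= [RHS](bigID (mem out)); congr (_ + _).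
  by rewrite (big_sub out k).
rewrite -(big_sub out (k \o (@arc D))) [RHS](reindex_inj (inv_inj (@arcK D))) /=.
by apply: eq_bigl => d; rewrite out_arc negbK.
Qed.

Lemma card_arcs : #|arcs| = (2 * ncross D)%N.
Proof.
have h1 : #|out| = #|[predC out]|.
  rewrite -(card_imset (mem out) (inv_inj (@arcK D))); apply: eq_card => d.
  apply/imsetP/idP => [[e eo ->]|nd]; first by rewrite inE /= out_arc negbK.
  by exists (arc d); rewrite ?arcK // out_arc.
have := cardC out; rewrite -h1 card_prod !card_ord.
have -> : #|arcs| = #|out| by rewrite card_sig; apply: eq_card.
lia.
Qed.

End Arcs.
End Surface.

(** * Homology of a connected nonlocal diagram *)

Section Homology.
Variables (D : rotation_system) (o : orientation D) (p : dart D).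
Implicit Types (d x y : dart D) (c : crossing D) (R : {set dart D}).
Hypothesis planar : in_RP2 D.
Hypothesis conD : connected_diagram D.
Hypothesis nonlocal : ~ local_diagram D.

Definition Reg : finType := {R : {set dart D} | R \in regions D}.
Definition reg x : Reg := exist _ (region x) (mem_regions x).

Let inR R x : F2 := (x \in R)%:R.
Let edge_R R d := inR R (corner d true) + inR R (corner d false).

Lemma mem_corner_cross R d l : R \in regions D ->
  (corner (arc d) (l (+) ~~ wraps d) \in R) = (corner d l \in R).
Proof.
move=> RD; have adj := region_adj_flag (d, l).
apply/idP/idP => h; rewrite (region_of RD h) mem_region connect1 //.
by rewrite region_adj_sym.
Qed.

Lemma edge_R_arc R d : R \in regions D -> edge_R R (arc d) = edge_R R d.
Proof.
move=> RD; rewrite /edge_R /inR -(mem_corner_cross d true RD).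
rewrite -(mem_corner_cross d false RD).
by case: (wraps d) => //=; rewrite addrC.
Qed.

Lemma sum_reg (u : Reg -> F2) x : \sum_R u R * inR (val R) x = u (reg x).
Proof.
rewrite (bigD1 (reg x)) //= /inR mem_region connect0 mulr1 big1 ?addr0 // => R Rx.
have [xR|_] := boolP (x \in sval R); last by rewrite mulr0.
case/eqP: Rx; apply: val_inj; exact: region_of (valP R) xR.
Qed.

Lemma reg_adj x y : region_adj x y -> reg x = reg y.
Proof. by move=> xy; apply: val_inj; apply/eqP; rewrite /= region_eq connect1. Qed.

Let incR (R : Reg) (a : arcs o) : F2 := edge_R (val R) (val a).
Let incC (c : crossing D) (a : arcs o) : F2 :=
  (c == (val a).1)%:R + (c == (arc (val a)).1)%:R.
Let wr (a : arcs o) : F2 := (wraps (val a))%:R.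

Lemma sum_delta (u : crossing D -> F2) e : \sum_c u c * (c == e)%:R = u e.
Proof.
rewrite (bigD1 e) //= eqxx mulr1 big1 ?addr0 // => c /negPf->.
by rewrite mulr0.
Qed.

Lemma F2_add_eq0 (a b : F2) : a + b = 0 -> a = b.
Proof. by move=> ab; apply: (addIr b); rewrite ab F2_char2. Qed.

Lemma arcs_forall (Q : dart D -> Prop) : (forall d, Q (arc d) -> Q d) ->
  (forall a : arcs o, Q (val a)) -> forall d, Q d.
Proof.
move=> Qa h d; have [dout|] := boolP (d \in out o).
  exact: (h (exist _ d dout)).
by rewrite -out_arc => aout; apply: Qa; exact: (h (exist _ (arc d) aout)).
Qed.

Lemma crossings_const (Q : crossing D -> crossing D -> Prop) :
  (forall c, Q c c) -> (forall a b c, Q a b -> Q b c -> Q a c) ->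
  (forall d, Q d.1 (arc d).1) -> forall c c', Q c c'.
Proof.
move=> Qr Qt Qa c c'; apply: (connect_ind (P := Q c) _ _ (conD c c')) => //.
by move=> a b ca /existsP[i /eqP<-]; exact: Qt ca (Qa (a, i)).
Qed.

Let incR_ker u : (forall a, \sum_R u R * incR R a = 0) ->
  forall R R' : Reg, u R = u R'.
Proof.
move=> h; pose th x := u (reg x).
have flank d : th (corner d true) = th (corner d false).
  move: d; apply: arcs_forall => [d|a].
    have adj l : th (corner (arc d) (l (+) ~~ wraps d)) = th (corner d l).
      congr u; apply/esym/reg_adj; exact: (region_adj_flag (d, l)).
    by rewrite -(adj true) -(adj false); case: (wraps d) => /= ->.
  apply: F2_add_eq0; rewrite -(h a) /th -!sum_reg -big_split /=.
  by apply: eq_bigr => R _; rewrite -mulrDr.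
have tw c i j : th (c, i) = th (c, j).
  have s k : th (c, k) = th (c, k - 1) by exact: (flank (c, k)).
  have h3 := s 3; have h2 := s 2; have h1 := s 1.
  have e32 : (3 - 1 : 'I_4) = 2 by exact: val_inj.
  have e21 : (2 - 1 : 'I_4) = 1 by exact: val_inj.
  have e10 : (1 - 1 : 'I_4) = 0 by exact: val_inj.
  rewrite e32 in h3; rewrite e21 in h2; rewrite e10 in h1.
  by move: i; apply: I4_cases; move: j; apply: I4_cases; rewrite ?h3 ?h2 ?h1.
have all : forall c c', forall i j, th (c, i) = th (c', j).
  apply: crossings_const => [//|a b c ab bc i j|[c i] k j].
    by rewrite (ab i 0) (bc 0 j).
  rewrite (tw _ k i) -[(c, i)]/(corner (c, i) true) /=.
  have -> : th (c, i) = th (corner (arc (c, i)) (true (+) ~~ wraps (c, i))).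
    congr u; apply/reg_adj; exact: (region_adj_flag ((c, i) : dart D, true)).
  rewrite [corner _ _]surjective_pairing.
  have -> : (corner (arc (c, i)) (true (+) ~~ wraps (c, i))).1 = (arc (c, i)).1.
    by case: (true (+) _).
  exact: tw.
have surj (R : Reg) : exists x, R = reg x.
  by have /imsetP[x _ Rx] := valP R; exists x; apply: val_inj.
move=> R R'; have [x ->] := surj R; have [y ->] := surj R'.
case: x => c i; case: y => c' j; exact: all.
Qed.

Let incC_ker u : (forall a, \sum_c u c * incC c a = 0) -> forall c c', u c = u c'.
Proof.
move=> h; apply: crossings_const => [//|a b c -> ->//|].
apply: arcs_forall => [d|a]; first by rewrite arcK => ->.
apply: F2_add_eq0; rewrite -(h a) -!sum_delta -big_split /=.
by apply: eq_bigr => c _; rewrite mulrDr.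
Qed.

Let incRC (R : Reg) c : \sum_a incR R a * incC c a = 0.
Proof.
pose k d := edge_R (val R) d * (c == d.1)%:R.
transitivity (\sum_d k d).
  rewrite -(sum_arcs o); apply: eq_bigr => a _.
  by rewrite /k (edge_R_arc _ (valP R)) -mulrDr.
rewrite -[RHS](sum_corners (fun x => inR (val R) x * (c == x.1)%:R)).
by apply: eq_bigr => d _; rewrite /k /edge_R mulrDl.
Qed.

Let inc_wr (R : Reg) : \sum_a incR R a * wr a = 0.
Proof.
have [q qP] := region_potential D.
pose h x : F2 := inR (val R) x * (q x)%:R.
pose k d := h (corner d true) + h (corner d false).
transitivity (\sum_d k d); last exact: sum_corners.
rewrite -(sum_arcs o); apply: eq_bigr => a _; rewrite /incR /wr /k.
move: (val a) => d {a}; have RD := valP R.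
have hE l : h (corner d l) + h (corner (arc d) (l (+) ~~ wraps d)) =
    inR (val R) (corner d l) * (wraps d)%:R.
  rewrite /h /inR mem_corner_cross // qP -mulrDr; congr (_ * _).
  by case: (q _); case: (wraps d); apply/eqP.
rewrite /edge_R mulrDl -!hE.
by case: (wraps d) => /=; rewrite addrACA // [X in _ = _ + X]addrC addrACA.
Qed.

(** A crossing function with coboundary [wraps] is a choice of [push] that makes the diagram
    local. *)
Let wr_new : ~ exists g : crossing D -> F2, forall a, wr a = \sum_c g c * incC c a.
Proof.
case=> g gE; apply: nonlocal; exists (fun c => g c != 0) => d.
have {gE} : (wraps d)%:R = g d.1 + g (arc d).1 :> F2.
  move: d; apply: arcs_forall => [d|a]; first by rewrite arcK wraps_arc addrC.
  rewrite -[LHS]/(wr a) gE -!sum_delta -big_split /=.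
  by apply: eq_bigr => c _; rewrite -mulrDr.
have [->|/F2_neq0->] := eqVneq (g d.1) 0; have [->|/F2_neq0->] := eqVneq (g (arc d).1) 0;
  by case: (wraps d) => // /eqP.
Qed.

Let card_components : #|components D| = 1%N.
Proof.
have -> : components D = [set component p.1].
  apply/setP => z; rewrite in_set1; apply/imsetP/eqP => [[c _ ->]|->]; last by exists p.1.
  by apply/setP => c'; rewrite !inE !conD.
by rewrite cards1.
Qed.

Let card_Reg : #|Reg| = #|regions D|.
Proof. by rewrite card_sig; apply: eq_card. Qed.

Let card_bound : (#|arcs o| + 1 <= #|Reg| + #|crossing D|)%N.
Proof.
move: planar; rewrite /in_RP2 card_components card_Reg card_arcs card_ord.
lia.
Qed.

(** The Euler characteristic is exactly 1: [in_RP2] bounds it below, and nonlocality excludes the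
    sphere. *)
Lemma card_regions : #|regions D| = (ncross D).+1.
Proof.
have := dual_card incRC inc_wr incR_ker incC_ker wr_new card_bound.
rewrite card_arcs card_Reg card_ord; lia.
Qed.

Lemma cocycle_arcs (y : dart D -> F2) :
  (forall R, R \in regions D ->
     \sum_d y d * ((corner d true \in R)%:R + (corner d false \in R)%:R) = 0) ->
  exists (g : crossing D -> F2) (t : F2), forall d,
    y d + y (arc d) = g d.1 + g (arc d).1 + t * (wraps d)%:R.
Proof.
move=> hy; pose z (a : arcs o) := y (val a) + y (arc (val a)).
have [R|g [t gt]] := dual_cocycle incRC inc_wr incR_ker incC_ker wr_new card_bound (z := z).
  transitivity (\sum_d y d * edge_R (val R) d); last exact: hy (valP R).
  rewrite -(sum_arcs o); apply: eq_bigr => a _; rewrite (edge_R_arc _ (valP R)).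
  by rewrite -mulrDl mulrC.
exists g, t; apply: arcs_forall => [d|a].
  by rewrite arcK wraps_arc => h; rewrite addrC h [X in X + _]addrC.
rewrite -[LHS]/(z a) gt -!sum_delta -big_split /=; congr (_ + _).
by apply: eq_bigr => c _; rewrite -mulrDr.
Qed.

(** The union of all arcs is a cycle, each crossing having four ends, and [wraps] vanishes on it
    because the link is nullhomologous. It therefore bounds a set of regions, the black ones. *)
Lemma coloring_exists : nullhomologous o -> exists black, @checkerboard D black.
Proof.
move=> null.
have [c||b bE] := dual_boundary incRC inc_wr incR_ker incC_ker wr_new card_bound
  (c := fun _ => 1).
- transitivity (\sum_(d : dart D) ((c == d.1)%:R : F2)).
    by rewrite -(sum_arcs o); apply: eq_bigr => a _; rewrite mulr1.
  rewrite -natr_sum -big_mkcond sum1_card.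
  have -> : #|[pred d : dart D | c == d.1]| = 4%N.
    rewrite -[RHS](card_ord 4) -(card_imset (mem 'I_4) (f := fun i => (c, i) : dart D)).
      apply: eq_card => -[c' i]; rewrite !inE /=.
      apply/eqP/imsetP => [->|[j _ [-> _]]//]; by exists i.
    by move=> i j [].
  by apply/eqP.
- transitivity (\sum_(a : arcs o) wr a); first by apply: eq_bigr => a _; rewrite mulr1.
  have -> : \sum_a wr a = \sum_(d in out o) ((wraps d)%:R : F2).
    by rewrite (big_sub (out o) (fun d => (wraps d)%:R : F2)).
  rewrite -natr_sum -big_mkcondr /= sum1_card.
  move: null; rewrite /nullhomologous => null.
  have -> : #|[pred d | (d \in out o) && wraps d]| =
            #|[set d : dart D | outgoing o d && wraps d]|.
    by apply: eq_card => d; rewrite !inE.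
  rewrite -(odd_double_half #|_|) (negPf null) add0n -mul2n natrM.
  by rewrite (_ : 2%:R = 0 :> F2) ?mul0r //; apply/eqP.
have flank d : b (reg (corner d true)) + b (reg (corner d false)) = 1.
  move: d; apply: arcs_forall => [d|a]; last first.
    rewrite (bE a) -!sum_reg -big_split /=; apply: eq_bigr => R _.
    by rewrite -mulrDr.
  have adj l : reg (corner (arc d) (l (+) ~~ wraps d)) = reg (corner d l).
    apply/esym/reg_adj; exact: (region_adj_flag (d, l)).
  by rewrite -(adj true) -(adj false); case: (wraps d) => //=; rewrite addrC.
exists [set x | b (reg x) != 0]; split=> [x y xy|d].
  by rewrite !inE (reg_adj xy).
rewrite !inE negbK; have := flank d.
have [->|/F2_neq0->] := eqVneq (b (reg (corner d true))) 0;
  have [->|/F2_neq0->] := eqVneq (b (reg (corner d false))) 0 => // /eqP.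
Qed.

End Homology.

(** * Duality of the two Tait graphs *)

Section Coloring.
Variables (D : rotation_system) (black : {set dart D}).
Implicit Types (d x y : dart D) (c e : crossing D) (R : {set dart D}).
Implicit Types (v H K : {set crossing D}).
Hypothesis check : @checkerboard D black.
Local Notation sgn := (edge_sign black).

Lemma checkerboardC : @checkerboard D (~: black).
Proof.
case: check => h1 h2; split=> [x y xy|d]; rewrite !in_setC ?(h1 _ _ xy) //.
by rewrite h2.
Qed.

Lemma black_adj x y : region_adj x y -> (x \in black) = (y \in black).
Proof. by case: check => h _; exact: h. Qed.

Lemma black_turn1 x : (turn x 1 \in black) = (x \notin black).
Proof.
case: check => _ /(_ (turn x 1)); rewrite /corner /= => ->.
by rewrite turnK.
Qed.

Lemma turn_turn x i j : turn (turn x i) j = turn x (i + j).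
Proof. by case: x => c k; rewrite /turn /= addrA. Qed.

Lemma turn0 x : turn x 0 = x.
Proof. by case: x => c k; rewrite /turn /= addr0. Qed.

Lemma black_turn2 x : (turn x 2 \in black) = (x \in black).
Proof.
have -> : turn x 2 = turn (turn x 1) 1.
  by rewrite turn_turn; congr (turn x _); exact: val_inj.
by rewrite !black_turn1 negbK.
Qed.

Lemma black_turnN1 x : (turn x (- 1) \in black) = (x \notin black).
Proof. by rewrite -{2}(turnNK x 1) black_turn1 negbK. Qed.

Lemma turn22 x : turn (turn x 2) 2 = x.
Proof.
rewrite turn_turn -[RHS]turn0; congr (turn x _); exact: val_inj.
Qed.

Lemma turn_eq c (i j k : 'I_4) : val (i + k) = val j ->
  turn (c, i) k = (c, j) :> dart D.
Proof. by move=> /val_inj <-. Qed.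

Lemma black_ends c : [/\ ((c, 1) \in black) = ((c, 0) \notin black),
  ((c, 2) \in black) = ((c, 0) \in black)
  & ((c, 3) \in black) = ((c, 0) \notin black)].
Proof.
have t1 : turn (c, 0) 1 = (c, 1) :> dart D by exact: turn_eq.
have t2 : turn (c, 0) 2 = (c, 2) :> dart D by exact: turn_eq.
have t3 : turn (c, 1) 2 = (c, 3) :> dart D by exact: turn_eq.
by rewrite -t1 -t2 -t3 !black_turn2 -t1 !black_turn1.
Qed.

Definition bc c : dart D := black_corner black c.

Lemma bc_black c : bc c \in black.
Proof.
rewrite /bc /black_corner /edge_sign; case: ifP => // h.
by have [-> _ _] := black_ends c; rewrite h.
Qed.

Lemma bc_crossing c : (bc c).1 = c.
Proof. by []. Qed.

Lemma black_bc x : x \in black -> x = bc x.1 \/ x = turn (bc x.1) 2.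
Proof.
case: x => c i /=; have := bc_black c.
have [b1 b2 b3] := black_ends c.
have t0 : turn (c, 0) 2 = (c, 2) :> dart D by exact: turn_eq.
have t1 : turn (c, 1) 2 = (c, 3) :> dart D by exact: turn_eq.
rewrite /bc /black_corner /edge_sign => _; move: i; apply: I4_cases;
  rewrite ?b1 ?b2 ?b3; case: ifP => h // _; rewrite ?t0 ?t1; by [left|right].
Qed.

Definition black_flank d := if d \in black then d else turn d (- 1).
Definition white_flank d := if d \in black then turn d (- 1) else d.

Lemma black_flank_black d : black_flank d \in black.
Proof. by rewrite /black_flank; case: ifP => // /negbT; rewrite black_turnN1. Qed.

Lemma black_flank_crossing d : (black_flank d).1 = d.1.
Proof. by rewrite /black_flank; case: ifP. Qed.

Lemma black_flank_id x : x \in black -> black_flank x = x.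
Proof. by rewrite /black_flank => ->. Qed.

Lemma black_flank_turn1 x : x \in black -> black_flank (turn x 1) = x.
Proof. by move=> xb; rewrite /black_flank black_turn1 xb turnK. Qed.

Lemma black_flank_fiber d x : black_flank d = x -> d = x \/ d = turn x 1.
Proof. by rewrite /black_flank; case: ifP => _ <-; [left|right; rewrite turnNK]. Qed.

Lemma corner_black_flank d l : corner d l \in black -> corner d l = black_flank d.
Proof.
case: l; rewrite /black_flank /=; first by move->.
by rewrite black_turnN1 => /negPf->.
Qed.

Lemma corner_white_flank d l : corner d l \notin black -> corner d l = white_flank d.
Proof.
case: l; rewrite /white_flank /=; first by move/negPf->.
by rewrite black_turnN1 negbK => ->.
Qed.

Lemma flag_black d l : (corner (arc d) (l (+) ~~ wraps d) \in black) =
  (corner d l \in black).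
Proof. exact/esym/black_adj/(region_adj_flag (d, l)). Qed.

Lemma black_flank_flag d : exists l, black_flank d = corner d l /\
  black_flank (arc d) = corner (arc d) (l (+) ~~ wraps d).
Proof.
have [l bl] : exists l, corner d l \in black.
  by have [h|h] := boolP (d \in black); [exists true|exists false;
    rewrite /= black_turnN1].
exists l; rewrite corner_black_flank //; split=> //.
by rewrite corner_black_flank // flag_black.
Qed.

Lemma white_flank_flag d : exists l, white_flank d = corner d l /\
  white_flank (arc d) = corner (arc d) (l (+) ~~ wraps d).
Proof.
have [l bl] : exists l, corner d l \notin black.
  have [h|h] := boolP (d \in black); [exists false|exists true] => //=.
  by rewrite black_turnN1 negbK.
exists l; rewrite corner_white_flank //; split=> //.
by rewrite corner_white_flank // flag_black.
Qed.

Lemma black_flank_adj d : region_adj (black_flank d) (black_flank (arc d)).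
Proof. by have [l [-> ->]] := black_flank_flag d; exact: (region_adj_flag (d, l)). Qed.

Lemma white_flank_adj d : region_adj (white_flank d) (white_flank (arc d)).
Proof. by have [l [-> ->]] := white_flank_flag d; exact: (region_adj_flag (d, l)). Qed.

Lemma black_adjP x y : x \in black -> region_adj x y ->
  exists d, x = black_flank d /\ y = black_flank (arc d).
Proof.
move=> xb /region_adjP[[d l] [xE yE]]; exists d.
rewrite xE yE; rewrite xE in xb; split; first exact: corner_black_flank.
by apply: corner_black_flank; rewrite flag_black.
Qed.

(* The edges of the Tait graph of [black] at which the smoothing v joins the  *)
(* two black corners.                                                         *)
Definition joins v : {set crossing D} := [set c | (c \in v) (+) sgn c].

(** The black side of a strand stays at one black corner, or passes to the opposite one if the
    smoothing joins them. *)
Lemma smoothing_black_flank v d : black_flank (smoothing v d) =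
  if d.1 \in joins v then turn (black_flank d) 2 else black_flank d.
Proof.
case: d => c i; rewrite inE /= /smoothing /=.
have [b1 b2 b3] := black_ends c.
have e10 : (1 - 0 : 'I_4) = 1 by exact: val_inj.
have e11 : (1 - 1 : 'I_4) = 0 by exact: val_inj.
have e12 : (1 - 2 : 'I_4) = 3 by exact: val_inj.
have e13 : (1 - 3 : 'I_4) = 2 by exact: val_inj.
have f0 : (- 1 - 0 : 'I_4) = 3 by exact: val_inj.
have f1 : (- 1 - 1 : 'I_4) = 2 by exact: val_inj.
have f2 : (- 1 - 2 : 'I_4) = 1 by exact: val_inj.
have f3 : (- 1 - 3 : 'I_4) = 0 by exact: val_inj.
rewrite /edge_sign; case: (c \in v); move: i; apply: I4_cases;
  rewrite ?e10 ?e11 ?e12 ?e13 ?f0 ?f1 ?f2 ?f3 /black_flank ?b1 ?b2 ?b3;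
  case: ((c, 0) \in black) => //=; rewrite /turn; apply: (congr1 (pair c)); exact: val_inj.
Qed.

End Coloring.

(** * Potentials and the intersection pairing of the two Tait graphs *)

Section Potentials.
Variables (D : rotation_system) (o : orientation D) (q : dart D -> bool).
Implicit Types (d x y : dart D) (c e : crossing D) (R : {set dart D}).
Implicit Types (black H K : {set crossing D}) (z : crossing D -> F2).
Hypothesis qP : forall d l,
  q (corner (arc d) (l (+) ~~ wraps d)) = q (corner d l) (+) wraps d.
Hypothesis cocycle : forall y : dart D -> F2,
  (forall R, R \in regions D ->
     \sum_d y d * ((corner d true \in R)%:R + (corner d false \in R)%:R) = 0) ->
  exists (g : crossing D -> F2) (t : F2), forall d,
    y d + y (arc d) = g d.1 + g (arc d).1 + t * (wraps d)%:R.
Hypothesis nonlocal : ~ local_diagram D.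

Let Q x : F2 := (q x)%:R.

Lemma F2_addb (a b : bool) : (a (+) b)%:R = a%:R + b%:R :> F2.
Proof. by case: a; case: b; apply/eqP. Qed.

Lemma Q_step t x y : region_step t x y -> Q x + Q y = t%:R.
Proof.
case/existsP => d /existsP[l /and3P[/eqP <- /eqP-> /eqP->]].
by rewrite /Q qP F2_addb addrA F2_char2 add0r.
Qed.

Lemma region_step_adj t x y : region_step t x y -> region x = region y.
Proof.
move=> xy; apply/eqP; rewrite region_eq connect1 //.
by apply/existsP; exists t.
Qed.

Section Color.
Variable B : {set dart D}.
Hypothesis check : @checkerboard D B.
Local Notation bcB := (bc B).

Definition bsum (F : dart D -> F2) c := F (bcB c) + F (turn (bcB c) 2).
(* As q is a potential of [wraps] on each region, the sum of [wrap_sum] over  *)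
(* a cycle of the Tait graph is its class in H_1(RP^2).                       *)
Definition wrap_sum := bsum Q.
Definition coboundary (phi : {set dart D} -> F2) := bsum (fun x => phi (region x)).
(** The cohomological form of having no essential cycle: on H the class of [wraps] is a
    coboundary. *)
Definition potential H := exists phi, forall c, c \in H -> wrap_sum c = coboundary phi c.

Lemma bsum_at F x : x \in B -> F x + F (turn x 2) = bsum F x.1.
Proof.
by move=> /(black_bc check)[->|->]; rewrite /bsum ?turn22 ?bc_crossing // addrC.
Qed.

Lemma bsumD F G c : bsum (fun x => F x + G x) c = bsum F c + bsum G c.
Proof. by rewrite /bsum addrACA. Qed.

Lemma coboundaryD phi psi c : coboundary (fun R => phi R + psi R) c = coboundary phi c + coboundary psi c.
Proof. exact: bsumD. Qed.

Lemma coboundaryZ t phi c : coboundary (fun R => t * phi R) c = t * coboundary phi c.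
Proof. by rewrite /coboundary /bsum mulrDr. Qed.

Lemma lift_const (F : dart D -> F2) :
  (forall x y, x \in B -> region_adj x y -> F x = F y) ->
  exists phi : {set dart D} -> F2, forall x, x \in B -> phi (region x) = F x.
Proof.
move=> FE; exists (fun R => if [pick x in R] is Some x then F x else 0) => x xB.
case: pickP => [y|/(_ x)]; last by rewrite /= mem_region connect0.
rewrite mem_region => xy; symmetry.
suff [] : y \in B /\ F x = F y by [].
apply: (connect_ind (P := fun y => y \in B /\ F x = F y) _ _ xy) => //.
by move=> a b [aB ->] ab; rewrite -(black_adj check ab) aB (FE _ _ aB ab).
Qed.

(** The witness z counts modulo 2 the passages of the walk over each edge of the Tait graph. *)
Lemma walk_lift H x a y b : x \in B ->
  connect (lifted_step H) (x, a) (y, b) ->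
  exists z, [/\ forall c, c \notin H -> z c = 0,
    forall phi, phi (region x) + phi (region y) = \sum_c z c * coboundary phi c
  & a%:R + b%:R = Q x + Q y + \sum_c z c * wrap_sum c].
Proof.
move=> xB xy; pose P (yb : dart D * bool) := yb.1 \in B /\
  exists z, [/\ forall c, c \notin H -> z c = 0,
    forall phi, phi (region x) + phi (region yb.1) = \sum_c z c * coboundary phi c
  & a%:R + yb.2%:R = Q x + Q yb.1 + \sum_c z c * wrap_sum c].
suff [] : P (y, b) by [].
apply: (connect_ind _ _ xy).
  split=> //; exists (fun _ => 0); split=> [//|phi|] /=; rewrite !F2_char2 ?add0r;
    by rewrite big1 // => c _; rewrite mul0r.
move=> {xy} [u s] [u' s'] [/= uB [z [zH zphi zw]]] /orP[st|/and3P[/= ts uH /eqP->]].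
  have adj : region_adj u u' by apply/existsP; exists (s (+) s').
  split; first by rewrite /= -(black_adj check adj).
  exists z; split=> [//|phi|] /=; first by rewrite -(region_step_adj st).
  have := Q_step st; rewrite F2_addb => Qs.
  have -> : s'%:R = s%:R + (Q u + Q u') :> F2 by rewrite Qs addrA F2_char2 add0r.
  rewrite addrA zw -addrA [X in _ + X]addrC addrA; congr (_ + _).
  by rewrite -addrA [Q u + (_ + _)]addrA F2_char2 add0r.
split; first by rewrite /= (black_turn2 check).
exists (fun c => z c + (c == u.1)%:R).
have sumE (F : crossing D -> F2) : \sum_c (z c + (c == u.1)%:R) * F c =
    \sum_c z c * F c + F u.1.
  rewrite -(sum_delta F) -big_split /=; apply: eq_bigr => c _.
  by rewrite mulrDl [_%:R * _]mulrC.
split=> [c cH|phi|] /=.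
- rewrite zH // add0r; case: eqP => // cu; by rewrite cu uH in cH.
- rewrite sumE -zphi -[coboundary phi _](bsum_at (fun x => phi (region x)) uB).
  by rewrite -addrA (addKK F2_char2).
- have -> : s' = s by apply/esym/eqP; rewrite -negb_add.
  rewrite sumE zw -[wrap_sum _](bsum_at Q uB).
  by rewrite -[LHS]addr0 -(F2_char2 (Q (turn u 2))); ring.
Qed.

Lemma curve_step_sym H t : symmetric (@curve_step D H t).
Proof.
move=> x y; rewrite /curve_step region_step_sym; congr (_ || _).
by apply/and3P/and3P => -[-> h /eqP e]; split=> //; rewrite e ?turn22 // in h *.
Qed.

Lemma lifted_sym H : connect_sym (@lifted_step D H).
Proof.
apply: sym_connect_sym => -[x a] [y b].
by rewrite /lifted_step /= curve_step_sym addbC.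
Qed.

Lemma lifted_shift H x a y b : connect (@lifted_step D H) (x, a) (y, b) ->
  connect (@lifted_step D H) (x, ~~ a) (y, ~~ b).
Proof.
move=> xy; apply: (connect_ind (P := fun yb => connect (@lifted_step D H)
  (x, ~~ a) (yb.1, ~~ yb.2)) _ _ xy); first exact: connect0.
move=> [u s] [u' s'] /= h st; apply: connect_trans h (connect1 _).
by move: st; rewrite /lifted_step /= addbN addNb negbK.
Qed.

(** Without essential cycles the double cover defined by [wraps] splits over each component, and a
    choice of sheet is a potential. Conversely a potential makes the sums along closed walks
    vanish. *)
Lemma homology_trivialP H : homology_trivial B H <-> potential H.
Proof.
split=> [|[phi phiE]]; last first.
  apply/forall_inP => x xB; apply/negP => /(walk_lift xB)[z [zH zphi]].
  suff -> : \sum_c z c * wrap_sum c = 0 by rewrite F2_char2 => /eqP.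
  rewrite -[RHS](F2_char2 (phi (region x))) zphi.
  apply: eq_bigr => c _; have [cH|/zH->] := boolP (c \in H).
    by rewrite phiE.
  by rewrite !mul0r.
move=> triv; pose L := connect (@lifted_step D H).
have Ls u w : L u w = L w u by exact: lifted_sym.
have Lt u w t : L u w -> L w t -> L u t by exact: connect_trans.
have Lsh x a y b s : L (x, a) (y, b) -> L (x, a (+) s) (y, b (+) s).
  by case: s; rewrite ?addbT ?addbF //; exact: lifted_shift.
have LB x a y b : x \in B -> L (x, a) (y, b) -> y \in B.
  move=> xB xy; apply: (connect_ind (P := fun yb => yb.1 \in B) _ _ xy) => //.
  move=> [u s] [u' s'] /= uB /orP[st|/and3P[_ _ /eqP/= ->]].
    rewrite -(black_adj check (x := u)) //; apply/existsP.
    by exists (s (+) s').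
  by rewrite black_turn2.
(* [C] is reachability, [r x] a representative of the component of x, and [P x] names the sheet over
   x that is reached from it. *)
pose C x y := [exists t, L (x, false) (y, t)].
pose r x := odflt x [pick y | C x y].
pose P x := L (r x, false) (x, true).
have key x y t : x \in B -> L (x, false) (y, t) -> P y = P x (+) t.
  move=> xB xy; have CE : C x =1 C y.
    move=> u; apply/existsP/existsP => -[s h].
      exists (s (+) t); move: xy; rewrite Ls => /(Lsh _ _ _ _ t).
      by rewrite addbb => yx; apply: Lt yx (Lsh _ _ _ _ t h).
    exists (s (+) t); apply: Lt xy _; exact: (Lsh _ _ _ _ t h).
  have rE : r y = r x.
    rewrite /r (eq_pick CE); case: pickP => [//|/(_ y)].
    by move=> /existsP[]; exists false; exact: connect0.
  have [s0 rs] : exists s, L (x, false) (r x, s).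
    rewrite /r; case: pickP => [u /existsP[s h]|_]; first by exists s.
    by exists false; exact: connect0.
  have rx : L (r x, false) (x, s0).
    by move: rs; rewrite Ls => /(Lsh _ _ _ _ s0); rewrite addbb.
  have rB : r x \in B by exact: LB xB rs.
  have uniq u a : L (r x, false) (u, a) -> L (r x, false) (u, true) = a.
    case: a => // h; apply/negP => h'.
    have := forall_inP triv _ rB; apply/negP; rewrite negbK.
    by apply: Lt h' _; rewrite Ls; exact: (Lsh _ _ _ _ true h).
  rewrite /P rE (uniq _ _ rx); apply: uniq; apply: Lt rx _.
  by have := Lsh _ _ _ _ s0 xy; rewrite addFb addbC.
have [|phi phiE] := @lift_const (fun x => (P x)%:R + Q x).
  move=> x y xB /existsP[t xy].
  have -> : P y = P x (+) t.
    by apply: key => //; apply: connect1; rewrite /lifted_step /= /curve_step xy.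
  rewrite F2_addb -(Q_step xy).
  by rewrite -[LHS]addr0 -(F2_char2 (Q y)); ring.
exists phi => c cH; rewrite /coboundary /bsum !phiE ?black_turn2 ?bc_black //.
have -> : P (turn (bcB c) 2) = P (bcB c) (+) false.
  apply: key; first exact: bc_black.
  apply: connect1; rewrite /lifted_step /= /curve_step /= cH eqxx.
  by rewrite orbT.
by rewrite addbF /wrap_sum /bsum -[LHS]addr0 -(F2_char2 (P (bcB c))%:R); ring.
Qed.

Lemma walk_graph K R S : conn (tait B) K R S ->
  exists z, (forall c, c \notin K -> z c = 0) /\
    forall phi, phi R + phi S = \sum_c z c * coboundary phi c.
Proof.
move=> RS; apply: (connect_ind (P := fun S => exists z,
    (forall c, c \notin K -> z c = 0) /\
    forall phi, phi R + phi S = \sum_c z c * coboundary phi c) _ _ RS).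
  exists (fun _ => 0); split=> // phi; rewrite F2_char2 big1 // => c _.
  by rewrite mul0r.
move=> {RS} {}S S' [z [zK zphi]] /existsP[e /andP[eK eS]].
exists (fun c => z c + (c == e)%:R); split=> [c cK|phi].
  rewrite zK // add0r; case: eqP => // ce; by rewrite ce eK in cK.
have -> : \sum_c (z c + (c == e)%:R) * coboundary phi c = \sum_c z c * coboundary phi c + coboundary phi e.
  rewrite -(sum_delta (coboundary phi)) -big_split /=; apply: eq_bigr => c _.
  by rewrite mulrDl [_%:R * _]mulrC.
rewrite -zphi; have -> : coboundary phi e = phi S + phi S'.
  by case/orP: eS => /eqP[] <- <-; rewrite /coboundary /bsum //= addrC.
by rewrite -addrA (addKK F2_char2).
Qed.

Lemma conn_const K phi R S : conn (tait B) K R S ->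
  (forall c, c \in K -> coboundary phi c = 0) -> phi R = phi S.
Proof.
move=> /walk_graph[z [zK zphi]] h; apply: F2_add_eq0; rewrite zphi big1 // => c _.
have [/h->|/zK->] := boolP (c \in K); [exact: mulr0|exact: mul0r].
Qed.

Lemma joined_const K phi e : joined (tait B) K e ->
  (forall c, c \in K -> coboundary phi c = 0) -> coboundary phi e = 0.
Proof.
move=> je h; have := conn_const je h; rewrite /= -/(bcB e) /coboundary /bsum => ->.
exact: F2_char2.
Qed.

Lemma sum_darts (F : dart D -> F2) : \sum_d F d =
  \sum_c (F (bcB c) + F (turn (bcB c) 1) + F (turn (bcB c) 2) + F (turn (bcB c) (- 1))).
Proof.
transitivity (\sum_c \sum_(i < 4) F (c, i)).
  by rewrite pair_bigA; apply: eq_bigr => -[].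
apply: eq_bigr => c _.
rewrite (reindex_inj (addrI (bcB c).2)) /=.
have I4 (G : 'I_4 -> F2) : \sum_i G i = G 0 + G 1 + G 2 + G (- 1).
  rewrite !big_ord_recl big_ord0 addr0 !addrA.
  by congr (_ + _ + _ + _); congr G; exact: val_inj.
rewrite I4; congr (_ + _ + _ + _); congr F.
by rewrite addr0.
Qed.

End Color.

Section TwoColors.
Variable B : {set dart D}.
Hypothesis check : @checkerboard D B.
Let W := ~: B.
Let checkW : @checkerboard D W := checkerboardC check.

Lemma turn3 x : turn x 3 = turn x (- 1).
Proof. by congr (turn x _); exact: val_inj. Qed.

Lemma bsumC F c : bsum W F c = F (turn (bc B c) 1) + F (turn (bc B c) (- 1)).
Proof.
have t1 : turn (c, 0) 1 = (c, 1) :> dart D by exact: turn_eq.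
have t2 : turn (c, 0) (- 1) = (c, 3) :> dart D by exact: turn_eq.
have t3 : turn (c, 1) 1 = (c, 2) :> dart D by exact: turn_eq.
have t4 : turn (c, 1) (- 1) = (c, 0) :> dart D by exact: turn_eq.
have t5 : turn (c, 0) 2 = (c, 2) :> dart D by exact: turn_eq.
have t6 : turn (c, 1) 2 = (c, 3) :> dart D by exact: turn_eq.
rewrite /bsum /bc /black_corner /edge_sign in_setC.
case: ((c, 0) \in B) => /=; rewrite ?t1 ?t2 ?t3 ?t4 ?t5 ?t6 // addrC.
by [].
Qed.

(** Each of the four ends at a crossing lies between a black and a white corner, and all four pairs
    of such corners occur. *)
Lemma pairing (F G : dart D -> F2) :
  \sum_c bsum B F c * bsum W G c = \sum_d F (black_flank B d) * G (white_flank B d).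
Proof.
rewrite (sum_darts B); apply: eq_bigr => c _; rewrite bsumC /bsum.
set x := bc B c; have xB : x \in B by exact: bc_black.
have x2B : turn x 2 \in B by rewrite black_turn2.
have e3 : turn x (- 1) = turn (turn x 2) 1.
  by rewrite turn_turn -turn3; congr (turn x _); exact: val_inj.
have e1 : turn x 1 = turn (turn x 2) (- 1).
  by rewrite turn_turn; congr (turn x _); exact: val_inj.
have -> : black_flank B x = x by exact: black_flank_id.
have -> : black_flank B (turn x 2) = turn x 2 by exact: black_flank_id.
have -> : black_flank B (turn x 1) = x by exact: black_flank_turn1.
have -> : black_flank B (turn x (- 1)) = turn x 2 by rewrite e3; exact: black_flank_turn1.
have wN y : y \in B -> white_flank B y = turn y (- 1) by rewrite /white_flank => ->.
have w1 y : y \in B -> white_flank B (turn y 1) = turn y 1.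
  by move=> yB; rewrite /white_flank (black_turn1 check) yB.
have -> : white_flank B (turn x (- 1)) = turn x (- 1) by rewrite e3; exact: w1.
rewrite (wN x xB) (wN _ x2B) (w1 x xB) -e1.
by ring.
Qed.

(* The Tait graphs of the two colors are dual to each other: a boundary of    *)
(* one is a cycle of the other.                                               *)
Lemma orth_coboundary phi psi : \sum_c coboundary B phi c * coboundary W psi c = 0.
Proof.
rewrite (pairing (fun x => phi (region x)) (fun x => psi (region x))) -(sum_arcs o).
apply: big1 => a _; rewrite -(F2_char2 (phi (region (black_flank B (val a))) *
  psi (region (white_flank B (val a))))); congr (_ + _ * _); congr (_ _);
  apply/eqP; rewrite region_eq connect1 // region_adj_sym.
- exact: black_flank_adj.
- exact: white_flank_adj.
Qed.

Lemma orth_wrap psi : \sum_c wrap_sum B c * coboundary W psi c = 0.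
Proof.
pose P x := psi (region x).
transitivity (\sum_d Q (black_flank B d) * P (white_flank B d)); first exact: (pairing Q P).
(* Adding this vanishing sum replaces the potential on the black side by the sum over both sides,
   which takes the same value at the two ends of an arc. *)
have z : \sum_d Q (white_flank B d) * P (white_flank B d) = 0.
  have := pairing (fun _ => 1) (fun x => Q x * P x).
  under [X in _ = X -> _]eq_bigr => d _ do rewrite mul1r.
  by move=> <-; apply: big1 => c _; rewrite /bsum F2_char2 mul0r.
transitivity (\sum_d (Q (black_flank B d) * P (white_flank B d) + Q (white_flank B d) * P (white_flank B d))).
  by rewrite big_split /= z addr0.
rewrite -(sum_arcs o); apply: big1 => a _.
have Pw : P (white_flank B (arc (val a))) = P (white_flank B (val a)).
  congr psi; apply/eqP; rewrite region_eq connect1 // region_adj_sym.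
  exact: white_flank_adj.
have Qb : Q (black_flank B (arc (val a))) = Q (black_flank B (val a)) + (wraps (val a))%:R.
  have [l [-> ->]] := black_flank_flag check (val a); by rewrite /Q qP F2_addb.
have Qw : Q (white_flank B (arc (val a))) = Q (white_flank B (val a)) + (wraps (val a))%:R.
  have [l [-> ->]] := white_flank_flag check (val a); by rewrite /Q qP F2_addb.
rewrite Pw Qb Qw -[RHS](F2_char2 ((Q (black_flank B (val a)) + Q (white_flank B (val a)) +
  (wraps (val a))%:R) * P (white_flank B (val a)))).
by ring.
Qed.

(** Transfers [cocycle] from the arcs of the diagram to the edges of the Tait graph. *)
Lemma tait_cocycle z : (forall psi, \sum_c z c * coboundary W psi c = 0) ->
  exists phi (t : F2), forall c, z c = coboundary B phi c + t * wrap_sum B c.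
Proof.
(* The value at c is placed on one of its two black corners, so that [bsum] recovers it. *)
move=> hz; pose zh (x : dart D) : F2 := if x == bc B x.1 then z x.1 else 0.
have zh2 c : bsum B zh c = z c.
  rewrite /bsum /zh /= eqxx; have -> : (turn (bc B c) 2 == bc B c) = false.
    by rewrite /turn /bc /black_corner xpair_eqE eqxx /=; case: ifP.
  by rewrite addr0.
have [R RD|g [t gt]] := cocycle (y := fun d => zh (black_flank B d)).
  pose I x : F2 := (x \in R)%:R.
  transitivity (\sum_d (zh (black_flank B d) * I (black_flank B d)) * 1 +
                \sum_d zh (black_flank B d) * I (white_flank B d)).
    rewrite -big_split /=; apply: eq_bigr => d _; rewrite mulr1 -mulrDr.
    congr (_ * _); rewrite /I /black_flank /white_flank; case: ifP => // _; exact: addrC.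
  rewrite -(pairing (fun x => zh x * I x) (fun _ => 1)) -(pairing zh I).
  rewrite big1 ?add0r => [|c _]; last by rewrite /bsum F2_char2 mulr0.
  rewrite -[RHS](hz (fun S => (S == R)%:R)); apply: eq_bigr => c _.
  rewrite zh2 /coboundary /bsum /I; congr (_ * (_%:R + _%:R)); congr nat_of_bool;
    by apply/idP/eqP => [/(region_of RD)->//|<-]; rewrite mem_region connect0.
(* This function agrees at both ends of an arc, hence is constant on black regions; the term g
   cancels between the two black corners of a crossing. *)
have [|phi phiE] := @lift_const B check (fun x => zh x + g x.1 + t * Q x).
  move=> x y xB /(black_adjP check xB)[d [-> ->]].
  apply: F2_add_eq0; have := gt d.
  rewrite -(black_flank_crossing B d) -(black_flank_crossing B (arc d)).
  have Qb : Q (black_flank B (arc d)) = Q (black_flank B d) + (wraps d)%:R.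
    have [l [-> ->]] := black_flank_flag check d; by rewrite /Q qP F2_addb.
  move=> e; have -> : zh (black_flank B (arc d)) = zh (black_flank B d) +
      (g (black_flank B d).1 + g (black_flank B (arc d)).1 + t * (wraps d)%:R).
    by rewrite -e addrA F2_char2 add0r.
  rewrite Qb -(F2_char2 (zh (black_flank B d) + g (black_flank B d).1 + g (black_flank B (arc d)).1 +
    t * (wraps d)%:R + t * Q (black_flank B d))).
  by ring.
exists phi, t => c; rewrite -{1}zh2 /coboundary /wrap_sum /bsum.
rewrite !phiE ?black_turn2 ?bc_black //.
rewrite /= -[LHS]addr0 -(F2_char2 (g c)) -[LHS]addr0.
rewrite -(F2_char2 (t * (Q (bc B c) + Q (turn (bc B c) 2)))).
by ring.
Qed.

Lemma wrap_sum_not_coboundary : ~ exists phi, forall c, wrap_sum B c = coboundary B phi c.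
Proof.
case=> phi phiE; apply: nonlocal.
pose P x := Q x + phi (region x).
have P2 x : x \in B -> P x = P (bc B x.1).
  move=> xB; case: (black_bc check xB) => [<-//|->].
  apply: F2_add_eq0; have := phiE x.1; rewrite /wrap_sum /coboundary /bsum /P.
  rewrite -[bc B (turn (bc B x.1) 2).1]/(bc B x.1); set y := bc B x.1 => e.
  by rewrite addrACA [Q _ + Q _]addrC e [phi _ + _]addrC F2_char2.
exists (fun c => P (bc B c) != 0) => d.
have : (wraps d)%:R = P (black_flank B d) + P (black_flank B (arc d)).
  have Qb : Q (black_flank B (arc d)) = Q (black_flank B d) + (wraps d)%:R.
    have [l [-> ->]] := black_flank_flag check d; by rewrite /Q qP F2_addb.
  have R : region (black_flank B d) = region (black_flank B (arc d)).
    by apply/eqP; rewrite region_eq connect1 // black_flank_adj.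
  rewrite /P Qb -R -[LHS]addr0 -(F2_char2 (Q (black_flank B d) + phi (region (black_flank B d)))).
  by ring.
rewrite (P2 (black_flank B d)) ?black_flank_black // (P2 (black_flank B (arc d))) ?black_flank_black //.
rewrite !black_flank_crossing.
have [->|/F2_neq0->] := eqVneq (P (bc B d.1)) 0;
  have [->|/F2_neq0->] := eqVneq (P (bc B (arc d).1)) 0;
  by case: (wraps d) => // /eqP.
Qed.

End TwoColors.

Lemma potential_mono B H K : H \subset K -> potential B K -> potential B H.
Proof. by move=> /subsetP HK [phi h]; exists phi => c /HK/h. Qed.

Section Duality.
Variable B : {set dart D}.
Hypothesis check : @checkerboard D B.
Let W := ~: B.
Let checkW : @checkerboard D W := checkerboardC check.

(** The essential class of RP^2 meets itself once. Otherwise [wrap_sum B] would be orthogonal to all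
    cycles of its graph, which are spanned by [wrap_sum W] and the coboundaries of the other color,
    and so be a coboundary. *)
Lemma wrap_sum_pairing : \sum_c wrap_sum B c * wrap_sum W c != 0.
Proof.
apply/eqP => z0; apply: (wrap_sum_not_coboundary check).
pose f (R : {set dart D}) c : F2 :=
  (region (bc B c) == R)%:R + (region (turn (bc B c) 2) == R)%:R.
have coboundaryE phi c : \sum_R phi R * f R c = coboundary B phi c.
  under eq_bigr => R _ do rewrite mulrDr.
  rewrite big_split /= /coboundary /bsum; congr (_ + _);
    [set r := region (bc B c)|set r := region _];
    by rewrite (bigD1 r) //= eqxx mulr1 big1 ?addr0 // => R;
      rewrite eq_sym => /negPf->; rewrite mulr0.
have [|b bE] := @double_orthogonal _ _ f (wrap_sum B); last first.
  by exists b => c; rewrite bE coboundaryE.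
move=> z hz; have [|phi [t zE]] := tait_cocycle checkW (z := z).
  move=> psi; rewrite setCK.
  transitivity (\sum_R psi R * \sum_c f R c * z c); last first.
    by rewrite big1 // => R _; rewrite hz mulr0.
  under [RHS]eq_bigr => R _ do rewrite mulr_sumr.
  rewrite exchange_big /=; apply: eq_bigr => c _; rewrite -coboundaryE mulr_sumr.
  by apply: eq_bigr => R _; rewrite mulrCA [z c * _]mulrC.
transitivity (\sum_c (wrap_sum B c * coboundary W phi c + t * (wrap_sum B c * wrap_sum W c))).
  by apply: eq_bigr => c _; rewrite zE mulrDr [wrap_sum B c * (t * _)]mulrCA.
by rewrite big_split /= -mulr_sumr z0 mulr0 addr0; exact: orth_wrap.
Qed.

Lemma orth_wrapC phi : \sum_c wrap_sum W c * coboundary B phi c = 0.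
Proof. by have := orth_wrap checkW phi; rewrite setCK. Qed.

(** With both potentials, at each crossing one of the two corrected cochains would be 0, and their
    pairing would vanish; but corrections by coboundaries do not change the pairing of the two
    [wrap_sum]. *)
Lemma potential_exclusive H : potential B H -> ~ potential W (~: H).
Proof.
move=> [phi hp] [psi hq]; case/eqP: wrap_sum_pairing.
transitivity (\sum_c (wrap_sum B c + coboundary B phi c) * (wrap_sum W c + coboundary W psi c) -
  \sum_c wrap_sum B c * coboundary W psi c - \sum_c wrap_sum W c * coboundary B phi c -
  \sum_c coboundary B phi c * coboundary W psi c).
  by rewrite -!sumrB; apply: eq_bigr => c _; ring.
rewrite orth_coboundary // orth_wrap // orth_wrapC !subr0; apply: big1 => c _.
have [cH|cH] := boolP (c \in H); first by rewrite hp // F2_char2 mul0r.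
by rewrite (hq c) ?inE // F2_char2 mulr0.
Qed.

Lemma tait_cocycleC z : (forall phi, \sum_c z c * coboundary B phi c = 0) ->
  exists psi (t : F2), forall c, z c = coboundary W psi c + t * wrap_sum W c.
Proof. by move=> hz; apply: (tait_cocycle checkW) => phi; rewrite setCK. Qed.

(** An essential closed curve in H is a cycle z, by duality [wrap_sum W] plus a coboundary. As z is
    0 off H, this coboundary gives a potential there. *)
Lemma essential_dual H : ~~ homology_trivial B H -> homology_trivial W (~: H).
Proof.
rewrite negb_forall_in => /exists_inP[x xB]; rewrite negbK => /(walk_lift check xB).
case=> z [zH zphi zw].
have [|psi [t zE]] := tait_cocycleC (z := z).
  by move=> phi; rewrite -zphi F2_char2.
have t1 : t = 1.
  have [t0|/F2_neq0 //] := eqVneq t 0; move: zw; rewrite F2_char2 !add0r.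
  move=> e; suff : (true%:R : F2) = 0 by move/eqP.
  rewrite e -[RHS](orth_wrap check psi); apply: eq_bigr => c _.
  by rewrite zE t0 mul0r addr0 mulrC.
apply/(homology_trivialP checkW); exists psi => c; rewrite inE => /zH.
by rewrite zE t1 mul1r addrC => /F2_add_eq0.
Qed.

Lemma homology_dual H : homology_trivial W (~: H) = ~~ homology_trivial B H.
Proof.
apply/idP/idP => [/(homology_trivialP checkW) h|]; last exact: essential_dual.
by apply/negP => /(homology_trivialP check) /potential_exclusive.
Qed.

(* A null-homologous cycle separates the projective plane. *)
Lemma separation H c : homology_trivial B (c |: H) -> c \notin H ->
  joined (tait B) H c -> ~~ joined (tait W) (~: (c |: H)) c.
Proof.
move=> /(homology_trivialP check)[phi0 phi0E] cH /walk_graph[z [zH zphi]].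
have z'E (F : crossing D -> F2) :
    \sum_e (z e + (e == c)%:R) * F e = \sum_e z e * F e + F c.
  rewrite -[F c in RHS]sum_delta -big_split /=; apply: eq_bigr => e _.
  by rewrite mulrDl [_%:R * _]mulrC.
have dphi phi : \sum_e (z e + (e == c)%:R) * coboundary B phi e = 0.
  by rewrite z'E -zphi; exact: F2_char2.
have [psi [t zE]] := tait_cocycleC dphi.
(* The cycle lies in [c |: H], where [wrap_sum B] is a coboundary, so it pairs to 0 with
   [wrap_sum B]; this isolates t times a nonzero pairing. *)
have t0 : t = 0.
  have : t * \sum_e wrap_sum B e * wrap_sum W e = 0.
    rewrite -[RHS](dphi phi0).
    transitivity (t * (\sum_e wrap_sum B e * wrap_sum W e) + \sum_e wrap_sum B e * coboundary W psi e).
      by rewrite orth_wrap // addr0.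
    rewrite mulr_sumr -big_split /=; apply: eq_bigr => e _; rewrite zE.
    have [eH|eH] := boolP (e \in c |: H); first by rewrite -phi0E //; ring.
    have : z e + (e == c)%:R = 0.
      move: eH; rewrite in_setU1 negb_or => /andP[/negPf-> /zH->].
      by rewrite add0r.
    rewrite zE => h; transitivity (wrap_sum B e * (coboundary W psi e + t * wrap_sum W e)); first ring.
    by rewrite h mulr0 mul0r.
  by move/eqP; rewrite mulf_eq0 (negPf wrap_sum_pairing) orbF => /eqP.
(* The cycle is now the white coboundary of psi: psi does not change along white edges outside
   [c |: H], but jumps across c. *)
apply/negP => jc; have h := joined_const (phi := psi) jc.
suff : (1 : F2) = 0 by move/eqP.
transitivity (coboundary W psi c).
  have := zE c; rewrite t0 mul0r addr0 => <-; by rewrite zH // add0r eqxx.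
apply: h => e; rewrite inE => eH; have := zE e; rewrite t0 mul0r addr0 => <-.
move: eH; rewrite in_setU1 negb_or => /andP[/negPf-> /zH->].
exact: addr0.
Qed.

(** A bridge closes no cycle, so the potential can be shifted on the component at one of its
    ends. *)
Lemma potential_add H c : potential B H -> ~~ joined (tait B) H c -> potential B (c |: H).
Proof.
move=> [phi phiE] nj; pose chi S : F2 := (conn (tait B) H (region (bc B c)) S)%:R.
exists (fun R => phi R + (wrap_sum B c + coboundary B phi c) * chi R) => e.
rewrite in_setU1 coboundaryD coboundaryZ => /predU1P[->|eH].
  have -> : coboundary B chi c = 1.
    by rewrite /coboundary /bsum /chi conn_refl [conn _ _ _ _](negPf nj) addr0.
  by rewrite mulr1 addrCA F2_char2 addr0.
rewrite -phiE //; have -> : coboundary B chi e = 0; last by rewrite mulr0 addr0.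
have je := joined_in (tait B) eH; rewrite /joined /= in je.
rewrite /coboundary /bsum /chi; set a := conn _ _ _ _; set b := conn _ _ _ _.
suff -> : a = b by rewrite F2_char2.
apply/idP/idP => h; apply: conn_trans h _; first exact: je.
by rewrite conn_sym; exact: je.
Qed.

Lemma tait_ends e : (ends (tait B) e).1 \in vertices (tait B) /\
  (ends (tait B) e).2 \in vertices (tait B).
Proof.
by split; apply: imset_f; rewrite ?(black_turn2 check); exact: bc_black.
Qed.

Lemma forest_potential T H : spanning_tree (tait B) T -> H \subset T -> potential B H.
Proof.
move=> tT; elim: {H}#|H| {-2}H (erefl #|H|) => [|n IH] H Hn HT.
  by exists (fun _ => 0) => c; rewrite (cards0_eq Hn) inE.
have [e eH] : exists e, e \in H by apply/set0Pn; rewrite -card_gt0 Hn.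
rewrite -(setD1K eH); apply: potential_add.
  apply: IH; first by move: Hn; rewrite (cardsD1 e) eH => -[].
  exact: subset_trans (subsetDl _ _) HT.
apply: contra (tree_acyclic tT (subsetP HT e eH)); apply: joined_mono.
by rewrite setSD.
Qed.

(** Fundamental cycles suffice: along the tree path of such a cycle, the potential of the tree and
    that of the cycle differ by a constant. *)
Lemma tree_homology T H : spanning_tree (tait B) T ->
  (forall e, e \in H -> e \notin T -> homology_trivial B (Cyc (tait B) T e)) ->
  homology_trivial B H.
Proof.
move=> tT h; apply/(homology_trivialP check).
have [phi phiE] := forest_potential tT (subxx T); exists phi => e eH.
have [/phiE//|eT] := boolP (e \in T).
have /(homology_trivialP check)[psi psiE] := h e eH eT.
rewrite psiE; last exact: (Cyc_self tT tait_ends).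
apply: F2_add_eq0; rewrite -coboundaryD.
apply: joined_const (Cyc_joined tT tait_ends eT) _ => c; rewrite in_setD1.
case/andP=> ce cC; rewrite coboundaryD -psiE // -phiE ?F2_char2 //.
by have := subsetP (Cyc_sub _ _ _) c cC; rewrite in_setU1 (negPf ce).
Qed.

Lemma joinsC v : joins W v = ~: joins B v.
Proof. by apply/setP => c; rewrite !inE /edge_sign in_setC addbN. Qed.

Lemma joinsK v : joins B (joins B v) = v.
Proof. by apply/setP => c; rewrite !inE addbK. Qed.

Lemma same_conn v d d' : same v d d' ->
  conn (tait B) (joins B v) (region (black_flank B d)) (region (black_flank B d')).
Proof.
apply: (connect_ind (P := fun d' =>
  conn (tait B) (joins B v) (region (black_flank B d)) (region (black_flank B d')))).
  exact: conn_refl.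
move=> x y dx; case/orP=> /eqP->.
  suff <- : region (black_flank B x) = region (black_flank B (arc x)) by [].
  by apply/eqP; rewrite region_eq connect1 // black_flank_adj.
rewrite (smoothing_black_flank check); case: ifP => // xH.
apply: conn_trans dx _; have := joined_in (tait B) xH; rewrite /joined /=.
rewrite -/(bc B x.1) => j; have := black_bc check (black_flank_black check x).
rewrite (black_flank_crossing B x); case=> ->; first exact: j.
by rewrite turn22 conn_sym; exact: j.
Qed.

Lemma not_joined_differ v c : ~~ joined (tait B) (joins B v) c -> c \notin joins B v ->
  differ v c.
Proof.
move=> nj cH; apply: contra nj => /same_conn.
have [b1 b2 b3] := black_ends check c.
have -> : black_flank B (c, 2) = turn (black_flank B (c, 0)) 2.
  rewrite /black_flank b2; case: ifP => _; rewrite ?turn_turn /turn /=;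
    by apply: (congr1 (pair c)); exact: val_inj.
have := black_bc check (black_flank_black check (c, 0)); rewrite (black_flank_crossing B).
by case=> ->; rewrite ?turn22 // conn_sym.
Qed.

End Duality.

Section Single.
Variable B : {set dart D}.
Hypothesis check : @checkerboard D B.

(** By [separation] the null-homologous cycle through c keeps the two white corners at c apart,
    while the white side of a circle never leaves a component of the white graph; so the two strands
    lie on different circles. *)
Lemma joined_differ v c : homology_trivial B (joins B v) -> c \in joins B v ->
  joined (tait B) (joins B v :\ c) c -> differ v c.
Proof.
move=> ht cH j; apply: (not_joined_differ (checkerboardC check)).
  rewrite joinsC -(setD1K cH); apply: separation j; rewrite ?setD1K //.
  by rewrite in_setD1 eqxx.
by rewrite joinsC inE cH.
Qed.

Lemma black_flank_third d d' d'' : black_flank B d = black_flank B d' -> black_flank B d'' = black_flank B d' ->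
  d != d' -> d'' != d -> d' = d''.
Proof.
move=> h1 h2; move: (black_flank_fiber h1) (black_flank_fiber h2) (black_flank_fiber (erefl (black_flank B d'))).
by move: (black_flank B d') => x {h1 h2}; case=> -> [] -> [] ->; rewrite ?eqxx.
Qed.

(** A neighborhood of a subtree has one boundary circle: each added edge of the forest merges two
    circles. *)
Lemma tree_same T H x y : spanning_tree (tait B) T -> H \subset T ->
  conn (tait B) H (region (black_flank B x)) (region (black_flank B y)) -> same (joins B H) x y.
Proof.
move=> tT; elim: {H}#|H| {-2}H (erefl #|H|) x y => [|n IH] H Hn x y HT.
  move=> xy; have : region (black_flank B x) = region (black_flank B y).
    apply: (connect_ind (P := fun R => region (black_flank B x) = R) _ _ xy) => //.
    by move=> a b _ /existsP[e]; rewrite (cards0_eq Hn) inE.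
  move/eqP; rewrite region_eq => {}xy.
  have base (e e' : dart D) : black_flank B e = black_flank B e' -> same (joins B H) e e'.
    move=> ee; have [->|ne] := eqVneq e e'; first exact: same_refl.
    rewrite (black_flank_third ee (d'' := smoothing (joins B H) e) _ ne (smoothing_neq _ _)).
      exact: same_smoothing.
    by rewrite (smoothing_black_flank check) joinsK (cards0_eq Hn) inE.
  pose P (z : dart D) := z \in B /\
    forall e : dart D, black_flank B e = z -> same (joins B H) x e.
  have [_] : P (black_flank B y).
    apply: (connect_ind _ _ xy).
      by split=> [|e ee]; [exact: black_flank_black|apply: base; rewrite ee].
    move=> z z' [zB zx] zz'; split; first by rewrite -(black_adj check zz').
    have [d [zd z'd]] := black_adjP check zB zz'; move=> e ez.
    apply: same_trans (zx d (esym zd)) _; apply: same_trans (same_arc _ _) _.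
    by apply: base; rewrite ez z'd.
  by apply.
have [c cH] : exists c, c \in H by apply/set0Pn; rewrite -card_gt0 Hn.
have Hn' : #|H :\ c| = n by move: Hn; rewrite (cardsD1 c) cH => -[].
have sub : H :\ c \subset T by exact: subset_trans (subsetDl _ _) HT.
have vE : joins B H = flip (joins B (H :\ c)) c.
  apply/setP => e; rewrite !inE; have [->|_] := eqVneq e c.
    by rewrite cH addbC.
  by rewrite addbF.
have dif : differ (joins B (H :\ c)) c.
  apply: (not_joined_differ check); rewrite joinsK ?in_setD1 ?eqxx //.
  apply: contra (tree_acyclic tT (subsetP HT c cH)); apply: joined_mono.
  by rewrite setSD.
have at_c (z : dart D) i : same (joins B (H :\ c)) z (c, i) ->
    at_crossing (joins B (H :\ c)) c z.
  rewrite same_sym => zi; have := same_strand (joins B (H :\ c)) c i.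
  by rewrite /at_crossing => /orP[]; rewrite same_sym => /same_trans/(_ zi)->;
    rewrite ?orbT.
have bcE : black_flank B (bc B c) = bc B c by exact: black_flank_id (bc_black check c).
have bcE2 : black_flank B (turn (bc B c) 2) = turn (bc B c) 2.
  by apply: black_flank_id; rewrite black_turn2 // bc_black.
rewrite -{1}(setD1K cH) conn_add vE same_merge //.
case/or3P=> [h|/andP[h1 h2]|/andP[h1 h2]]; first by rewrite (IH _ Hn').
  have a1 : at_crossing (joins B (H :\ c)) c x.
    by apply: at_c; apply: (IH _ Hn' x (bc B c)) => //; rewrite bcE.
  have a2 : at_crossing (joins B (H :\ c)) c y.
    apply: at_c; rewrite same_sym; apply: (IH _ Hn' (turn (bc B c) 2) y) => //.
    by rewrite bcE2.
  by rewrite a1 a2 orbT.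
have a1 : at_crossing (joins B (H :\ c)) c x.
  by apply: at_c; apply: (IH _ Hn' x (turn (bc B c) 2)) => //; rewrite bcE2.
have a2 : at_crossing (joins B (H :\ c)) c y.
  by apply: at_c; rewrite same_sym; apply: (IH _ Hn' (bc B c) y) => //; rewrite bcE.
by rewrite a1 a2 orbT.
Qed.

End Single.
End Potentials.

(** * Trees and vertices of the cube *)

Section Counting.
Local Open Scope nat_scope.

(** Compares vertices of the cube by the largest crossing at which they differ. *)
Definition binary n (A : {set 'I_n}) : nat := \sum_(e in A) 2 ^ e.

Lemma sum_pow2 n (c : 'I_n) : \sum_(e < n | e < c) 2 ^ e < 2 ^ c.
Proof.
rewrite -(big_ord_widen n (fun i => 2 ^ i)) ?(ltnW (ltn_ord c)) //.
by elim: (nat_of_ord c) => [|k IH]; rewrite ?big_ord0 // big_ord_recr /= expnS mul2n -addnn ltn_add2r.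
Qed.

Lemma binary_lt n (A A' : {set 'I_n}) (c : 'I_n) : c \notin A -> c \in A' ->
  (forall e : 'I_n, c < e -> (e \in A) = (e \in A')) -> binary A < binary A'.
Proof.
move=> cA cA' eqA; rewrite /binary.
rewrite (bigID (fun e : 'I_n => c < e)) [ltnRHS](bigID (fun e : 'I_n => c < e)) /=.
have -> : \sum_(e in A | c < e) 2 ^ e = \sum_(e in A' | c < e) 2 ^ e.
  apply: eq_bigl => e; case: (boolP (c < e)); rewrite ?andbF // => /eqA->.
  by [].
rewrite ltn_add2l; apply: leq_trans (_ : 2 ^ c <= _); last first.
  by rewrite (bigD1 c) ?cA' ?ltnn //= leq_addr.
apply: leq_ltn_trans (sum_pow2 c).
rewrite [leqLHS]big_mkcond [leqRHS]big_mkcond /=; apply: leq_sum => e _.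
case: ifP => // /andP[eA]; rewrite -leqNgt leq_eqVlt => /orP[ec|->//].
by case/negP: cA; rewrite (_ : c = e) //; apply/esym/val_inj/eqP.
Qed.

Lemma odd_card_addb (T : finType) (A B : {set T}) :
  odd #|[set x | (x \in A) (+) (x \in B)]| = odd #|A| (+) odd #|B|.
Proof.
have -> : [set x | (x \in A) (+) (x \in B)] = (A :\: B) :|: (B :\: A).
  by apply/setP => x; rewrite !inE; case: (x \in A); case: (x \in B).
rewrite cardsU disjoint_setI0 ?cards0 ?subn0; last first.
  rewrite -setI_eq0; apply/eqP/setP => x; rewrite !inE.
  by case: (x \in A); case: (x \in B).
have := cardsID B A; have := cardsID A B; rewrite setIC => <- <-.
by rewrite !oddD; case: (odd _); case: (odd _); case: (odd _).
Qed.

End Counting.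

Section TaitConnected.
Variables (D : rotation_system) (B : {set dart D}).
Hypothesis conD : connected_diagram D.
Hypothesis check : @checkerboard D B.

Lemma tait_connected u v : u \in vertices (tait B) -> v \in vertices (tait B) ->
  conn (tait B) setT u v.
Proof.
pose Q c c' := forall d d' : dart D, d.1 = c -> d'.1 = c' ->
  conn (tait B) setT (region (black_flank B d)) (region (black_flank B d')).
have Q0 c : conn (tait B) setT (region (bc B c)) (region (turn (bc B c) 2)).
  exact: (joined_in (tait B) (in_setT c)).
have Qc : forall c, Q c c.
  move=> c d d' dc d'c.
  have := black_bc check (black_flank_black check d).
  have := black_bc check (black_flank_black check d').
  rewrite !black_flank_crossing dc d'c; case=> -> [] ->; rewrite ?conn_refl //.
  by rewrite conn_sym.
have all : forall c c', Q c c'.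
  apply: (crossings_const conD Qc) => [a b c ab bc d d' da d'c|d].
    exact: conn_trans (ab d (b, 0) da erefl) (bc (b, 0) d' erefl d'c).
  move=> x y xd ya; apply: conn_trans (Qc _ x d xd erefl) _.
  suff -> : region (black_flank B d) = region (black_flank B (arc d)) by exact: Qc.
  by apply/eqP; rewrite region_eq connect1 // black_flank_adj.
case/imsetP=> x xB -> /imsetP[y yB ->].
by rewrite -(black_flank_id xB) -(black_flank_id yB); exact: (all x.1 y.1).
Qed.

End TaitConnected.

Section Interval.
Variables (D : rotation_system) (o : orientation D) (q : dart D -> bool).
Implicit Types (c e : crossing D) (v T H K : {set crossing D}).
Hypothesis qP : forall d l,
  q (corner (arc d) (l (+) ~~ wraps d)) = q (corner d l) (+) wraps d.
Hypothesis cocycle : forall y : dart D -> F2,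
  (forall R, R \in regions D ->
     \sum_d y d * ((corner d true \in R)%:R + (corner d false \in R)%:R) = 0) ->
  exists (g : crossing D -> F2) (t : F2), forall d,
    y d + y (arc d) = g d.1 + g (arc d).1 + t * (wraps d)%:R.
Hypothesis nonlocal : ~ local_diagram D.
Hypothesis conD : connected_diagram D.
Variable B : {set dart D}.
Hypothesis check : @checkerboard D B.
Local Notation G := (tait B).
Let ends_in := tait_ends check.
Let connG := tait_connected conD check.

Definition active T : {set crossing D} :=
  [set e | int_active B T e || loc_ext_active B T e].

(** Crapo's interval of edge sets attached to T, with external activity restricted to local edges:
    by [toggled_joins], T and [joins B v] may differ only at active edges. *)
Definition interval T v :=
  [forall c, ((c \in v) (+) (c \in joins B T)) ==> (c \in active T)].

Lemma toggled_joins T v c :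
  (c \in v) (+) (c \in joins B T) = (c \in joins B v) (+) (c \in T).
Proof. by rewrite !inE addbA addbAC. Qed.

Lemma interval_in T v c : interval T v -> c \in T -> c \notin joins B v ->
  int_active B T c.
Proof.
move=> /forallP/(_ c) + cT /negPf cH; rewrite toggled_joins cT cH /= inE.
by rewrite /loc_ext_active /ext_active cT orbF.
Qed.

Lemma interval_notin T v c : interval T v -> c \notin T -> c \in joins B v ->
  loc_ext_active B T c.
Proof.
move=> /forallP/(_ c) + cT cH; rewrite toggled_joins cH (negPf cT) /= inE.
by rewrite /int_active (negPf cT).
Qed.

Lemma interval_homology T v : spanning_tree G T -> interval T v ->
  homology_trivial B (joins B v).
Proof.
move=> tT Tv; apply: (tree_homology qP check tT) => e eH eT.
by have /andP[] := interval_notin Tv eT eH.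
Qed.

Lemma interval_fits T v : interval T v -> fits G (joins B v) T.
Proof.
move=> Tv; split=> e h1 h2.
  by have /andP[] := interval_in Tv h1 h2.
by have /andP[/andP[_ ->]] := interval_notin Tv h2 h1.
Qed.

Lemma interval_greedy T v : spanning_tree G T -> interval T v ->
  T = greedy G (joins B v).
Proof. by move=> tT Tv; apply: greedy_unique tT (interval_fits Tv). Qed.

Lemma homology_mono H K : H \subset K -> homology_trivial B K ->
  homology_trivial B H.
Proof.
move=> HK /(homology_trivialP qP check)/(potential_mono HK) h.
exact/(homology_trivialP qP check).
Qed.

Lemma greedy_interval v : homology_trivial B (joins B v) ->
  interval (greedy G (joins B v)) v.
Proof.
move=> ht; apply/forallP => c; rewrite toggled_joins; apply/implyP.
set T := greedy _ _.
have [cH|cH] := boolP (c \in joins B v); have [cT|cT] := boolP (c \in T) => // _.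
  have [small sub] := greedy_Cyc ends_in connG cH cT.
  by rewrite inE /loc_ext_active /ext_active cT small (homology_mono sub) ?orbT.
by rewrite inE /int_active cT (greedy_Cut connG cT cH).
Qed.

(** A toggled external edge closes a null-homologous cycle in [joins B v]; a toggled internal edge
    has its ends unjoined there, since T is the greedy tree. *)
Lemma active_differ T v c : spanning_tree G T -> interval T v -> c \in active T ->
  (c \in v) (+) (c \in joins B T) -> differ v c.
Proof.
move=> tT Tv cA; have TE := interval_greedy tT Tv; have ht := interval_homology tT Tv.
rewrite toggled_joins; have [cH|cH] := boolP (c \in joins B v);
  have [cT|cT] := boolP (c \in T) => // _.
  apply: (joined_differ o qP cocycle nonlocal check ht cH).
  apply: joined_mono (Cyc_joined tT ends_in cT); apply: setSD.
  by move: cT; rewrite TE => cT; have [] := greedy_Cyc ends_in connG cH cT.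
apply: (not_joined_differ check _ cH).
move: cT; rewrite TE inE; apply: contra; apply: joined_mono.
by rewrite /pre (negPf cH) subsetUl.
Qed.

(** By [tree_step] the one-circle vertices agree with v and [flip v c] at c, so there they change
    from A to B, and they agree with each other above c. *)
Lemma interval_step T T' v c : spanning_tree G T -> spanning_tree G T' ->
  interval T v -> interval T' (flip v c) -> c \notin v -> T != T' ->
  (binary (joins B T) < binary (joins B T'))%N.
Proof.
move=> tT tT' Tv T'v cv TT'.
have [|cT cT' _ above] := tree_step (c := c) ends_in tT tT'
  (interval_fits Tv) (interval_fits T'v) _ TT'.
  by move=> f fc; rewrite !inE (negPf fc) addbF.
apply: (binary_lt (c := c)).
- by rewrite inE cT inE -addbA addbb addbF.
- by rewrite inE cT' !inE -addbA addbb addbF eqxx addbT.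
- by move=> e ce; rewrite !inE above.
Qed.

Lemma tree_vertex_same T d d' : spanning_tree G T -> same (joins B T) d d'.
Proof.
move=> tT; apply: (tree_same check tT (subxx T)).
by apply: (tree_conn tT); apply: imset_f; exact: black_flank_black.
Qed.

End Interval.

(** * From the gradings of the cube to those of trees *)

Section Degrees.
Variables (D : rotation_system) (o : orientation D) (B : {set dart D}).
Hypothesis check : @checkerboard D B.
Hypothesis inhabited : inhabited (dart D).
Local Notation G := (tait B).
Local Notation sgn := (edge_sign B).
Implicit Types (T : {set crossing D}) (pm : bool).

Lemma tait_vertices_neq0 : vertices G != set0.
Proof.
have [d] := inhabited; apply/set0Pn; exists (region (black_flank B d)).
by apply: imset_f; exact: black_flank_black.
Qed.

Lemma card_tait_tree T : spanning_tree G T -> #|T|.+1 = #|vertices G|.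
Proof. exact: card_tree (tait_ends check) tait_vertices_neq0 _. Qed.

Local Notation plus_edges T := #|[set e in T | sgn e == true]|.

Lemma card_joins T : (#|joins B T| + 2 * plus_edges T)%N = (#|T| + num_edges B true)%N.
Proof.
pose P : {set crossing D} := [set e | sgn e].
have -> : [set e in T | sgn e == true] = T :&: P.
  by apply/setP => e; rewrite !inE eqb_id.
have -> : joins B T = (T :\: P) :|: (P :\: T).
  by apply/setP => e; rewrite !inE; case: (e \in T); case: (sgn e).
have -> : num_edges B true = #|P| by apply: eq_card => e; rewrite !inE eqb_id.
rewrite cardsU disjoint_setI0 ?cards0 ?subn0; last first.
  rewrite -setI_eq0; apply/eqP/setP => e; rewrite !inE.
  by case: (e \in T); case: (sgn e).
have := cardsID P T; have := cardsID T P; rewrite setIC; lia.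
Qed.

Lemma card_sign_split (Q R : pred (crossing D)) :
  (forall e, Q e -> ~~ R e) ->
  #|[set e | (Q e || R e) && ((Q e) (+) (sgn e))]| =
  (#|[set e | Q e && (sgn e == false)]| + #|[set e | R e && (sgn e == true)]|)%N /\
  #|[set e | (Q e || R e) && ~~ ((Q e) (+) (sgn e))]| =
  (#|[set e | Q e && (sgn e == true)]| + #|[set e | R e && (sgn e == false)]|)%N.
Proof.
move=> QR.
have dis s s' : #|[set e | Q e && (sgn e == s)] :&: [set e | R e && (sgn e == s')]| = 0%N.
  apply/eqP; rewrite cards_eq0; apply/eqP/setP => e; rewrite !inE.
  by have [/QR/negPf->|] := boolP (Q e); rewrite ?andbF.
split; rewrite -[RHS]subn0; [rewrite -(dis false true)|rewrite -(dis true false)];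
  rewrite -cardsU; apply: eq_card => e; rewrite !inE;
  by have [/QR/negPf->|_] := boolP (Q e); case: (sgn e); rewrite /= ?andbF ?orbF ?andbT.
Qed.

Lemma active_cards T :
  #|active B T :&: joins B T| = (num_int B false T + num_loc B true T)%N /\
  #|active B T :\: joins B T| = (num_int B true T + num_loc B false T)%N.
Proof.
have QR e : int_active B T e -> ~~ loc_ext_active B T e.
  by case/andP=> eT _; rewrite /loc_ext_active /ext_active eT.
have [<- <-] := card_sign_split QR; split; apply: eq_card => e; rewrite !inE.
  have [i|ni] := boolP (int_active B T e); first by have /andP[-> _] := i.
  have [l|//] := boolP (loc_ext_active B T e).
  by have /andP[/andP[/negPf-> _] _] := l.
rewrite andbC; have [i|ni] := boolP (int_active B T e).
  by have /andP[-> _] := i.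
have [l|//] := boolP (loc_ext_active B T e).
by have /andP[/andP[/negPf-> _] _] := l.
Qed.

Definition top_vertex T : {set crossing D} :=
  [set c | (c \in joins B T) (+) (c \in active B T)].

Lemma card_top T : (#|top_vertex T| + #|active B T :&: joins B T|)%N =
  (#|joins B T| + #|active B T :\: joins B T|)%N.
Proof.
rewrite /top_vertex; move: (active B T) (joins B T) => A H.
have -> : [set c | (c \in H) (+) (c \in A)] = (A :\: H) :|: (H :\: A).
  by apply/setP => e; rewrite !inE; case: (e \in A); case: (e \in H).
rewrite cardsU disjoint_setI0 ?cards0 ?subn0; last first.
  rewrite -setI_eq0; apply/eqP/setP => e; rewrite !inE.
  by case: (e \in A); case: (e \in H).
have := cardsID A H; rewrite setIC; lia.
Qed.

(** Up to the sign, u is the number of splitting minus the number of merging active crossings, as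
    seen in the direction of the differential. *)
Lemma u_degE pm T : u_deg B pm T =
  pm_sign pm * (#|active B T :\: joins B T|%:Z - #|active B T :&: joins B T|%:Z).
Proof.
have [-> ->] := active_cards T; rewrite /u_deg !PoszD; congr (_ * _).
ring.
Qed.

Lemma v_degE pm T : spanning_tree G T ->
  2 * (pm_sign pm * v_deg B pm T) =
  (num_edges B true)%:Z + pm_sign pm * (#|vertices G|%:Z - 1) - #|joins B T|%:Z.
Proof.
move=> tT; have := card_joins T; have := card_tait_tree tT.
have : (#|[set e in T | sgn e == true]| + #|[set e in T | sgn e == false]|)%N = #|T|.
  rewrite -[RHS](cardsID [set e | sgn e] T); congr (_ + _)%N; apply: eq_card => e;
    by rewrite !inE ?eqb_id ?eqbF_neg // andbC.
rewrite /v_deg /pm_sign; case: pm; lia.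
Qed.

(** The constants built from the writhe and [k_const] turn the degree of a tree into the
    cohomological degree at [top_vertex], where the generator of its subcube lives. *)
Lemma tree_degreeE pm (T : tree G) :
  tree_degree o pm T = (#|top_vertex (val T)|%:Z - (n_minus o)%:Z)%:~R.
Proof.
have := v_degE pm (valP T); have := card_top (val T).
have : (#|[set c | positive_crossing o c]| + n_minus o)%N =
    (num_edges B true + num_edges B false)%N.
  transitivity (ncross D).
    rewrite -[RHS]card_ord -(cardsT (crossing D)).
    rewrite -(cardsID [set c | positive_crossing o c] setT); congr (_ + _)%N;
      by apply: eq_card => c; rewrite !inE ?andbT.
  rewrite -[LHS]card_ord -(cardsT (crossing D)).
  rewrite -(cardsID [set c | sgn c] setT); congr (_ + _)%N;
    by apply: eq_card => c; rewrite !inE ?andbT ?eqb_id ?eqbF_neg.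
rewrite /tree_degree u_degE /writhe /k_const; move: (v_deg B pm (val T)) => v.
set a := #|_ :\: _|; set b := #|_ :&: _|; set h := #|joins _ _|; set t := #|top_vertex _|.
set np := #|[set c | positive_crossing o c]|; set nm := n_minus o.
set V := #|vertices G|; set ep := num_edges B true; set em := num_edges B false.
move=> e1 e2 e3.
have -> : np%:Z - nm%:Z + pm_sign pm * (pm_sign pm * (ep%:Z - em%:Z) +
    2 * (V%:Z - 1)) = 2 * (ep%:Z - nm%:Z + pm_sign pm * (V%:Z - 1)).
  by rewrite /pm_sign in e3 *; case: pm e3 => e3; lia.
have half (x : int) : (2 * x)%:~R / 2 = x%:~R :> rat.
  by rewrite intrM mulrC; exact: mulKf.
rewrite half -intrD; congr _%:~R.
by rewrite /pm_sign in e3 *; case: pm e3 => e3; lia.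
Qed.

(** The difference of splitting and merging active crossings drops by 1, which is the change of u.
    With one more B-smoothing at the top, the one-circle vertex gains two, which changes v by
    one. *)
Lemma bidegreeE pm (T T' : tree G) :
  #|top_vertex (val T')|%:Z = #|top_vertex (val T)|%:Z + 1 ->
  #|active B (val T')|%:Z - 2 * #|active B (val T') :&: joins B (val T')|%:Z =
  #|active B (val T)|%:Z - 2 * #|active B (val T) :&: joins B (val T)|%:Z - 1 ->
  bidegree pm T' = bidegree pm T + (- pm_sign pm, - pm_sign pm).
Proof.
have := v_degE pm (valP T'); have := v_degE pm (valP T).
have := card_top (val T'); have := card_top (val T).
have := cardsID (joins B (val T)) (active B (val T)).
have := cardsID (joins B (val T')) (active B (val T')).
move=> e1 e2 e3 e4 e5 e6 e7 e8.
have eu : u_deg B pm (val T') = u_deg B pm (val T) - pm_sign pm.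
  by rewrite !u_degE /pm_sign; case: (pm); lia.
have ev : v_deg B pm (val T') = v_deg B pm (val T) - pm_sign pm.
  by move: e5 e6; rewrite /pm_sign; case: (pm); lia.
by rewrite /bidegree eu ev.
Qed.

End Degrees.

(** * The spanning tree complex *)

Section TwoTaitGraphs.
Variables (D : rotation_system) (o : orientation D) (p : dart D).
Variable q : dart D -> bool.
Implicit Types (c e : crossing D) (v : {set crossing D}).
Hypothesis planar : in_RP2 D.
Hypothesis conD : connected_diagram D.
Hypothesis nonlocal : ~ local_diagram D.
Hypothesis qP : forall d l,
  q (corner (arc d) (l (+) ~~ wraps d)) = q (corner d l) (+) wraps d.
Variable B : {set dart D}.
Hypothesis check : @checkerboard D B.
Let W := ~: B.
Let checkW : @checkerboard D W := checkerboardC check.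
Let cocycle := @cocycle_arcs D o p planar conD nonlocal.

Definition trees : finType := (tree (tait B) + tree (tait (~: B)))%type.

Definition greedy_of (C : {set dart D}) (cC : @checkerboard D C) v : tree (tait C) :=
  exist _ (greedy (tait C) (joins C v)) (greedy_tree (tait_connected conD cC) (joins C v)).

Definition tree_of v : trees :=
  if homology_trivial B (joins B v) then inl (greedy_of check v)
  else inr (greedy_of checkW v).

Definition vertex_of (T : trees) : {set crossing D} :=
  match T with inl T => joins B (val T) | inr T => joins W (val T) end.

Definition active_of (T : trees) : {set crossing D} :=
  match T with inl T => active B (val T) | inr T => active W (val T) end.

Definition is_plus (T : trees) : bool := if T is inl _ then true else false.

Lemma homology_joinsC v : homology_trivial W (joins W v) = ~~ homology_trivial B (joins B v).
Proof. by rewrite joinsC (homology_dual o qP cocycle nonlocal check). Qed.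

Lemma tree_ofP v T : (tree_of v == T) =
  [forall c, ((c \in v) (+) (c \in vertex_of T)) ==> (c \in active_of T)].
Proof.
rewrite /tree_of; case: T => T.
  rewrite -[RHS]/(interval B (val T) v).
  case: ifP => ht; last first.
    apply/esym/negP => /(interval_homology qP check (valP T)).
    by rewrite ht.
  apply/eqP/idP => [[<-]|Tv]; first exact: (greedy_interval qP conD check).
  congr inl; apply: val_inj; apply/esym.
  exact: (interval_greedy conD check (valP T)).
rewrite -[RHS]/(interval W (val T) v).
case: ifP => ht.
  apply/esym/negP => /(interval_homology qP checkW (valP T)).
  by rewrite homology_joinsC ht.
apply/eqP/idP => [[<-]|Tv].
  by apply: (greedy_interval qP conD checkW); rewrite homology_joinsC ht.
congr inr; apply: val_inj; apply/esym.
exact: (interval_greedy conD checkW (valP T)).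
Qed.

Lemma tree_of_interval v :
  [forall c, ((c \in v) (+) (c \in vertex_of (tree_of v))) ==> (c \in active_of (tree_of v))].
Proof. by rewrite -tree_ofP. Qed.

Lemma active_of_differ v c : c \in active_of (tree_of v) ->
  (c \in v) (+) (c \in vertex_of (tree_of v)) -> differ v c.
Proof.
have := tree_of_interval v; case: (tree_of v) => T /= Tv.
  exact: (active_differ o qP cocycle nonlocal conD check (valP T) Tv).
exact: (active_differ o qP cocycle nonlocal conD checkW (valP T) Tv).
Qed.

Lemma vertex_of_same T d d' : same (vertex_of T) d d'.
Proof.
case: T => T /=; first exact: (tree_vertex_same check _ _ (valP T)).
exact: (tree_vertex_same checkW _ _ (valP T)).
Qed.

Lemma card_vertices : (#|vertices (tait B)| + #|vertices (tait W)|)%N = (ncross D).+1.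
Proof.
rewrite -(card_regions o p planar conD nonlocal) /=.
have -> : regions D = [set region x | x in B] :|: [set region x | x in W].
  rewrite -imsetU setUCr; apply/setP => R.
  by apply/imsetP/imsetP => -[x _ ->]; exists x.
rewrite cardsU disjoint_setI0 ?cards0 ?subn0 //.
rewrite -setI_eq0; apply/eqP/setP => R; rewrite !inE.
apply/andP => -[/imsetP[x xB ->] /imsetP[y yW /eqP]].
rewrite region_eq => xy; move: yW; rewrite inE.
apply/negP; rewrite negbK.
by apply: (connect_ind (P := fun y => y \in B) _ _ xy) => // a b aB /(black_adj check)<-.
Qed.

Let inh : inhabited (dart D) := inhabits p.

(** Every toggle on the way from the one-circle vertex of the tree to v adds a circle. *)
Lemma odd_circles v : odd #|circles v| =
  ~~ odd #|v| (+) odd #|vertex_of (tree_of v)|.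
Proof.
set T := tree_of v; set A := [set c | (c \in v) (+) (c \in vertex_of T)].
have TT : tree_of (vertex_of T) = T.
  by apply/eqP; rewrite tree_ofP; apply/forallP => c; rewrite addbb.
have vE : v = [set c | (c \in vertex_of T) (+) (c \in A)].
  by apply/setP => c; rewrite !inE addbC addbK.
rewrite {1}vE (circles_toggle tree_ofP active_of_differ); first last.
- by move=> c _; rewrite /toggled TT addbb.
- rewrite TT; apply/subsetP => c; rewrite inE => cA.
  by have /forallP/(_ c) := tree_of_interval v; rewrite -/T cA.
rewrite (_ : circles _ = [set circle (vertex_of T) p]); last first.
  apply/setP => z; rewrite in_set1; apply/imsetP/eqP => [[d _ ->]|->].
    by apply/eqP; rewrite circle_eq vertex_of_same.
  by exists p.
by rewrite cards1 oddD odd_card_addb addTb addNb.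
Qed.

(** By [card_joins] the sum is, modulo 2, the number of crossings plus the numbers of edges of both
    trees, that is [2 * ncross D - 1]. So the parity of a one-circle vertex determines the color. *)
Lemma odd_vertices (T : tree (tait B)) (T' : tree (tait W)) :
  odd (#|joins B (val T)| + #|joins W (val T')|).
Proof.
have := card_joins B (val T); have := card_joins W (val T').
have := card_tait_tree check inh (valP T); have := card_tait_tree checkW inh (valP T').
have := card_vertices.
have : (num_edges B true + num_edges W true)%N = ncross D.
  rewrite -[RHS]card_ord -(cardsT (crossing D)).
  rewrite -(cardsID [set c | edge_sign B c] setT); congr (_ + _)%N;
    by apply: eq_card => c; rewrite !inE ?andbT ?eqb_id /edge_sign ?in_setC.
set h := #|joins B _|; set h' := #|joins W _|.
set t := #|[set e in val T | _]|; set t' := #|[set e in val T' | _]|.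
move: h h' t t' => h h' t t'; lia.
Qed.

Lemma tree_of_step v c : c \notin v -> differ v c || differ (flip v c) c ->
  tree_of (flip v c) != tree_of v ->
  (binary (vertex_of (tree_of v)) < binary (vertex_of (tree_of (flip v c))))%N /\
  is_plus (tree_of v) = is_plus (tree_of (flip v c)).
Proof.
move=> cv dif; have := tree_of_interval v; have := tree_of_interval (flip v c).
have := odd_circles v; have := odd_circles (flip v c).
have cf : #|flip v c| = #|v|.+1.
  by have := card_flip v c; rewrite cv (negPf cv) addn0 addn1.
have oc : odd #|circles (flip v c)| = ~~ odd #|circles v|.
  have := differ_card v c; have [dv|nv] := boolP (differ v c).
    by rewrite (negPf (differ_flip dv)) addn0 addn1 => <-; rewrite /= negbK.
  by move: dif; rewrite (negPf nv) /= => -> ; rewrite addn0 addn1 => ->.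
rewrite oc cf => /= o1 o2; move: o1; rewrite o2 {o2}.
case: (tree_of v) => T; case: (tree_of (flip v c)) => T' /= o1 T'v Tv TT'.
- split=> //; apply: (interval_step check (valP T) (valP T') Tv T'v cv).
  by apply: contra_neq TT' => /val_inj->.
- have := odd_vertices T T'; move: o1; rewrite oddD -/W.
  by case: (odd #|v|); case: (odd _); case: (odd _).
- have := odd_vertices T' T; move: o1; rewrite oddD -/W.
  by case: (odd #|v|); case: (odd _); case: (odd _).
- split=> //; apply: (interval_step checkW (valP T) (valP T') Tv T'v cv).
  by apply: contra_neq TT' => /val_inj->.
Qed.

End TwoTaitGraphs.

(** * The reduced Khovanov complex as an abstract state space *)

Section Reduced.
Variables (D : rotation_system) (p : dart D).

Definition rs_res (s : reduced_state p) : {set crossing D} := (val (val s)).1.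
Definition rs_labels (s : reduced_state p) : {set {set dart D}} := (val (val s)).2.

Lemma rs_valid s : valid p (rs_res s) (rs_labels s).
Proof. by apply/andP; split; [exact: (valP (val s))|exact: (valP s)]. Qed.

Lemma rs_surj v x : valid p v x -> exists s, rs_res s = v /\ rs_labels s = x.
Proof.
case/andP=> xv px.
by exists (exist _ (exist _ (v, x) xv : state D) px : reduced_state p).
Qed.

Lemma rs_inj s t : rs_res s = rs_res t -> rs_labels s = rs_labels t -> s = t.
Proof.
move=> rst lst; do 2!apply: val_inj.
rewrite [LHS]surjective_pairing [RHS]surjective_pairing.
by rewrite -[(val (val s)).1]/(rs_res s) rst -[(val (val s)).2]/(rs_labels s) lst.
Qed.

Definition reduced_space : state_space p := StateSpace rs_valid rs_surj rs_inj.

Lemma khd_coef (S : state_space p) (s t : S) : khd S (basis_vec s) t =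
  ([exists c, (c \notin res s) && (res t == c |: res s)] &&
   smooth_incidence (res s) (labels s) (res t) (labels t))%:R.
Proof.
rewrite /khd sum_lfunE sum_ffunE.
transitivity (\sum_(c <- enum (crossing D)) (((c \notin res s) &&
  (res t == flip (res s) c)) && smooth_incidence (res s) (labels s) (res t) (labels t))%:R : F2).
  apply: eq_bigr => c _; rewrite endo_mulE on_basisE.
  case: ifP => _ /=; last by rewrite linear0 ffunE.
  by rewrite extend_basis.
case: existsP => [[c /andP[cs /eqP tE]]|no]; last first.
  apply: big1 => c _.
  case cs: ((c \notin res s) && (res t == flip (res s) c)) => //=.
  by case: no; exists c; case/andP: cs => cs; rewrite flip_add // cs.
rewrite big_enum (bigD1 c) //= cs tE -(flip_add cs) eqxx /= big1 ?addr0 // => e ec.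
have [es|//] := boolP (e \notin res s).
case: eqP => // /setP/(_ e).
by rewrite !in_flip eqxx (negPf ec) (negPf es).
Qed.

Lemma reduced_differentialE : reduced_differential p = khd reduced_space.
Proof.
apply: lfun_eq_basis => s; apply/ffunP => t.
rewrite (khd_coef (S := reduced_space)) /reduced_differential extend_basis.
congr (_%:R); rewrite /incidence /smooth_incidence /= /rs_res /rs_labels /=.
by case: (sval (sval s)) => v x; case: (sval (sval t)) => w y.
Qed.

End Reduced.

Lemma homogeneous_map (A A' : zmodType) (phi : A -> A') (I J : finType)
    (degI : I -> A) (degJ : J -> A) (degI' : I -> A') (degJ' : J -> A') k k'
    (f : 'Hom(fspace I, fspace J)) :
  (forall i, degI' i = phi (degI i)) -> (forall j, degJ' j = phi (degJ j)) ->
  (forall x, phi (x + k) = phi x + k') ->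
  homogeneous degI degJ k f -> homogeneous degI' degJ' k' f.
Proof. by move=> hI hJ hk hf i j /hf e; rewrite hI hJ e hk. Qed.

Lemma direct_sum_split (I J : finType) (d : 'End(fspace (I + J)%type)) :
  (forall i j, d (basis_vec (inl i)) (inr j) = 0) ->
  (forall i j, d (basis_vec (inr j)) (inl i) = 0) -> (d \o d = 0)%VF ->
  exists (f : 'End(fspace I)) (g : 'End(fspace J)),
    [/\ d = direct_sum f g,
        forall i i', f (basis_vec i) i' = d (basis_vec (inl i)) (inl i'),
        forall j j', g (basis_vec j) j' = d (basis_vec (inr j)) (inr j'),
        (f \o f = 0)%VF & (g \o g = 0)%VF].
Proof.
move=> dIJ dJI dd.
have d2 a b : \sum_c d (basis_vec a) c * d (basis_vec c) b = 0.
  by rewrite -lfun_coord -comp_lfunE dd lfunE /= ffunE.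
pose f : 'End(fspace I) := extend (fun i i' => d (basis_vec (inl i)) (inl i')).
pose g : 'End(fspace J) := extend (fun j j' => d (basis_vec (inr j)) (inr j')).
have fE i i' : f (basis_vec i) i' = d (basis_vec (inl i)) (inl i').
  exact: extend_basis.
have gE j j' : g (basis_vec j) j' = d (basis_vec (inr j)) (inr j').
  exact: extend_basis.
exists f, g; split=> //.
- apply: lfun_eq_basis => a; apply/ffunP => b; rewrite extend_basis.
  by case: a b => [i|j] [i'|j'].
- apply: lfun_eq_basis => i; apply/ffunP => i'.
  rewrite comp_lfunE lfun_coord [in RHS]lfunE /= [in RHS]ffunE.
  transitivity (\sum_c d (basis_vec (inl i)) c * d (basis_vec c) (inl i')); last exact: d2.
  rewrite big_sumType /= [X in _ = _ + X]big1 ?addr0 => [|j _].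
    by apply: eq_bigr => k _; rewrite !fE.
  by rewrite dIJ mul0r.
- apply: lfun_eq_basis => j; apply/ffunP => j'.
  rewrite comp_lfunE lfun_coord [in RHS]lfunE /= [in RHS]ffunE.
  transitivity (\sum_c d (basis_vec (inr j)) c * d (basis_vec c) (inr j')); last exact: d2.
  rewrite big_sumType /= [X in _ = X + _]big1 ?add0r => [|i _].
    by apply: eq_bigr => k _; rewrite !gE.
  by rewrite dJI mul0r.
Qed.

Lemma tree_complex (D : rotation_system) (o : orientation D) (p : dart D)
    (B : {set dart D}) :
  in_RP2 D -> connected_diagram D -> ~ local_diagram D -> @checkerboard D B ->
  exists (dplus : 'End(fspace (tree (tait B))))
         (dminus : 'End(fspace (tree (tait (~: B))))),
    [/\ homogeneous (@bidegree D B true) (@bidegree D B true)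
          (-1, -1) dplus
        /\ (dplus \o dplus = 0)%VF,
        homogeneous (@bidegree D (~: B) false)
          (@bidegree D (~: B) false) (1, 1) dminus
        /\ (dminus \o dminus = 0)%VF
      & deformation_retract
          (sum_degree (@tree_degree D B o true)
                      (@tree_degree D (~: B) o false))
          (direct_sum dplus dminus)
          (@state_degree D o p) (reduced_differential p)].
Proof.
move=> planar conD nonlocal check; have [q qP] := region_potential D.
have trP := tree_ofP o p planar conD nonlocal qP check.
have dif := @active_of_differ D o p q planar conD nonlocal qP B check.
have single := @vertex_of_same D B check.
have step := @tree_of_step D o p q planar conD nonlocal qP B check.
have [dI [r [f [h [[dIh dI2] [rh rc] [fh fc] rf [hh hr]]]]]] :=
  block_retract (reduced_space p) trP dif single
    (rho := fun T : trees B => binary (vertex_of T)) step.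
pose top := vmax (@vertex_of D B) (@active_of D B).
have card_top (T : trees B) : #|circles (top T)| = (1 + #|active_of T|)%N.
  exact: (circles_vmax p trP dif single).
pose merged (T : trees B) := #|active_of T :&: vertex_of T|.
have deg (T T' : trees B) : dI (basis_vec T) T' != 0 ->
    [/\ #|top T'|%:Z = #|top T|%:Z + 1,
        #|active_of T'|%:Z - 2 * (merged T')%:Z =
        #|active_of T|%:Z - 2 * (merged T)%:Z - 1
      & is_plus T' = is_plus T].
  move=> /dIh e; split.
  - exact: (congr1 (fun x : int * int * int => x.1.1) e).
  - have : #|circles (top T')|%:Z - (2 * (merged T' + 1))%N%:Z =
        #|circles (top T)|%:Z - (2 * (merged T + 1))%N%:Z - 1.
      exact: (congr1 (fun x : int * int * int => x.1.2) e).
    rewrite !card_top; move: (merged T) (merged T') => m m'.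
    by move: #|active_of T| #|active_of T'| => k k'; lia.
  - have : (is_plus T')%:Z = (is_plus T)%:Z + 0.
      exact: (congr1 (fun x : int * int * int => x.2) e).
    by rewrite addr0; case: (is_plus T'); case: (is_plus T).
have [dp [dm [dE dpE dmE dp2 dm2]]] : exists (f : 'End(fspace (tree (tait B))))
    (g : 'End(fspace (tree (tait (~: B))))),
    [/\ dI = direct_sum f g,
        forall i i', f (basis_vec i) i' = dI (basis_vec (inl i)) (inl i'),
        forall j j', g (basis_vec j) j' = dI (basis_vec (inr j)) (inr j'),
        (f \o f = 0)%VF & (g \o g = 0)%VF].
  apply: direct_sum_split => // i j; apply/eqP; apply: contraT;
    by case/deg=> _ _.
exists dp, dm; split; [split=> // T T' | split=> // T T' |].
- rewrite dpE => /deg[e1 e2 _].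
  exact: (@bidegreeE D B check (inhabits p) true T T' e1 e2).
- rewrite dmE => /deg[e1 e2 _].
  exact: (@bidegreeE D (~: B) (checkerboardC check) (inhabits p) false T T' e1 e2).
(* Of the three gradings only the number of B-smoothings enters the cohomological degree. *)
pose phi (x : int * int * int) : rat := (x.1.1 - (n_minus o)%:Z)%:~R.
have phi_shift a b c x : phi (x + (a, b, c)) = phi x + a%:~R.
  by rewrite /phi -intrD /= addrAC.
have hI T : sum_degree (@tree_degree D B o true) (@tree_degree D (~: B) o false) T =
    phi (degI (@vertex_of D B) (@active_of D B) (@is_plus D B) T).
  case: T => T; first exact: (tree_degreeE o check (inhabits p)).
  exact: (tree_degreeE o (checkerboardC check) (inhabits p)).
rewrite reduced_differentialE.
exists r, f, h; rewrite -dE; split=> //.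
- split=> //; apply: (homogeneous_map (phi := phi) _ hI _ rh) => // x.
  by rewrite !addr0.
- split=> //; apply: (homogeneous_map (phi := phi) hI _ _ fh) => // x.
  by rewrite !addr0.
- split=> //; apply: (homogeneous_map (phi := phi) _ _ _ hh) => // x.
  exact: (phi_shift (-1) 1 0).
Qed.

Lemma plus_coloring_exists (D : rotation_system) (B : {set dart D}) :
  @checkerboard D B -> exists black : {set dart D}, plus_coloring black.
Proof.
move=> check; have numC s : num_edges (~: B) s = num_edges B (~~ s).
  apply: eq_card => c; rewrite !inE /edge_sign in_setC.
  by case: (_ \in _); case: s.
have [le|lt] := leqP (num_edges B false) (num_edges B true); first by exists B.
exists (~: B); split; first exact: checkerboardC.
by rewrite !numC; exact: ltnW.
Qed.

Theorem theorem6p10 (D : diagram) (o : orientation D) (p : dart D) :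
  connected_diagram D -> ~ local_diagram D -> nullhomologous o ->
  (exists black : {set dart D}, plus_coloring black) /\
  forall black : {set dart D}, plus_coloring black ->
  exists (dplus : 'End(fspace (tree (tait black))))
         (dminus : 'End(fspace (tree (tait (~: black))))),
    [/\ homogeneous (@bidegree D black true) (@bidegree D black true)
          (-1, -1) dplus
        /\ (dplus \o dplus = 0)%VF,
        homogeneous (@bidegree D (~: black) false)
          (@bidegree D (~: black) false) (1, 1) dminus
        /\ (dminus \o dminus = 0)%VF
      & deformation_retract
          (sum_degree (@tree_degree D black o true)
                      (@tree_degree D (~: black) o false))
          (direct_sum dplus dminus)
          (@state_degree D o p) (reduced_differential p)].
Proof.
move=> conD nonlocal null; have planar := diagram_in_RP2 D; split.
  have [B check] := coloring_exists p planar conD nonlocal null.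
  exact: plus_coloring_exists check.
by move=> B [check _]; exact: tree_complex.
Qed.
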